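(* Let $\mathbb{D}=\{z\in\mathbb{C}:|z|<1\}$, let $A^2(\mathbb{D})$ be the Bergman space, and let $\mathbb{P}_K$ be the Bergman determinantal point process on $\mathbb{D}$ (both defined in the context). For any $1<s<3/2$ and any $z\in\mathbb{D}$, \[ \mathbb{P}_K\Big(\Big\{X\in\mathrm{Conf}(\mathbb{D})\,\Big|\,\sum_{k=0}^\infty\sum_{x\in X,\ k\le d_{\mathrm{h}}(z,x)<k+1}e^{-sd_{\mathrm{h}}(z,x)}f(x)\ \text{converges for all } f\in A^2(\mathbb{D})\Big\}\Big)=0. \]
   Context: $\mu$ denotes the normalized Lebesgue measure $\mathrm{d}\mu=\frac{1}{\pi}\mathrm{d}x\,\mathrm{d}y$ on $\mathbb{D}$. $A^2(\mathbb{D})$ is the Hilbert space of holomorphic $f:\mathbb{D}\to\mathbb{C}$ with $\int_{\mathbb{D}}|f|^2\,\mathrm{d}\mu<\infty$; its reproducing kernel is $K(z,w)=(1-z\overline{w})^{-2}$. $\mathrm{Conf}(\mathbb{D})$ is the space of locally finite configurations (locally finite subsets) of $\mathbb{D}$, and $\mathbb{P}_K$ is the determinantal point process on $\mathbb{D}$ with kernel $K$ with respect to $\mu$, i.e. its $k$-point correlation functions with respect to $\mu^{\otimes k}$ are $\rho_k(x_1,\dots,x_k)=\det[K(x_i,x_j)]_{1\le i,j\le k}$. The hyperbolic distance is $d_{\mathrm{h}}(z,x)=\log\frac{1+|\varphi_z(x)|}{1-|\varphi_z(x)|}$ with $\varphi_z(x)=\frac{z-x}{1-\overline{z}x}$.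 For each $k$ the inner sum is a finite sum, and ''converges'' refers to convergence of the series over $k$. *)

(* Defs.v *)
From HB Require Import structures.
From mathcomp Require Import all_boot all_order all_algebra.
From mathcomp Require Import all_classical all_reals all_analysis measurable_realfun.
From mathcomp Require Import complex.

Set Implicit Arguments.
Unset Strict Implicit.
Unset Printing Implicit Defensive.

Import Order.TTheory GRing.Theory Num.Theory.
Import numFieldNormedType.Exports.

Local Open Scope classical_set_scope.
Local Open Scope ring_scope.
Local Open Scope complex_scope.

Section Bergman.
Variable R : realType.

Definition toC (p : R * R) : R[i] := p.1 +i* p.2.

Definition cabs (z : R[i]) : R := Num.sqrt (complex.Re z ^+ 2 + complex.Im z ^+ 2).

Definition diskD : set (R * R) := [set p | cabs (toC p) < 1].

(* Lebesgue measure on R^2 (the product of Lebesgue measures);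
   mu = (1/pi) * leb2 is the normalized measure of the paper. *)
Definition leb2 := ((@lebesgue_measure R) \x (@lebesgue_measure R))%E.

Definition Kb (z w : R[i]) : R[i] := ((1 - z * conjc w) ^+ 2)^-1.

Definition phiz (z x : R[i]) : R[i] := (z - x) / (1 - conjc z * x).
Definition dh (z x : R * R) : R :=
  ln ((1 + cabs (phiz (toC z) (toC x))) / (1 - cabs (phiz (toC z) (toC x)))).

Definition holomorphic_on (D : set (R * R)) (f : R * R -> R[i]) : Prop :=
  forall z, D z -> exists f' : R[i], forall e : R, 0 < e ->
    exists2 del : R, 0 < del & forall w, D w ->
      0 < cabs (toC w - toC z) < del ->
      cabs ((f w - f z) / (toC w - toC z) - f') < e.

(* the Bergman space A^2(D) (values of f outside D are irrelevant) *)
Definition bergman (f : R * R -> R[i]) : Prop :=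
  holomorphic_on diskD f /\
  ((pi^-1)%:E * \int[leb2]_(p in diskD) ((cabs (f p)) ^+ 2)%:E < +oo)%E.

Definition is_conf (X : set (R * R)) : Prop :=
  X `<=` diskD /\
  forall Kc : set (R * R), compact Kc -> Kc `<=` diskD -> finite_set (X `&` Kc).

Definition rel_compact (B : set (R * R)) : Prop :=
  exists Kc : set (R * R), [/\ compact Kc, Kc `<=` diskD & B `<=` Kc].

Definition ncount (B X : set (R * R)) : \bar R :=
  (\esum_(x in X `&` B) 1)%E.

Definition nprod (Bs : seq (set (R * R))) (X : set (R * R)) : \bar R :=
  (\big[*%E/1%E]_(B <- Bs) ncount B X)%E.

Definition kmatrix (xs : seq (R * R)) : 'M[R[i]]_(size xs) :=
  \matrix_(i < size xs, j < size xs)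
    Kb (toC (nth (0, 0) xs i)) (toC (nth (0, 0) xs j)).
(* det of the Hermitian matrix kmatrix xs is real; rho is its real part *)
Definition rho (xs : seq (R * R)) : R := complex.Re (\det (kmatrix xs)).

(* iterated integral  int_{B_1} ... int_{B_k} F(x_1,...,x_k) dmu(x_k)...dmu(x_1)
   with mu = (1/pi) leb2; for nonnegative F this is the integral over
   B_1 x ... x B_k against mu^{(x) k} (Tonelli). *)
Fixpoint iint (Bs : seq (set (R * R))) (F : seq (R * R) -> \bar R) : \bar R :=
  match Bs with
  | [::] => F [::]
  | B :: Bs' => ((pi^-1)%:E * \int[leb2]_(x in B) iint Bs' (fun xs => F (x :: xs)))%E
  end.

(* k-point correlation functions of the random configuration X are
   rho_k = det[K(x_i,x_j)] w.r.t. mu^{(x) k}: for pairwise disjoint relatively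
   compact Borel sets B_1..B_k,
   E[ N_{B_1} ... N_{B_k} ] = int_{B_1 x ... x B_k} rho_k dmu^k. *)
Definition bergman_dpp {d} {Omega : measurableType d}
  (P : probability Omega R) (X : Omega -> set (R * R)) : Prop :=
  [/\ forall w, is_conf (X w),
      forall B, measurable B -> rel_compact B ->
        measurable_fun setT (fun w => ncount B (X w)) &
      forall Bs : seq (set (R * R)), (0 < size Bs)%N ->
        (forall B, B \in Bs -> measurable B /\ rel_compact B) ->
        (forall i j, (i < j < size Bs)%N -> nth set0 Bs i `&` nth set0 Bs j = set0) ->
        (\int[P]_w nprod Bs (X w) = iint Bs (fun xs => (rho xs)%:E))%E].

Definition block (X : set (R * R)) (z : R * R) (s : R) (f : R * R -> R[i]) (k : nat) : R[i] :=
  \sum_(x \in [set x | X x /\ (k%:R <= dh z x < k.+1%:R)]) ((expR (- (s * dh z x)))%:C * f x).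

Definition cseries_converges (a : nat -> R[i]) : Prop :=
  cvgn (series (fun k => complex.Re (a k))) /\ cvgn (series (fun k => complex.Im (a k))).

End Bergman.

(* Main.v *)
(* The k-th block is the functional [f |-> sum_x c_x f(x)] on the Bergman space,
   with [c_x = exp (- s d_h(z, x))] and [x] in the k-th annulus, and the square
   of its norm is [sum_n (n+1) |S_n|^2], where [S_n = sum_x c_x x^n].  If all the
   series converge, a gliding hump argument bounds these norms uniformly in [k].
   For [s < 3/2] this almost surely fails.  Let [1 - rho] be the largest squared
   modulus in the annulus, so that [rho] is of order [exp (- k)], and let
   [g = 1 / (1 - rho)] and [T] of order [1 / rho].  Up to a constant the squared
   norm is at least [sum_(i, j < T) g^(i+j) |S_(i+j)|^2], which equals
   [sum_(x, y) c_x c_y Re (F(x, y)^2)] with [F(x, y) = sum_(i < T) (g x conj y)^i].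
   The squares [|F|^2] are integrable enough for the off-diagonal part to have
   expectation [O(exp (- 2 s k) rho^-3)] because [rho_2 <= rho_1 rho_1], while the
   points with [1 - |x|^2] within a factor [1 + del] of [rho], about
   [del^(3/2) / rho] of them by a second moment estimate, each contribute a
   diagonal term of order [exp (- 2 s k) T^2].  With [T ~ 1 / (rho del)] the
   diagonal part is of order [del^(-1/2) exp (- 2 s k) rho^-3], so it dominates
   for small [del], and what remains grows like [exp ((3 - 2 s) k)]. *)
Require Import Defs.
From HB Require Import structures.
From mathcomp Require Import all_boot all_order all_algebra.
From mathcomp Require Import all_classical all_reals all_analysis measurable_realfun.
From mathcomp Require Import complex.
From mathcomp Require Import ring lra zify.

Set Implicit Arguments.
Unset Strict Implicit.
Unset Printing Implicit Defensive.

Import Order.TTheory GRing.Theory Num.Theory.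
Import numFieldNormedType.Exports.

Local Open Scope classical_set_scope.
Local Open Scope ring_scope.
Local Open Scope complex_scope.

(** * The modulus of a complex number *)

Section ComplexModulus.
Variable R : realType.
Implicit Types (z w : R[i]) (x : R).

(** The power [del^(3/2)] has a geometric origin. For [z] other than 0 the hyperbolic disc about [z]
    is a Euclidean disc not centred at 0, so its modulus peaks in the direction of [z] only. Moving
    off that direction by a transverse distance [h] changes the attainable [1 - |x|^2] by a factor
    [1 + O(h^2)], so the useful points fill a sector of width of order [sqrt del] and radial
    thickness of order [rho del]; the density [rho^-2] then gives the count. The form in [i + j]
    replaces [sum_n (n+1) |S_n|^2] because its kernel is a square [F^2], and Parseval computes the
    integral of [|F|^2]. Over an annulus of thickness [O(rho)] this integral is only [O(rho)], which
    turns the density factor [rho^-4] into [rho^-3], the same power as in the diagonal part; the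
    comparison is then decided by the choice of [del] alone. Each bound [M] and each tolerance [eps]
    get a single annulus, chosen after [del], whose norm exceeds [M] outside an event of probability
    at most [eps]. So the configurations with all norms at most [M] form a null set, and countably
    many of these sets cover the event of convergence. *)

Lemma cabsE z : (cabs z)%:C = `|z|.
Proof. by rewrite normc_def. Qed.

Lemma cabs_ge0 z : 0 <= cabs z.
Proof. exact: sqrtr_ge0. Qed.

Lemma cabsM z w : cabs (z * w) = cabs z * cabs w.
Proof. by apply: complexI; rewrite rmorphM /= !cabsE normrM. Qed.

Lemma cabsX z n : cabs (z ^+ n) = cabs z ^+ n.
Proof. by apply: complexI; rewrite rmorphXn /= !cabsE normrX. Qed.

Lemma cabsV z : cabs z^-1 = (cabs z)^-1.
Proof. by apply: complexI; rewrite fmorphV /= !cabsE normfV. Qed.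

Lemma cabsN z : cabs (- z) = cabs z.
Proof. by apply: complexI; rewrite !cabsE normrN. Qed.

Lemma cabsBC z w : cabs (z - w) = cabs (w - z).
Proof. by rewrite -cabsN opprB. Qed.

Lemma cabsJ z : cabs (conjc z) = cabs z.
Proof. by apply: complexI; rewrite !cabsE normcJ. Qed.

Lemma cabs0 : cabs (0 : R[i]) = 0.
Proof. by apply: complexI; rewrite cabsE normr0. Qed.

Lemma cabs1 : cabs (1 : R[i]) = 1.
Proof. by apply: complexI; rewrite cabsE normr1. Qed.

Lemma cabs_real x : cabs x%:C = `|x|.
Proof. by rewrite /cabs /= expr0n addr0 sqrtr_sqr. Qed.

Lemma cabs_eq0 z : (cabs z == 0) = (z == 0).
Proof.
by rewrite -(inj_eq (@complexI R)) cabsE -[X in _ == X]/(0 : R[i]) normr_eq0.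
Qed.

Lemma cabs_gt0 z : (0 < cabs z) = (z != 0).
Proof. by rewrite lt_def cabs_ge0 andbT cabs_eq0. Qed.

Lemma le_cabsD z w : cabs (z + w) <= cabs z + cabs w.
Proof. by rewrite -lecR rmorphD /= !cabsE ler_normD. Qed.

Lemma le_cabsB z w : cabs z - cabs w <= cabs (z - w).
Proof. by rewrite -lecR rmorphB /= !cabsE lerB_dist. Qed.

Lemma le_cabs_sum (I : Type) (r : seq I) (P : pred I) (F : I -> R[i]) :
  cabs (\sum_(i <- r | P i) F i) <= \sum_(i <- r | P i) cabs (F i).
Proof.
elim/big_rec2 : _ => [|i x y _ h]; first by rewrite cabs0.
by rewrite (le_trans (le_cabsD _ _))// lerD2l.
Qed.

Lemma cabs_sqr z : cabs z ^+ 2 = complex.Re z ^+ 2 + complex.Im z ^+ 2.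
Proof. by rewrite sqr_sqrtr// addr_ge0// sqr_ge0. Qed.

Lemma cabs_sqrC z : (cabs z ^+ 2)%:C = z * conjc z.
Proof. by rewrite -sqr_normc -cabsE -rmorphXn. Qed.

Lemma Re_le_cabs z : `|complex.Re z| <= cabs z.
Proof. by rewrite -sqrtr_sqr ler_wsqrtr// lerDl sqr_ge0. Qed.

Lemma Im_le_cabs z : `|complex.Im z| <= cabs z.
Proof. by rewrite -sqrtr_sqr ler_wsqrtr// lerDr sqr_ge0. Qed.

Lemma cabs_le_ReIm z : cabs z <= `|complex.Re z| + `|complex.Im z|.
Proof.
rewrite -(@ler_pXn2r _ 2)// ?nnegrE ?cabs_ge0// ?addr_ge0//.
rewrite cabs_sqr -(real_normK (num_real (complex.Re z))).
rewrite -(real_normK (num_real (complex.Im z))) sqrrD.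
have := mulr_ge0 (normr_ge0 (complex.Re z)) (normr_ge0 (complex.Im z)); lra.
Qed.

Lemma ReD z w : complex.Re (z + w) = complex.Re z + complex.Re w.
Proof. by case: z => ? ?; case: w. Qed.

Lemma ImD z w : complex.Im (z + w) = complex.Im z + complex.Im w.
Proof. by case: z => ? ?; case: w. Qed.

Lemma Re_sum (I : Type) (r : seq I) (P : pred I) (F : I -> R[i]) :
  complex.Re (\sum_(i <- r | P i) F i) = \sum_(i <- r | P i) complex.Re (F i).
Proof. exact: (big_morph _ ReD). Qed.

Lemma Im_sum (I : Type) (r : seq I) (P : pred I) (F : I -> R[i]) :
  complex.Im (\sum_(i <- r | P i) F i) = \sum_(i <- r | P i) complex.Im (F i).
Proof. exact: (big_morph _ ImD). Qed.

Definition nsq (p : R * R) : R := p.1 ^+ 2 + p.2 ^+ 2.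

Lemma nsqE p : nsq p = cabs (toC p) ^+ 2.
Proof. by rewrite cabs_sqr. Qed.

Lemma nsq_ge0 p : 0 <= nsq p.
Proof. by rewrite nsqE sqr_ge0. Qed.

Lemma nsq_lt1 p : (nsq p < 1) = (cabs (toC p) < 1).
Proof. by rewrite nsqE expr_lt1// cabs_ge0. Qed.

(** A finite stand-in for integration over the angle: a cross term [i != j] is a geometric sum with
    ratio [w ^+ i * conjc w ^+ j], an [M]-th root of unity different from 1, and such a sum
    vanishes. *)
Lemma finite_parseval (w : R[i]) (M T : nat) (b : nat -> R[i]) :
  cabs w = 1 -> w ^+ M = 1 ->
  (forall n, (0 < n < T)%N -> w ^+ n != 1) ->
  \sum_(l < M) cabs (\sum_(j < T) b j * w ^+ (l * j)) ^+ 2 =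
  M%:R * \sum_(j < T) cabs (b j) ^+ 2.
Proof.
move=> w1 wM wT; apply: complexI.
have wJ : w * conjc w = 1 by rewrite -cabs_sqrC w1 expr1n.
rewrite rmorph_sum rmorphM rmorph_sum /= rmorph_nat.
under eq_bigr => l _.
  rewrite cabs_sqrC [conjc _]rmorph_sum /= big_distrlr /=; over.
under [in RHS]eq_bigr => j _ do rewrite cabs_sqrC.
rewrite exchange_big /= mulr_sumr; apply: eq_bigr => i _.
rewrite exchange_big /= (bigD1 i)//= [X in _ + X]big1 ?addr0 => [|j ji].
  under eq_bigr => l _.
    rewrite rmorphM rmorphXn /= mulrACA -exprMn wJ expr1n mulr1; over.
  by rewrite sumr_const card_ord mulr_natl.
under eq_bigr => l _.
  rewrite rmorphM rmorphXn /= mulrACA mulnC exprM mulnC exprM -exprMn; over.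
rewrite -mulr_sumr.
set q := (X in \sum_(_ < _) X ^+ _).
have qM : q ^+ M = 1.
  rewrite /q exprMn -!exprM ![(_ * M)%N]mulnC !exprM wM.
  have -> : conjc w ^+ M = 1 by rewrite -rmorphXn wM rmorph1.
  by rewrite !expr1n mulr1.
have q1 : q - 1 != 0.
  rewrite subr_eq0 /q; apply/eqP => q1.
  have [ij|ij|/eqP] := ltngtP i j; last by rewrite eq_sym val_eqE (negPf ji).
    have : w ^+ (j - i) = 1.
      rewrite -[RHS]conjc1 -q1 rmorphM !rmorphXn /= conjcK.
      rewrite -[in RHS](subnK (ltnW ij)) exprD mulrCA.
      by rewrite -exprMn mulrC (mulrC _ w) wJ expr1n mul1r.
    by move/eqP; rewrite (negPf (wT _ _))// subn_gt0 ij (leq_ltn_trans (leq_subr _ _)).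
  have : w ^+ (i - j) = 1.
    rewrite -q1 -[in RHS](subnK (ltnW ij)) exprD -mulrA.
    by rewrite -exprMn wJ expr1n mulr1.
  by move/eqP; rewrite (negPf (wT _ _))// subn_gt0 ij (leq_ltn_trans (leq_subr _ _)).
have := subrX1 q M; rewrite qM subrr => /esym/eqP.
by rewrite mulf_eq0 (negPf q1) /= => /eqP ->; rewrite mulr0.
Qed.

Lemma cos_eq1_gt0_lt2pi (x : R) : 0 < x < 2 * pi -> cos x != 1.
Proof.
move=> /andP[x0 x2].
have -> : x = (x / 2) *+ 2 by rewrite -mulr_natr mulfVK.
have : 0 < sin (x / 2).
  by apply: sin_gt0_pi; rewrite divr_gt0//= ltr_pdivrMr// mulrC.
rewrite mulr2n cosD -!expr2 cos2sin2; set s := sin _ => s0.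
by apply/eqP => h; have := exprn_gt0 2 s0; lra.
Qed.

Lemma exists_root_of_unity (M : nat) : (0 < M)%N ->
  exists w : R[i], [/\ cabs w = 1, w ^+ M = 1 &
    forall n, (0 < n < M)%N -> w ^+ n != 1].
Proof.
move=> M0; pose t : R := 2 * pi / M%:R.
have M0' : 0 < M%:R :> R by rewrite ltr0n.
have wn n : (cos t +i* sin t) ^+ n = cos (t * n%:R) +i* sin (t * n%:R) :> R[i].
  elim: n => [|n ih]; first by rewrite mulr0 cos0 sin0.
  rewrite exprS ih -[in RHS]natr1 mulrDr mulr1 cosD sinD.
  by apply/eqP; rewrite eq_complex /=; apply/andP; split; apply/eqP; ring.
exists (cos t +i* sin t); split.
- by rewrite /cabs /= cos2Dsin2 sqrtr1.
- rewrite wn /t mulfVK ?gt_eqF//.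
  by rewrite mulr_natl cos2pi sin2pi.
- move=> n /andP[n0 nM]; rewrite wn; apply/eqP => -[/eqP h _]; move: h.
  apply/negP/cos_eq1_gt0_lt2pi; rewrite /t mulr_gt0 ?ltr0n ?divr_gt0 ?mulr_gt0 ?pi_gt0//=.
  by rewrite mulrAC ltr_pdivrMr// ltr_pM2l ?mulr_gt0 ?pi_gt0// ltr_nat.
Qed.

End ComplexModulus.

(** * Rotations and dilations of planar Lebesgue measure *)

Section PlaneMeasure.
Variable R : realType.
HB.instance Definition _ := Measure.on (@leb2 R).

Lemma leb1_affine (a c : R) (A : set R) : a != 0 -> measurable A ->
  lebesgue_measure A =
    (`|a|%:E * lebesgue_measure ((fun x : R => (a * x + c)%R) @^-1` A))%E.
Proof.
move=> a0 mA.
pose f := fun x : measurableTypeR R => a * x + c : measurableTypeR R.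
have mf : measurable_fun setT f.
  by apply/measurable_funD => //; apply/measurable_funM => //.
pose m := mscale (NngNum (normr_ge0 a)) (pushforward lebesgue_measure f)
  : {measure set (measurableTypeR R) -> \bar R}.
have -> : lebesgue_measure A = m mf A.
  apply: lebesgue_measure_unique => // X [[u v]] _ <-.
  rewrite /m /= /mscale /= /pushforward /f/=.
  have [a1|a1] := ltP 0 a.
    have -> : (fun x : R => a * x + c) @^-1` `]u, v] =
        `](u - c)/a, (v - c)/a]%classic.
      rewrite eqEsubset; split=> x /=; rewrite !in_itv /= => /andP[h1 h2].
        by apply/andP; split; [rewrite ltr_pdivrMr//|rewrite ler_pdivlMr//]; lra.
      apply/andP; split; [move: h1; rewrite ltr_pdivrMr//|
        move: h2; rewrite ler_pdivlMr//]; lra.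
    rewrite !lebesgue_measure_itv /= !lte_fin ltr_pM2r ?invr_gt0//.
    rewrite ltrD2r; case: ifPn => _; last by rewrite mule0.
    by rewrite -!EFinB -EFinM gtr0_norm//; congr EFin; field.
  have {}a1 : a < 0 by rewrite lt_neqAle a0.
  have -> : (fun x : R => a * x + c) @^-1` `]u, v] =
      `[(v - c)/a, (u - c)/a[%classic.
    rewrite eqEsubset; split=> x /=; rewrite !in_itv /= => /andP[h1 h2].
      by apply/andP; split; [rewrite ler_ndivrMr//|rewrite ltr_ndivlMr//]; lra.
    apply/andP; split; [move: h2; rewrite ltr_ndivlMr//|
      move: h1; rewrite ler_ndivrMr//]; lra.
  rewrite !lebesgue_measure_itv /= !lte_fin ltr_nM2r ?invr_lt0//.
  rewrite ltrD2r; case: ifPn => _; last by rewrite mule0.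
  by rewrite -!EFinB -EFinM ltr0_norm//; congr EFin; field.
by rewrite /m /= /mscale /= /pushforward /f.
Qed.

Lemma leb2E1 (A : set (R * R)) :
  leb2 A = (\int[lebesgue_measure]_x lebesgue_measure (xsection A x))%E.
Proof. by []. Qed.

Lemma leb2E2 (A : set (R * R)) : measurable A ->
  leb2 A = (\int[lebesgue_measure]_y lebesgue_measure (ysection A y))%E.
Proof.
move=> mA; have := product_measure_unique (m1:=@lebesgue_measure R)
  (m2:=@lebesgue_measure R)
  (m' := product_measure2 (@lebesgue_measure R)(@lebesgue_measure R)).
move=> /(_ _ A mA); apply=> B C mB mC; exact: product_measure2E.
Qed.

Lemma measurable_affine1 (a : R) (g : R -> R) : measurable_fun setT g ->
  measurable_fun setT (fun p : R * R => (a * p.1 + g p.2, p.2)).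
Proof.
move=> mg; apply/measurable_fun_pair => //.
by apply/measurable_funD; [apply/measurable_funM|exact/(measurableT_comp mg)].
Qed.

Lemma measurable_affine2 (a : R) (g : R -> R) : measurable_fun setT g ->
  measurable_fun setT (fun p : R * R => (p.1, a * p.2 + g p.1)).
Proof.
move=> mg; apply/measurable_fun_pair => //.
by apply/measurable_funD; [apply/measurable_funM|exact/(measurableT_comp mg)].
Qed.

(** Cavalieri's principle: on each horizontal slice the map is affine in one variable, and the shift
    [g p.2] is constant there. *)
Lemma leb2_affine1 (a : R) (g : R -> R) (A : set (R * R)) : a != 0 ->
  measurable_fun setT g -> measurable A ->
  leb2 A = (`|a|%:E *
    leb2 ((fun p : R * R => ((a * p.1 + g p.2)%R, p.2)) @^-1` A))%E.
Proof.
move=> a0 mg mA.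
have mB : measurable ((fun p : R * R => ((a * p.1 + g p.2)%R, p.2)) @^-1` A).
  by rewrite -[X in measurable X]setTI; exact: (measurable_affine1 a mg).
rewrite !leb2E2// -ge0_integralZl//; last exact: measurable_fun_ysection.
apply: eq_integral => y _.
rewrite (@leb1_affine a (g y))//; last exact: measurable_ysection.
Qed.

Lemma leb2_affine2 (a : R) (g : R -> R) (A : set (R * R)) : a != 0 ->
  measurable_fun setT g -> measurable A ->
  leb2 A = (`|a|%:E *
    leb2 ((fun p : R * R => (p.1, (a * p.2 + g p.1)%R)) @^-1` A))%E.
Proof.
move=> a0 mg mA.
have mB : measurable ((fun p : R * R => (p.1, (a * p.2 + g p.1)%R)) @^-1` A).
  by rewrite -[X in measurable X]setTI; exact: (measurable_affine2 a mg).
rewrite !leb2E1// -ge0_integralZl//; last exact: measurable_fun_xsection.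
apply: eq_integral => y _.
rewrite (@leb1_affine a (g y))//; last exact: measurable_xsection.
Qed.

Definition dil (a : R) (p : R * R) : R * R := (a * p.1, a * p.2).

Lemma leb2_dil (a : R) (A : set (R * R)) : 0 < a -> measurable A ->
  leb2 A = ((a ^+ 2)%:E * leb2 (dil a @^-1` A))%E.
Proof.
move=> a0 mA; have a1 : a != 0 by rewrite gt_eqF.
have mc : measurable_fun setT (fun _ : R => 0 : R) by [].
rewrite (leb2_affine1 a1 mc mA) (leb2_affine2 a1 mc); last first.
  by rewrite -[X in measurable X]setTI; exact: (measurable_affine1 a mc).
rewrite muleA -EFinM gtr0_norm// -expr2; congr (_ * leb2 _)%E.
by apply/seteqP; split => -[x y] /=; rewrite /dil /= !addr0.
Qed.

Definition plane_rot (u p : R * R) : R * R :=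
  (u.1 * p.1 - u.2 * p.2, u.2 * p.1 + u.1 * p.2).

Lemma measurable_plane_rot u : measurable_fun setT (plane_rot u).
Proof.
by apply/measurable_fun_pair; [apply/measurable_funB|apply/measurable_funD];
  apply/measurable_funM.
Qed.

Lemma measurable_rot_preimage u (A : set (R * R)) :
  measurable A -> measurable (plane_rot u @^-1` A).
Proof.
by move=> mA; rewrite -[X in measurable X]setTI; exact: measurable_plane_rot.
Qed.

Lemma leb2_rot (u : R * R) (A : set (R * R)) : u.1 ^+ 2 + u.2 ^+ 2 = 1 ->
  measurable A -> leb2 (plane_rot u @^-1` A) = leb2 A.
Proof.
(* A rotation with nonzero cosine is a product of two maps each changing a
   single coordinate; the remaining quarter turns are products of two such. *)
have case1 (v : R * R) (B : set (R * R)) : v.1 != 0 ->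
    v.1 ^+ 2 + v.2 ^+ 2 = 1 -> measurable B -> leb2 (plane_rot v @^-1` B) = leb2 B.
  move=> v0 v1 mB.
  have mg c : measurable_fun setT (fun y : R => c * y).
    by apply/measurable_funM.
  have v0' : (v.1)^-1 != 0 by rewrite invr_eq0.
  rewrite [RHS](leb2_affine2 v0' (mg (v.2 / v.1)))//.
  rewrite [in RHS](leb2_affine1 v0 (mg (- v.2))); last first.
    by rewrite -[X in measurable X]setTI; exact: (measurable_affine2 _ (mg _)).
  rewrite muleA -EFinM -normrM mulVf// normr1 mul1e; congr (leb2 _).
  have e x y : v.1^-1 * y + v.2 / v.1 * (v.1 * x + - v.2 * y) =
      v.2 * x + v.1 * y.
    have -> : v.1^-1 * y = (v.1 ^+ 2 + v.2 ^+ 2) / v.1 * y by rewrite v1 mul1r.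
    by field.
  by apply/seteqP; split => -[x y] /=; rewrite /plane_rot /= e mulNr.
move=> u1 mA; have [u0|u0] := eqVneq u.1 0; last exact: case1.
have u2 : u.2 != 0.
  by apply/eqP => u20; move: u1; rewrite u0 u20 !expr0n addr0 => /eqP; rewrite eq_sym oner_eq0.
(* The 3-4-5 triangle splits the quarter turn [u] into [v] after [w], both with nonzero cosine. *)
pose w : R * R := (3 / 5, 4 / 5).
pose v : R * R := (4 / 5 * u.2, 3 / 5 * u.2).
have -> : plane_rot u @^-1` A = plane_rot w @^-1` (plane_rot v @^-1` A).
  have e p : plane_rot u p = plane_rot v (plane_rot w p).
    by rewrite /plane_rot /= u0; congr (_, _); field.
  by apply/seteqP; split => p /=; rewrite e.
have w0 : w.1 != 0 by rewrite mulf_neq0 ?invr_eq0 ?pnatr_eq0.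
have w1 : w.1 ^+ 2 + w.2 ^+ 2 = 1 by rewrite /w /=; field.
have v0 : v.1 != 0 by rewrite !mulf_neq0 ?invr_eq0 ?pnatr_eq0.
have v1 : v.1 ^+ 2 + v.2 ^+ 2 = 1.
  by rewrite -[RHS]u1 /v /= u0; field.
by rewrite !case1//; exact: measurable_rot_preimage.
Qed.

Lemma ge0_integral_rot (u : R * R) (f : R * R -> \bar R) :
  u.1 ^+ 2 + u.2 ^+ 2 = 1 -> measurable_fun setT f ->
  (forall p, 0 <= f p)%E ->
  (\int[@leb2 R]_p f (plane_rot u p) = \int[@leb2 R]_p f p)%E.
Proof.
move=> u1 mf f0.
pose PT := (measurableTypeR R * measurableTypeR R)%type.
have mr : @measurable_fun _ _ PT PT setT (plane_rot u) by exact: measurable_plane_rot.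
have mf' : @measurable_fun _ _ PT _ setT f by exact: mf.
have := @ge0_integral_pushforward _ _ PT PT R (plane_rot u) mr
  (@leb2 R) setT f measurableT mf' (fun y _ => f0 y).
rewrite preimage_setT => h; apply: etrans (esym h) _.
by apply: eq_measure_integral => B mB _; exact: leb2_rot.
Qed.

End PlaneMeasure.

Section MonotoneIntegral.
Local Open Scope ereal_scope.
Context d (T : measurableType d) (R : realType) (mu : {measure set T -> \bar R}).
Import HBNNSimple.

(** The integral of a nonnegative function is a supremum over the simple functions below it, so
    monotonicity holds for arbitrary functions. Iterated integrals can thus be compared without a
    study of how the inner one depends on its parameter. *)
Lemma le_integral_nonmeas (D : set T) (f g : T -> \bar R) :
  (forall x, D x -> 0 <= g x) -> (forall x, D x -> f x <= g x) ->
  \int[mu]_(x in D) f x <= \int[mu]_(x in D) g x.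
Proof.
move=> g0 fg; rewrite [leLHS]integralE.
apply: (@le_trans _ _ (\int[mu]_(x in D) f^\+ x)).
  by rewrite geeDl// oppe_le0 integral_ge0.
rewrite !ge0_integralE//; apply: ge_ereal_sup => _ [h /= hf <-].
apply: ereal_sup_ubound; exists h => //= x.
apply: le_trans (hf x) _; rewrite /patch; case: ifPn => //.
by rewrite inE => Dx; rewrite funeposE ge_max fg// g0.
Qed.

End MonotoneIntegral.

(** * Areas of annuli and sums of powers *)

Section Annuli.
Variable R : realType.
Local Notation leb := (@leb2 R).

(** The bounds are on the squared modulus, which makes the area linear in [b - a]. *)
Definition ann (a b : R) : set (R * R) := [set p | a <= nsq p < b].

Lemma measurable_nsq : measurable_fun setT (@nsq R).
Proof. by apply/measurable_funD; apply/measurable_funX. Qed.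

Lemma measurable_ann a b : measurable (ann a b).
Proof.
have -> : ann a b = setT `&` @nsq R @^-1` `[a, b[.
  by rewrite setTI; apply/seteqP; split => p /=; rewrite /ann /= in_itv.
exact: measurable_nsq.
Qed.

Lemma nsq_dil a (p : R * R) : nsq (dil a p) = a ^+ 2 * nsq p.
Proof. by rewrite /nsq /dil /=; ring. Qed.

Lemma nsq_rot (u p : R * R) : u.1 ^+ 2 + u.2 ^+ 2 = 1 -> nsq (plane_rot u p) = nsq p.
Proof.
move=> u1; rewrite -[RHS]mul1r -u1 /nsq /plane_rot /=; ring.
Qed.

Lemma toC_rot (u p : R * R) : toC (plane_rot u p) = toC u * toC p :> R[i].
Proof.
by apply/eqP; rewrite eq_complex /=; apply/andP; split; apply/eqP; rewrite // addrC.
Qed.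

Definition disc_area : R := fine (leb (ann 0 1)).

Lemma leb2_ann01 : leb (ann 0 1) = disc_area%:E.
Proof.
rewrite /disc_area fineK// ge0_fin_numE//.
pose I : set R := `[-1, 1]%classic.
apply: (@le_lt_trans _ _ (leb (I `*` I))).
  apply: le_measure; rewrite ?inE.
  - exact: measurable_ann.
  - by apply: measurableX; exact: measurable_itv.
  - move=> [x y] /andP[_]; rewrite /nsq /I /= => h; rewrite !in_itv /=.
    by split; apply/andP; split; nra.
have -> : leb (I `*` I) = (lebesgue_measure I * lebesgue_measure I)%E.
  by apply: product_measure1E; exact: measurable_itv.
rewrite !lebesgue_measure_itv /= lte_fin.
by case: ifP; rewrite -?EFinB -?EFinM ?mul0e ltry.
Qed.

Lemma disc_area_ge0 : 0 <= disc_area.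
Proof. by rewrite -lee_fin -leb2_ann01. Qed.

Lemma leb2_ann0 b : 0 <= b -> leb (ann 0 b) = (b * disc_area)%:E.
Proof.
rewrite le_eqVlt => /predU1P[<-|b0].
  rewrite mul0r (_ : ann 0 0 = set0) ?measure0//.
  by apply/seteqP; split => // p /= /andP[]; lra.
rewrite (@leb2_dil _ (Num.sqrt b)) ?sqrtr_gt0//; last exact: measurable_ann.
rewrite sqr_sqrtr ?ltW// EFinM -leb2_ann01; congr (_ * leb _)%E.
have e p : (b * nsq p < b) = (nsq p < 1) by rewrite -[ltRHS]mulr1 ltr_pM2l.
have b0' := ltW b0.
by apply/seteqP; split => p;
  rewrite /ann /= nsq_dil sqr_sqrtr// e nsq_ge0 mulr_ge0 ?nsq_ge0.
Qed.

Lemma leb2_ann a b : 0 <= a <= b -> leb (ann a b) = ((b - a) * disc_area)%:E.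
Proof.
move=> /andP[a0 ab].
have U : ann 0 b = ann 0 a `|` ann a b.
  apply/seteqP; split => p /=; rewrite /ann /= !nsq_ge0 /=.
    by move=> pb; have [?|?] := ltP (nsq p) a; [left|right].
  by move=> [pa|/andP[]//]; apply: lt_le_trans ab.
have : leb (ann 0 b) = (leb (ann 0 a) + leb (ann a b))%E.
  rewrite U measureU//; try exact: measurable_ann.
  by apply/seteqP; split => // p /= [/andP[_ ?] /andP[? _]]; lra.
rewrite !leb2_ann0 ?(le_trans a0)// => h.
have : (b * disc_area)%:E = ((a * disc_area)%:E + leb (ann a b))%E by [].
have : leb (ann a b) \is a fin_num.
  rewrite ge0_fin_numE//; apply: (@le_lt_trans _ _ (leb (ann 0 b))).
    by apply: le_measure; rewrite ?inE; try exact: measurable_ann; rewrite U; right.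
  by rewrite leb2_ann0 ?(le_trans a0)// ltry.
by move=> /fineK <- [e]; congr EFin; rewrite mulrBl e; ring.
Qed.

(** The left Riemann sum of the increasing function [t^N] on [[0, m]] lies below its integral. *)
Lemma powsum_le (N m : nat) : (N.+1 * \sum_(i < m) i ^ N <= m ^ N.+1)%N.
Proof.
elim: m => [|m ih]; first by rewrite big_ord0 muln0.
rewrite big_ord_recr mulnDr /=; apply: leq_trans (leq_add ih (leqnn _)) _.
elim: N {ih} => [|N ih]; first by rewrite !expn1 expn0; lia.
rewrite [leqRHS]expnS; apply: leq_trans (leq_mul (leqnn _) ih).
by rewrite [(m ^ N.+2)%N]expnS [(m ^ N.+1)%N]expnS; nia.
Qed.

End Annuli.

(** * Parseval's identity on an annulus *)

Section ComplexMeasurable.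
Context d (T : measurableType d) (R : realType).
Implicit Types f g : T -> R[i].

Definition cmeasurable f :=
  measurable_fun setT (fun x => complex.Re (f x)) /\
  measurable_fun setT (fun x => complex.Im (f x)).

Lemma cmeasurable_cst c : cmeasurable (fun=> c).
Proof. by split. Qed.

Lemma cmeasurableD f g : cmeasurable f -> cmeasurable g ->
  cmeasurable (fun x => f x + g x).
Proof.
move=> [f1 f2] [g1 g2]; split.
  by under eq_fun do rewrite ReD; exact: measurable_funD.
by under eq_fun do rewrite ImD; exact: measurable_funD.
Qed.

Lemma cmeasurableM f g : cmeasurable f -> cmeasurable g ->
  cmeasurable (fun x => f x * g x).
Proof.
move=> [f1 f2] [g1 g2]; split.
  have -> : (fun x => complex.Re (f x * g x)) = (fun x => complex.Re (f x) *
      complex.Re (g x) - complex.Im (f x) * complex.Im (g x)).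
    by apply/funext => x; case: (f x) => ? ?; case: (g x).
  by apply: measurable_funB; apply: measurable_funM.
have -> : (fun x => complex.Im (f x * g x)) = (fun x => complex.Re (f x) *
    complex.Im (g x) + complex.Im (f x) * complex.Re (g x)).
  by apply/funext => x; case: (f x) => ? ?; case: (g x).
by apply: measurable_funD; apply: measurable_funM.
Qed.

Lemma cmeasurableX f n : cmeasurable f -> cmeasurable (fun x => f x ^+ n).
Proof.
move=> mf; elim: n => [|n ih]; first exact: cmeasurable_cst.
by under eq_fun do rewrite exprS; exact: cmeasurableM.
Qed.

Lemma cmeasurable_sum (I : Type) (r : seq I) (F : I -> T -> R[i]) :
  (forall i, cmeasurable (F i)) -> cmeasurable (fun x => \sum_(i <- r) F i x).
Proof.
move=> mF; elim: r => [|i r ih].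
  by under eq_fun do rewrite big_nil; exact: cmeasurable_cst.
by under eq_fun do rewrite big_cons; exact: cmeasurableD.
Qed.

Lemma measurable_cabs_sqr f : cmeasurable f ->
  measurable_fun setT (fun x => cabs (f x) ^+ 2).
Proof.
move=> [f1 f2]; under eq_fun do rewrite cabs_sqr.
by apply: measurable_funD; apply: measurable_funX.
Qed.

End ComplexMeasurable.

Section PolynomialIntegrals.
Variable R : realType.
Local Notation leb := (@leb2 R).
Local Notation alpha := (@disc_area R).

Definition cpoly (c : nat -> R[i]) (T : nat) (z : R[i]) : R[i] :=
  \sum_(j < T) c j * z ^+ j.

Lemma measurable_cpoly c T :
  measurable_fun setT (fun p : R * R => cabs (cpoly c T (toC p)) ^+ 2).
Proof.
apply: measurable_cabs_sqr; apply: cmeasurable_sum => j.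
apply: cmeasurableM; first exact: cmeasurable_cst.
by apply: cmeasurableX; split; [exact: measurable_fst|exact: measurable_snd].
Qed.

(** An upper Riemann sum over [j.+1] annuli of equal area. The exact value lacks the factor 2: by
    [powsum_le] the lower sum is at most the exact value, and the last cell adds as much again. *)
Lemma integral_nsq_pow_le (b : R) (j : nat) : 0 <= b ->
  (\int[leb]_(p in ann 0 b) (nsq p ^+ j)%:E <=
    (2 * alpha * b ^+ j.+1 / j.+1%:R)%:E)%E.
Proof.
move=> b0.
have N0 : 0 < j.+1%:R :> R by rewrite ltr0n.
pose r (i : nat) : R := b * i%:R / j.+1%:R.
have r0 i : 0 <= r i by rewrite /r divr_ge0 ?mulr_ge0.
have rS i : r i <= r i.+1.
  by rewrite /r ler_pM2r ?invr_gt0// ler_wpM2l// ler_nat.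
pose g (i : nat) (p : R * R) : \bar R :=
  ((r i.+1) ^+ j * \1_(ann (r i) (r i.+1)) p)%:E.
have g0 i p : (0 <= g i p)%E by rewrite lee_fin mulr_ge0 ?exprn_ge0.
have mg i : measurable_fun setT (g i).
  apply/measurable_EFinP/measurable_funM => //.
  by apply: measurable_indic; exact: measurable_ann.
apply: (@le_trans _ _ (\int[leb]_p \sum_(i < j.+1) g i p)%E).
  rewrite [leLHS]integral_mkcond; apply: le_integral_nonmeas => p _.
    by apply: sume_ge0.
  rewrite /patch; case: ifPn => [|_]; last exact: sume_ge0.
  rewrite inE => /andP[_ pb].
  have b1 : 0 < b by apply: le_lt_trans pb; exact: nsq_ge0.
  pose y := nsq p * j.+1%:R / b.
  have y0 : 0 <= y by rewrite /y !mulr_ge0 ?nsq_ge0 ?invr_ge0.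
  have /andP[n1 n2] := truncn_itv y0.
  have nj : (Num.truncn y < j.+1)%N.
    rewrite -(ltr_nat R); apply: le_lt_trans n1 _.
    by rewrite /y ltr_pdivrMr// mulrC ltr_pM2l.
  rewrite (bigD1 (Ordinal nj))//=.
  apply: (@le_trans _ _ (g (Num.truncn y) p)); last first.
    by rewrite leeDl// sume_ge0.
  have yE : nsq p = b * y / j.+1%:R by rewrite /y; field; rewrite ?gt_eqF.
  have pin : ann (r (Num.truncn y)) (r (Num.truncn y).+1) p.
    rewrite /ann /= yE /r ler_pM2r ?invr_gt0// ler_pM2l// n1 /=.
    by rewrite ltr_pM2r ?invr_gt0// ltr_pM2l.
  rewrite lee_fin indicE mem_set// mulr1 lerXn2r// ?nnegrE ?nsq_ge0//.
  by case/andP: pin => _ /ltW.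
rewrite ge0_integral_sum//; last by move=> *; exact: mg.
have Ig i : (\int[leb]_p g i p)%E = ((r i.+1) ^+ j * (b / j.+1%:R * alpha))%:E.
  rewrite /g; under eq_integral do rewrite EFinM.
  rewrite ge0_integralZl_EFin ?exprn_ge0//; last first.
    by apply/measurable_EFinP; apply: measurable_indic; exact: measurable_ann.
  transitivity ((r i.+1 ^+ j)%:E * leb (ann (r i) (r i.+1)))%E.
    by congr (_ * _)%E; rewrite integral_indic ?setIT//; exact: measurable_ann.
  rewrite leb2_ann ?r0 ?rS// -EFinM /r; congr (_ * (_ * _))%:E.
  by rewrite -mulrBl -mulrBr -natrB// subSnn mulr1.
under eq_bigr do rewrite Ig.
rewrite sumEFin lee_fin -mulr_suml.
have -> : \sum_(i < j.+1) r i.+1 ^+ j =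
    (b / j.+1%:R) ^+ j * (\sum_(i < j.+1) i.+1 ^ j)%N%:R.
  rewrite natr_sum mulr_sumr; apply: eq_bigr => i _.
  by rewrite natrX -exprMn /r mulrAC.
have S : (j.+1 * (\sum_(i < j.+1) i.+1 ^ j) <= 2 * j.+1 ^ j.+1)%N.
  have h : (\sum_(i < j.+1) i.+1 ^ j <= \sum_(i < j.+1) i ^ j + j.+1 ^ j)%N.
    rewrite -(big_mkord xpredT (fun i => i.+1 ^ j)%N).
    rewrite -(big_mkord xpredT (fun i => i ^ j)%N) -big_nat_recr//=.
    by rewrite [leqRHS]big_nat_recl// leq_addl.
  apply: leq_trans (leq_mul (leqnn _) h) _.
  by rewrite mulnDr -expnS mul2n -addnn leq_add2r powsum_le.
move: S; rewrite -(ler_nat R) !natrM natrX => S; move: S.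
set s := (\sum_(i < j.+1) i.+1 ^ j)%:R => S.
have -> : (b / j.+1%:R) ^+ j * s * (b / j.+1%:R * alpha) =
    (j.+1%:R * s) * (b / j.+1%:R) ^+ j.+1 * alpha / j.+1%:R.
  by rewrite exprS; field; rewrite gt_eqF.
have -> : 2 * alpha * b ^+ j.+1 / j.+1%:R =
    (2 * j.+1%:R ^+ j.+1) * (b / j.+1%:R) ^+ j.+1 * alpha / j.+1%:R.
  by rewrite exprMn exprVn; field; rewrite ?expf_neq0 gt_eqF.
rewrite !ler_wpM2r ?invr_ge0 ?disc_area_ge0 ?exprn_ge0 ?divr_ge0//.
Qed.

(** The annulus and the measure are invariant under rotations, so the integrand may be averaged over
    finitely many of them; [finite_parseval] evaluates this average pointwise. *)
Lemma integral_parseval (a b : R) (c : nat -> R[i]) (T : nat) :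
  (\int[leb]_(p in ann a b) (cabs (cpoly c T (toC p)) ^+ 2)%:E =
   \sum_(j < T) (cabs (c j) ^+ 2)%:E *
     \int[leb]_(p in ann a b) (nsq p ^+ j)%:E)%E.
Proof.
(* Order [T.+1] separates all exponents below [T] and stays positive when [T] is 0. *)
have [w [w1 wT wn]] := exists_root_of_unity R (ltn0Sn T).
pose u (l : nat) : R * R := (complex.Re (w ^+ l), complex.Im (w ^+ l)).
have uE l : toC (u l) = w ^+ l by rewrite /toC /u; case: (w ^+ l).
have u1 l : (u l).1 ^+ 2 + (u l).2 ^+ 2 = 1.
  by rewrite -cabs_sqr cabsX w1 !expr1n.
pose f (p : R * R) := (cabs (cpoly c T (toC p)) ^+ 2)%:E.
pose g := f \_ (ann a b).
have mA := measurable_ann a b.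
have f0 p : (0 <= f p)%E by rewrite lee_fin sqr_ge0.
have mf : measurable_fun setT f by by apply/measurable_EFinP; apply: measurable_cpoly.
have mg : measurable_fun setT g.
  by apply/(measurable_restrictT f mA); exact: measurable_funTS.
have g0 p : (0 <= g p)%E by rewrite /g /patch; case: ifP.
rewrite -[LHS]/(\int[leb]_(p in ann a b) f p)%E integral_mkcond -/g.
have avg : (\sum_(l < T.+1) \int[leb]_p g (plane_rot (u l) p) =
    T.+1%:R%:E * \int[leb]_p g p)%E.
  under eq_bigr do rewrite ge0_integral_rot//.
  elim: T.+1 => [|n ih]; first by rewrite big_ord0 mul0e.
  by rewrite big_ord_recr /= ih -[in RHS]natr1 EFinD ge0_muleDl ?mul1e ?lee_fin.
have mgu l : measurable_fun setT (fun p => g (plane_rot (u l) p)).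
  by apply: measurableT_comp => //; exact: measurable_plane_rot.
have S : (\int[leb]_p \sum_(l < T.+1) g (plane_rot (u l) p) =
    \sum_(l < T.+1) \int[leb]_p g (plane_rot (u l) p))%E.
  apply: (@ge0_integral_sum _ _ R leb setT measurableT _
    (fun (l : 'I_T.+1) p => g (plane_rot (u l) p))).
    by move=> l; exact: mgu.
  by move=> l p _; exact: g0.
have {S} {}avg := etrans S avg.
have L : (\int[leb]_p \sum_(l < T.+1) g (plane_rot (u l) p) =
    \int[leb]_(p in ann a b) (T.+1%:R%:E *
      \sum_(j < T) (cabs (c j) ^+ 2)%:E * (nsq p ^+ j)%:E))%E.
  rewrite [RHS]integral_mkcond; apply: eq_integral => p _.
  rewrite /g /patch.
  have e l : (plane_rot (u l) p \in ann a b) = (p \in ann a b).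
    by apply/idP/idP; rewrite !inE /ann /= nsq_rot.
  under eq_bigr do rewrite e.
  case: ifPn => _; last by rewrite big1.
  rewrite sumEFin; under [in RHS]eq_bigr do rewrite -EFinM.
  rewrite sumEFin -EFinM; congr EFin.
  pose bb j := c j * toC p ^+ j.
  transitivity (\sum_(l < T.+1) cabs (\sum_(j < T) bb j * w ^+ (l * j)) ^+ 2).
    apply: eq_bigr => l _; congr (cabs _ ^+ 2); apply: eq_bigr => j _.
    by rewrite /bb toC_rot uE exprMn -exprM; ring.
  rewrite finite_parseval//; last first.
    by move=> n /andP[n0 nT]; apply: wn; rewrite n0 ltnW.
  congr (_ * _); apply: eq_bigr => j _.
  by rewrite /bb cabsM exprMn cabsX exprAC nsqE.
have N0 : (0 < T.+1%:R :> R) by rewrite ltr0n.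
have mt j : measurable_fun (ann a b)
    (fun p => (cabs (c j) ^+ 2)%:E * (nsq p ^+ j)%:E)%E.
  apply: measurable_funeM; apply: measurable_funTS; apply/measurable_EFinP.
  by apply: measurable_funX; exact: measurable_nsq.
have t0 j p : (0 <= (cabs (c j) ^+ 2)%:E * (nsq p ^+ j)%:E)%E.
  by rewrite -EFinM lee_fin mulr_ge0 ?sqr_ge0 ?exprn_ge0 ?nsq_ge0.
have M : (\int[leb]_(p in ann a b) (T.+1%:R%:E *
      \sum_(j < T) (cabs (c j) ^+ 2)%:E * (nsq p ^+ j)%:E) =
    T.+1%:R%:E * \sum_(j < T) (cabs (c j) ^+ 2)%:E *
     \int[leb]_(p in ann a b) (nsq p ^+ j)%:E)%E.
  rewrite ge0_integralZl_EFin//; last 2 first.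
  - by move=> p _; apply: sume_ge0.
  - by apply: emeasurable_sum => j; exact: mt.
  congr (_ * _)%E; rewrite ge0_integral_sum//; last by move=> j; exact: mt.
  apply: eq_bigr => j _; rewrite ge0_integralZl_EFin ?sqr_ge0//.
  - by move=> p _; rewrite lee_fin exprn_ge0 ?nsq_ge0.
  - apply: measurable_funTS; apply/measurable_EFinP.
    by apply: measurable_funX; exact: measurable_nsq.
have := etrans (esym avg) (etrans L M) => h.
have N1 : ((T.+1%:R^-1 : R)%:E * (T.+1%:R : R)%:E = 1)%E.
  by rewrite -EFinM mulVf// gt_eqF.
have {}h := congr1 (fun x => (T.+1%:R^-1 : R)%:E * x)%E h.
by rewrite !muleA N1 !mul1e in h.
Qed.

End PolynomialIntegrals.

(** * Counting points and pairs of points *)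

Section Counting.
Variable R : realType.

Lemma finite_conf_seq (Y B : set (R * R)) : is_conf Y -> rel_compact B ->
  exists2 s : seq (R * R), uniq s & Y `&` B = [set` s].
Proof.
move=> [_ fY] [K [cK KD BK]].
have fU : finite_set (Y `&` B).
  by apply: sub_finite_set (fY _ cK KD); exact: setIS.
move/finite_seqP : fU => [s ->]; exists (undup s); first exact: undup_uniq.
by apply/seteqP; split => x /=; rewrite mem_undup.
Qed.

Lemma ncountE (B Y : set (R * R)) (s : seq (R * R)) : uniq s ->
  Y `&` B = [set` s] -> ncount B Y = (size s)%:R%:E.
Proof.
move=> us sE; rewrite /ncount sE esum_fset//; last exact: finite_seq.
by rewrite -fsbig_seq//= sumEFin big_const_seq iter_addr addr0 count_predT.
Qed.

End Counting.

(** * Intensity and negative correlation *)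

Section CorrelationKernel.
Variable R : realType.
Local Notation leb := (@leb2 R).

Definition rho1 (p : R * R) : R := ((1 - nsq p) ^+ 2)^-1.

Lemma rho1_ge0 p : 0 <= rho1 p.
Proof. by rewrite invr_ge0 sqr_ge0. Qed.

Lemma Kb_diag (p : R * R) : Kb (toC p) (toC p) = (rho1 p)%:C.
Proof.
by rewrite /Kb -cabs_sqrC -nsqE /rho1 fmorphV rmorphXn rmorphB rmorph1.
Qed.

Lemma Kb_conj (z w : R[i]) : Kb w z = conjc (Kb z w).
Proof.
rewrite /Kb conjc_inv rmorphXn rmorphB rmorph1 rmorphM /= conjcK.
by rewrite mulrC.
Qed.

Lemma rho_1 (p : R * R) : rho [:: p] = rho1 p.
Proof. by rewrite /rho det_mx11 mxE -[RHS]/(complex.Re (rho1 p)%:C) -Kb_diag. Qed.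

Lemma det_mx22 (A : 'M[R[i]]_2) :
  \det A = A 0 0 * A 1 1 - A 0 1 * A 1 0.
Proof.
rewrite (expand_det_row _ 0) big_ord_recl big_ord1 /cofactor !det_mx11 !mxE.
rewrite expr0 expr1 mul1r mulN1r mulrN.
have -> : lift 0 0 = 1 :> 'I_2 by apply/val_inj.
by have -> : lift 1 0 = 0 :> 'I_2 by apply/val_inj.
Qed.

(** The kernel is Hermitian, so the off-diagonal product subtracted in the determinant is
    [|K(p, q)|^2]. *)
Lemma rho_2_le (p q : R * R) : rho [:: p; q] <= rho1 p * rho1 q.
Proof.
rewrite /rho det_mx22 !mxE.
rewrite -[Kb _ _ * Kb _ _ - _]/(Kb (toC p) (toC p) * Kb (toC q) (toC q) -
  Kb (toC p) (toC q) * Kb (toC q) (toC p)).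
rewrite !Kb_diag [Kb (toC q) _]Kb_conj -cabs_sqrC.
by rewrite -rmorphM -rmorphB /= lerBlDr lerDl sqr_ge0.
Qed.

End CorrelationKernel.

Section Intensity.
Context (R : realType) (d : measure_display) (Omega : measurableType d).
Context (P : probability Omega R) (X : Omega -> set (R * R)).
Hypothesis HX : bergman_dpp P X.
Local Notation leb := (@leb2 R).
Local Open Scope ereal_scope.

Definition intensity (B : set (R * R)) : \bar R :=
  (pi^-1)%:E * \int[leb]_(x in B) (rho1 x)%:E.

Lemma intensity_ge0 B : 0 <= intensity B.
Proof.
rewrite mule_ge0 ?lee_fin ?invr_ge0 ?pi_ge0// integral_ge0// => p _.
by rewrite lee_fin rho1_ge0.
Qed.

Lemma rel_compact_disk B : @rel_compact R B -> B `<=` @diskD R.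
Proof. by move=> [K [_ KD BK]]; exact: subset_trans BK KD. Qed.

Lemma measurable_rho1 (B : set (R * R)) : measurable B -> B `<=` @diskD R ->
  measurable_fun B (fun p => (rho1 p)%:E).
Proof.
move=> mB BD.
apply: (eq_measurable_fun (fun p : R * R => ((1 - nsq p) `^ (- 2%:R))%:E)%R).
  move=> p /set_mem /BD; rewrite /diskD /= -nsq_lt1 => p1.
  by rewrite powRN powR_mulrn ?subr_ge0 ?(ltW p1).
apply: measurable_funTS; apply/measurable_EFinP.
apply: (measurableT_comp (measurable_powR (- 2%:R)%R)).
by apply: measurable_funB => //; exact: measurable_nsq.
Qed.

Lemma expected_count B : measurable B -> rel_compact B ->
  \int[P]_w ncount B (X w) = intensity B.
Proof.
move=> mB cB; have [_ _ /(_ [:: B] isT)] := HX.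
rewrite /nprod; under eq_integral do rewrite big_seq1; move=> -> //.
- by rewrite /= /intensity; under eq_integral do rewrite rho_1.
- by move=> C; rewrite inE => /eqP ->.
- by move=> i j /andP[ij]; rewrite ltnS leqn0 => /eqP j0; rewrite j0 in ij.
Qed.

Lemma expected_pair_le B C : measurable B -> rel_compact B ->
  measurable C -> rel_compact C -> B `&` C = set0 ->
  \int[P]_w (ncount B (X w) * ncount C (X w)) <= intensity B * intensity C.
Proof.
move=> mB cB mC cC BC; have [_ _ /(_ [:: B; C] isT)] := HX.
rewrite /nprod; under eq_integral do rewrite big_cons big_seq1; move=> -> //.
- rewrite /=.
  have -> : intensity B * intensity C = (pi^-1)%:E *
      \int[leb]_(x in B) (intensity C * (rho1 x)%:E).
    rewrite ge0_integralZl ?intensity_ge0//.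
    + by rewrite [in LHS]/intensity -muleA; congr (_ * _); exact: muleC.
    + by apply: measurable_rho1 => //; exact: rel_compact_disk.
    + by move=> p _; rewrite lee_fin rho1_ge0.
  rewrite lee_pmul2l ?lte_fin ?invr_gt0 ?pi_gt0//.
  apply: le_integral_nonmeas => x Bx.
    by rewrite mule_ge0 ?intensity_ge0// lee_fin rho1_ge0.
  rewrite /intensity -muleA lee_pmul2l ?lte_fin ?invr_gt0 ?pi_gt0// muleC.
  rewrite -ge0_integralZl_EFin ?rho1_ge0//.
  + apply: le_integral_nonmeas => y Cy; rewrite -EFinM lee_fin.
      by rewrite mulr_ge0 ?rho1_ge0.
    exact: rho_2_le.
  + by move=> p _; rewrite lee_fin rho1_ge0.
  + by apply: measurable_rho1 => //; exact: rel_compact_disk.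
- by move=> D; rewrite !inE => /orP[|] /eqP ->.
- by case=> [|i] [|[|j]] //=; rewrite ?ltnS ?ltn0 ?andbF.
Qed.

End Intensity.

Section PairSums.
Context (R : realType) (d : measure_display) (Omega : measurableType d).
Context (P : probability Omega R) (X : Omega -> set (R * R)).
Hypothesis HX : bergman_dpp P X.
Local Notation leb := (@leb2 R).

Lemma ncount_ge0 (B Y : set (R * R)) : (0 <= ncount B Y)%E.
Proof. by apply: esum_ge0. Qed.

Lemma rel_compactS (A B : set (R * R)) :
  A `<=` B -> rel_compact B -> rel_compact A.
Proof. by move=> AB [K [cK KD BK]]; exists K; split => //; exact: subset_trans BK. Qed.

Lemma measurable_ncount B : measurable B -> rel_compact B ->
  measurable_fun setT (fun w => ncount B (X w)).
Proof. by have [_ + _] := HX; exact. Qed.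

Definition pair_term (I : finType) (A : I -> set (R * R)) (h : I -> I -> R)
    (w : Omega) (c c' : I) : \bar R :=
  ((h c c')%:E * (ncount (A c) (X w) * ncount (A c') (X w)))%E.

Definition pair_sum (I : finType) (A : I -> set (R * R)) (h : I -> I -> R)
    (w : Omega) : \bar R :=
  (\sum_c \sum_(c' | c' != c) pair_term A h w c c')%E.

Section FinitePartition.
Context (I : finType) (A : I -> set (R * R)) (h : I -> I -> R).
Hypotheses (mA : forall c, measurable (A c)) (cA : forall c, rel_compact (A c)).
Hypothesis dA : forall c c', c' != c -> A c `&` A c' = set0.
Hypothesis h0 : forall c c', 0 <= h c c'.

Lemma pair_term_ge0 w c c' : (0 <= pair_term A h w c c')%E.
Proof. by rewrite mule_ge0 ?lee_fin ?mule_ge0 ?ncount_ge0. Qed.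

Lemma measurable_pair_term c c' :
  measurable_fun setT (fun w => pair_term A h w c c').
Proof.
by apply: measurable_funeM; apply: emeasurable_funM; exact: measurable_ncount.
Qed.

Lemma pair_sum_ge0 w : (0 <= pair_sum A h w)%E.
Proof. by apply: sume_ge0 => c _; apply: sume_ge0 => c' _; exact: pair_term_ge0. Qed.

Lemma measurable_pair_sum : measurable_fun setT (pair_sum A h).
Proof.
apply: emeasurable_sum => c.
under eq_fun do rewrite -big_filter.
by apply: emeasurable_sum => c'; exact: measurable_pair_term.
Qed.

Lemma expected_pair_sum_le : (\int[P]_w pair_sum A h w <=
  \sum_c \sum_c' (h c c')%:E * (intensity (A c) * intensity (A c')))%E.
Proof.
have S c : measurable_fun setT (fun w => \sum_(c' | c' != c) pair_term A h w c c')%E.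
  under eq_fun do rewrite -big_filter.
  by apply: emeasurable_sum => c'; exact: measurable_pair_term.
rewrite ge0_integral_sum//; last first.
  by move=> c w _; apply: sume_ge0 => c' _; exact: pair_term_ge0.
apply: lee_sum => c _.
under eq_integral do rewrite -big_filter.
rewrite ge0_integral_sum//; last 2 first.
- by move=> c'; exact: measurable_pair_term.
- by move=> c' w _; exact: pair_term_ge0.
rewrite big_filter.
(* The diagonal cells, to which the correlation bound does not apply, are added back as nonnegative
   terms, so that the bound is a full double sum. *)
apply: (@le_trans _ _ (\sum_(c' | c' != c)
    (h c c')%:E * (intensity (A c) * intensity (A c')))%E); last first.
  rewrite [leRHS](bigD1 c)//= leeDr//.
  apply: mule_ge0; first by rewrite lee_fin.
  by apply: mule_ge0; exact: intensity_ge0.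
apply: lee_sum => c' cc'; rewrite ge0_integralZl_EFin//.
- by rewrite lee_wpmul2l ?lee_fin// (expected_pair_le HX)//; exact: dA.
- by move=> w _; rewrite mule_ge0 ?ncount_ge0.
- by apply: emeasurable_funM; exact: measurable_ncount.
Qed.

End FinitePartition.

Lemma ncount_seq (B Y : set (R * R)) (s : seq (R * R)) : uniq s ->
  (forall x, x \in s -> Y x /\ B x) -> ((size s)%:R%:E <= ncount B Y)%E.
Proof.
move=> us sB; apply: esum_ge; exists [set` s].
  by split; [exact: finite_seq|move=> x /= /sB].
rewrite -fsbig_seq//= sumEFin lee_fin.
by rewrite big_const_seq iter_addr addr0 count_predT.
Qed.

(** Injectivity of [g] puts distinct points into distinct cells, so no pair is lost to the excluded
    diagonal; further points of the configuration add only nonnegative terms. *)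
Lemma pair_sum_ge (I : finType) (A : I -> set (R * R)) (h : I -> I -> R) w
    (s : seq (R * R)) (g : R * R -> I) :
  (forall c c', 0 <= h c c') -> uniq s ->
  (forall x, x \in s -> X w x /\ A (g x) x) -> {in s &, injective g} ->
  ((\sum_(x <- s) \sum_(y <- s | y != x) h (g x) (g y))%:E <= pair_sum A h w)%E.
Proof.
move=> h0 us sA gI.
pose m (c : I) := size [seq x <- s | g x == c].
have mE c : (m c)%:R = \sum_(x <- s) (g x == c)%:R :> R.
  rewrite /m size_filter -sum1_count natr_sum big_mkcond /=.
  by apply: eq_bigr => x _; case: ifP.
apply: (@le_trans _ _ (\sum_c \sum_(c' | c' != c)
    (h c c')%:E * ((m c)%:R%:E * (m c')%:R%:E))%E); last first.
  have mc c : ((m c)%:R%:E <= ncount (A c) (X w))%E.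
    apply: ncount_seq; first exact: filter_uniq.
    by move=> x; rewrite mem_filter => /andP[/eqP <-]; exact: sA.
  apply: lee_sum => c _; apply: lee_sum => c' _.
  by rewrite lee_wpmul2l ?lee_fin// lee_pmul// lee_fin.
under [leRHS]eq_bigr => c _.
  under eq_bigr => c' _ do rewrite -!EFinM.
  rewrite sumEFin; over.
rewrite sumEFin lee_fin.
apply: (@le_trans _ _ (\sum_c \sum_(c' | c' != c) \sum_(x <- s) \sum_(y <- s)
    h (g x) (g y) * ((g x == c)%:R * (g y == c')%:R))); last first.
  apply: ler_sum => c _; apply: ler_sum => c' _.
  rewrite !mE big_distrlr /= mulr_sumr; apply: ler_sum => x _.
  rewrite mulr_sumr; apply: ler_sum => y _.
  have [->|_] := eqVneq (g x) c; last by rewrite !mul0r !mulr0.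
  by have [->|_] := eqVneq (g y) c'; last by rewrite !mulr0.
under [leRHS]eq_bigr => c _ do rewrite exchange_big /=.
rewrite [leRHS]exchange_big /= big_seq [leRHS]big_seq.
apply: ler_sum => x xs; rewrite (bigD1 (g x))//=.
apply: (@le_trans _ _ (\sum_(c' | c' != g x) \sum_(y <- s)
    h (g x) (g y) * ((g x == g x)%:R * (g y == c')%:R))); last first.
  rewrite lerDl sumr_ge0// => c _; rewrite sumr_ge0// => c' _.
  by rewrite sumr_ge0// => y _; rewrite !mulr_ge0.
rewrite exchange_big /= big_seq_cond [leRHS]big_seq big_mkcondr /=.
apply: ler_sum => y ys; case: ifPn => [yx|_].
  rewrite (bigD1 (g y))/=; last by apply: contra yx => /eqP /gI ->.
  by rewrite !eqxx !mulr1 lerDl sumr_ge0// => c _; rewrite !mulr_ge0.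
by rewrite sumr_ge0// => c _; rewrite !mulr_ge0.
Qed.

End PairSums.

(** * Sums over pairs of distinct points through finer and finer grids *)

Section PairSumFatou.
Context (R : realType) (d : measure_display) (Omega : measurableType d).
Context (P : probability Omega R) (X : Omega -> set (R * R)).
Hypothesis HX : bergman_dpp P X.
Local Notation leb := (@leb2 R).

Lemma limn_einf_supE (u : (\bar R)^nat) :
  limn_einf u = ereal_sup (range (einfs u)).
Proof. by rewrite limn_einf_lim; apply/cvg_lim => //; exact: cvg_einfs_sup. Qed.

Lemma limn_einf_ge (u : (\bar R)^nat) (a : \bar R) N :
  (forall n, (N <= n)%N -> (a <= u n)%E) -> (a <= limn_einf u)%E.
Proof.
move=> h; apply: (@le_trans _ _ (einfs u N)).
  by apply: le_ereal_inf_tmp => _ [n /= Nn <-]; exact: h.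
by rewrite limn_einf_supE; apply: ereal_sup_ubound; exists N.
Qed.

Lemma measurable_fun_limn_einf (f : (Omega -> \bar R)^nat) :
  (forall n, measurable_fun setT (f n)) ->
  measurable_fun setT (fun w => limn_einf (f ^~ w)).
Proof.
move=> mf.
have -> : (fun w => limn_einf (f ^~ w)) =
    (fun w => - limn_esup (fun n => - f n w))%E.
  by apply/funext => w; rewrite -limn_einfN; congr limn_einf;
    apply/funext => n /=; rewrite oppeK.
apply: measurableT_comp => //; apply: measurable_fun_limn_esup => n.
exact: measurableT_comp.
Qed.

Definition near_pt (del : R) (x y : R * R) : Prop :=
  `|y.1 - x.1| < del /\ `|y.2 - x.2| < del.

Lemma uniform_delta (T : eqType) (s : seq T) (Q : T -> R -> Prop) :
  (forall x e e', e' <= e -> Q x e -> Q x e') ->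
  (forall x, exists2 e, 0 < e & Q x e) ->
  exists2 e, 0 < e & forall x, x \in s -> Q x e.
Proof.
move=> mono ex; elim: s => [|x s [e e0 IH]]; first by exists 1.
have [e' e'0 Qx] := ex x; exists (Num.min e e').
  by rewrite lt_min e0.
move=> y; rewrite inE => /predU1P[->|ys].
  by apply: mono Qx; rewrite ge_min lexx orbT.
by apply: mono (IH _ ys); rewrite ge_min lexx.
Qed.

(** Half-open cells of side [1 / (n+1)] that partition the square around the disc, which has side
    2. *)
Definition grid (U : set (R * R)) (n : nat) (c : 'I_(2 * n.+1) * 'I_(2 * n.+1)) :
    set (R * R) :=
  U `&` [set p | (c.1%:R <= (p.1 + 1) * n.+1%:R < c.1.+1%:R) &&
                 (c.2%:R <= (p.2 + 1) * n.+1%:R < c.2.+1%:R)].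

Arguments grid U n c : clear implicits.

Lemma grid_near U n c x y : grid U n c x -> grid U n c y ->
  near_pt (n.+1%:R^-1) x y.
Proof.
move=> [_ /= /andP[/andP[a1 a2] /andP[a3 a4]]] [_ /= /andP[/andP[b1 b2] /andP[b3 b4]]].
have n0 : 0 < n.+1%:R :> R by rewrite ltr0n.
rewrite -!natr1 in a2 a4 b2 b4.
by split; rewrite -[ltRHS]mul1r ltr_pdivlMr// -[X in _ * X](ger0_norm (ltW n0))
  -normrM ltr_norml; apply/andP; split; lra.
Qed.

Lemma disk_coord (p : R * R) : diskD p -> (-1 < p.1 < 1) && (-1 < p.2 < 1).
Proof.
rewrite /diskD /= -nsq_lt1 /nsq => h.
by apply/andP; split; apply/andP; split; nra.
Qed.

Lemma grid_cover U n x : U `<=` @diskD R -> U x -> exists c, grid U n c x.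
Proof.
move=> UD Ux; have /andP[/andP[a1 a2] /andP[b1 b2]] := disk_coord (UD _ Ux).
have n0 : 0 < n.+1%:R :> R by rewrite ltr0n.
have ha : 0 <= (x.1 + 1) * n.+1%:R by rewrite mulr_ge0//; lra.
have hb : 0 <= (x.2 + 1) * n.+1%:R by rewrite mulr_ge0//; lra.
have la : (Num.truncn ((x.1 + 1) * n.+1%:R) < 2 * n.+1)%N.
  by rewrite truncn_lt_nat// natrM ltr_pM2r//; lra.
have lb : (Num.truncn ((x.2 + 1) * n.+1%:R) < 2 * n.+1)%N.
  by rewrite truncn_lt_nat// natrM ltr_pM2r//; lra.
by exists (Ordinal la, Ordinal lb); split => //=; rewrite !truncn_itv.
Qed.

Lemma grid_disj U n c c' : c' != c -> grid U n c `&` grid U n c' = set0.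
Proof.
move=> cc; apply/seteqP; split => // x [[_ /= /andP[a1 a2]] [_ /= /andP[b1 b2]]].
case/eqP: cc; case: c c' a1 a2 b1 b2 => [i j] [i' j'] /= a1 a2 b1 b2.
by congr (_, _); apply/val_inj; rewrite /= -(truncn_def a1, truncn_def a2)
  -(truncn_def b1, truncn_def b2).
Qed.

Lemma measurable_grid U n c : measurable U -> measurable (grid U n c).
Proof.
move=> mU; apply: measurableI => //.
have -> : [set p : R * R | (c.1%:R <= (p.1 + 1) * n.+1%:R < c.1.+1%:R) &&
      (c.2%:R <= (p.2 + 1) * n.+1%:R < c.2.+1%:R)] =
    ((fun p : R * R => (p.1 + 1) * n.+1%:R) @^-1` `[c.1%:R, c.1.+1%:R[) `&`
    ((fun p : R * R => (p.2 + 1) * n.+1%:R) @^-1` `[c.2%:R, c.2.+1%:R[).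
  apply/seteqP; split => p /=; rewrite !in_itv /=; first by move=> /andP[].
  by move=> [-> ->].
apply: measurableI; rewrite -[X in measurable X]setTI.
  have mf : measurable_fun setT (fun p : R * R => (p.1 + 1) * n.+1%:R).
    by apply: measurable_funM => //; apply: measurable_funD.
  exact: mf.
have mf : measurable_fun setT (fun p : R * R => (p.2 + 1) * n.+1%:R).
  by apply: measurable_funM => //; apply: measurable_funD.
exact: mf.
Qed.

Context (U : set (R * R)) (H : R * R -> R * R -> R).
Hypotheses (mU : measurable U) (cU : rel_compact U).
Hypothesis H0 : forall x y, 0 <= H x y.
Hypothesis Hlsc : forall x y e, 0 < e -> exists2 del, 0 < del &
  forall x' y', near_pt del x x' -> near_pt del y y' -> H x y - e <= H x' y'.

(** The infimum keeps the discretized sum below the true one, so bounds on expectations hold at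
    every mesh. For an empty cell it is the infimum of the empty set, which is 0, so nonnegativity
    persists. *)
Definition hinf n (c c' : 'I_(2 * n.+1) * 'I_(2 * n.+1)) : R :=
  inf [set r | exists x y, [/\ grid U n c x, grid U n c' y & r = H x y]].

Lemma hinf_ge0 n c c' : 0 <= @hinf n c c'.
Proof.
rewrite /hinf; set S := [set _ | _].
have [->|S0] := eqVneq S set0; first by rewrite inf0.
by apply: lb_le_inf; [exact/set0P|move=> _ [x [y [_ _ ->]]]].
Qed.

Lemma hinf_le n c c' x y : grid U n c x -> grid U n c' y -> @hinf n c c' <= H x y.
Proof.
move=> cx cy; apply: ge_inf; last by exists x, y.
by exists 0 => _ [a [b [_ _ ->]]].
Qed.

Lemma le_hinf n c c' x y (a : R) : grid U n c x -> grid U n c' y ->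
  (forall x' y', grid U n c x' -> grid U n c' y' -> a <= H x' y') ->
  a <= @hinf n c c'.
Proof.
move=> cx cy h; apply: lb_le_inf; first by exists (H x y), x, y.
by move=> _ [x' [y' [? ? ->]]]; exact: h.
Qed.

(* The correlation functions are only known for disjoint sets, so the sum over
   pairs of distinct points is bounded through pairs of distinct cells of ever
   finer grids; Fatou's lemma then gives the bound on the expectation. *)
Definition lower_pair_sum (w : Omega) : \bar R :=
  limn_einf (fun n => pair_sum X (grid U n) (@hinf n) w).

Let UD := rel_compact_disk cU.
Let mG n c : measurable (grid U n c) := measurable_grid c mU.
Let cG n c : rel_compact (grid U n c) := rel_compactS (@subIsetl _ _ _) cU.

Lemma measurable_lower_pair_sum : measurable_fun setT lower_pair_sum.
Proof.
by apply: measurable_fun_limn_einf => n; exact: (measurable_pair_sum HX).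
Qed.

Lemma lower_pair_sum_ge0 w : (0 <= lower_pair_sum w)%E.
Proof.
apply: (@limn_einf_ge _ _ 0) => n _; apply: pair_sum_ge0 => // c c'.
exact: hinf_ge0.
Qed.

Lemma lower_pair_sum_ge w (s : seq (R * R)) : uniq s ->
  (forall x, x \in s -> X w x /\ U x) ->
  ((\sum_(x <- s) \sum_(y <- s | y != x) H x y)%:E <= lower_pair_sum w)%E.
Proof.
move=> us sU; apply/lee_addgt0Pr => e e0.
pose m := (size s)%:R : R.
have m0 : 0 < m * m + 1 by rewrite ltr_wpDl// mulr_ge0.
(* The error [e] is shared among at most [m * m] ordered pairs; the summand 1 covers the empty
   list. *)
pose e' := e / (m * m + 1).
have e'0 : 0 < e' by rewrite divr_gt0.
(* The second clause separates distinct points of [s]; it makes the map from points to cells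
   injective once the mesh is below [del]. *)
pose Q (xy : (R * R) * (R * R)) del :=
  (forall x' y', near_pt del xy.1 x' -> near_pt del xy.2 y' ->
    H xy.1 xy.2 - e' <= H x' y') /\ (near_pt del xy.1 xy.2 -> xy.1 = xy.2).
have Qmono xy a b : b <= a -> Q xy a -> Q xy b.
  move=> ba [q1 q2]; have nm u v : near_pt b u v -> near_pt a u v.
    by move=> [? ?]; split; exact: lt_le_trans ba.
  by split=> [x' y' /nm ? /nm|/nm]; [exact: q1|exact: q2].
have Qex xy : exists2 del, 0 < del & Q xy del.
  have [del del0 hdel] := @Hlsc xy.1 xy.2 e' e'0.
  have [exy|nxy] := eqVneq xy.1 xy.2; first by exists del => //; split.
  pose t := Num.max `|xy.2.1 - xy.1.1| `|xy.2.2 - xy.1.2|.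
  have t0 : 0 < t.
    rewrite lt_max !normr_gt0 !subr_eq0 -negb_and; apply: contra nxy.
    by move=> /andP[/eqP a /eqP b]; apply/eqP; case: (xy) a b => -[? ?] [? ?] /= -> ->.
  exists (Num.min del t); first by rewrite lt_min del0.
  split.
    have lm (r : R) : r < Num.min del t -> r < del by rewrite lt_min => /andP[].
    by move=> x' y' [? ?] [? ?]; apply: hdel; split; exact: lm.
  move=> [a1 a2]; move: (ltxx t); rewrite {1}/t gt_max.
  by move: a1 a2; rewrite !lt_min => /andP[_ ->] /andP[_ ->].
have [del del0 hdel] := uniform_delta [seq (x, y) | x <- s, y <- s] Qmono Qex.
have [N hN] : exists N : nat, N.+1%:R^-1 <= del.
  have := archi_boundP (ltW (_ : 0 < del^-1)); rewrite invr_gt0 => /(_ del0) h.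
  exists (Num.bound del^-1); rewrite -[leRHS]invrK lef_pV2 ?posrE ?invr_gt0//.
  by rewrite (le_trans (ltW h))// ler_nat.
rewrite -leeBlDr// -EFinB; apply: (@limn_einf_ge _ _ N) => n Nn.
have nN : n.+1%:R^-1 <= del.
  by apply: le_trans hN; rewrite lef_pV2 ?posrE// ler_nat.
pose g (x : R * R) : 'I_(2 * n.+1) * 'I_(2 * n.+1) :=
  match pselect (exists c, grid U n c x) with
  | left h => projT1 (cid h)
  | right _ => (ord0, ord0)
  end.
have gP x : U x -> grid U n (g x) x.
  move=> /(grid_cover n UD) h; rewrite /g; case: pselect => // h'.
  by case: (cid h').
have nd x y : grid U n (g x) y -> U x -> near_pt del x y.
  move=> gy /gP gx; have [a b] := grid_near gx gy.
  by split; exact: lt_le_trans nN.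
have gI : {in s &, injective g}.
  move=> x y xs ys gxy; have [_] := hdel (x, y) (allpairs_f _ xs ys).
  apply => /=; apply: nd; last by case: (sU _ xs).
  by rewrite gxy; apply: gP; case: (sU _ ys).
apply: le_trans (@pair_sum_ge _ _ _ _ _ (grid U n) (@hinf n) w s g _ us _ gI); last 2 first.
- by move=> c c'; exact: hinf_ge0.
- by move=> x xs; have [? ?] := sU _ xs; split => //; exact: gP.
rewrite lee_fin.
apply: (@le_trans _ _ (\sum_(x <- s) (\sum_(y <- s | y != x) H x y - m * e'))).
  rewrite sumrB big_const_seq iter_addr addr0 count_predT lerB//.
  rewrite -mulr_natl -/m mulrA /e' mulrCA -[leRHS]mulr1 ler_pM2l//.
  by rewrite ler_pdivrMr// mul1r lerDl.
rewrite big_seq [leRHS]big_seq; apply: ler_sum => x xs.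
rewrite lerBlDr -[leLHS]addr0.
apply: (@le_trans _ _ (\sum_(y <- s | y != x) (hinf (g x) (g y) + e'))).
  rewrite addr0 big_seq_cond [leRHS]big_seq_cond; apply: ler_sum => y /andP[ys _].
  have [_ Ux] := sU _ xs; have [_ Uy] := sU _ ys.
  rewrite -lerBlDr; apply: (@le_hinf _ _ _ x y); [exact: gP|exact: gP|].
  move=> x' y' gx gy; have [+ _] := hdel (x, y) (allpairs_f _ xs ys).
  by apply => /=; exact: nd.
rewrite big_split /= lerD2l.
rewrite big_const_seq iter_addr addr0 -mulr_natl ler_pM2r// ler_nat.
exact: count_size.
Qed.

Lemma expected_lower_pair_sum_le (M : \bar R) :
  (forall n, \sum_c \sum_c' (@hinf n c c')%:E *
     (intensity (grid U n c) * intensity (grid U n c')) <= M)%E ->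
  (\int[P]_w lower_pair_sum w <= M)%E.
Proof.
move=> hM; apply: le_trans (fatou _ _ _ _) _ => //.
- by move=> n; exact: (measurable_pair_sum HX).
- by move=> n w _; apply: pair_sum_ge0 => // c c'; exact: hinf_ge0.
rewrite limn_einf_supE; apply: ge_ereal_sup => _ [n _ <-].
apply: (@le_trans _ _ (\int[P]_w pair_sum X (grid U n) (@hinf n) w)%E).
  by apply: ereal_inf_lbound; exists n => /=.
apply: le_trans (hM n); apply: (expected_pair_sum_le HX) => //.
- exact: grid_disj.
- by move=> c c'; exact: hinf_ge0.
Qed.

End PairSumFatou.
Arguments grid {R} U n c.
Arguments hinf {R} U H n c c'.

(* Chebyshev's inequality in a form that needs only an upper bound on the
   factorial moment [E[N (N - 1)]]. *)
Lemma deviation_ineq (R : realType) (m n : R) (b : bool) :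
  0 <= n -> (b -> n < m / 2) ->
  2 * m * n + m ^+ 2 / 4 * b%:R <= n * (n - 1) + n + m ^+ 2.
Proof.
case: b => n0 h; rewrite /= ?mulr0n ?mulr1n ?mulr0 ?mulr1; last by have := sqr_ge0 (n - m); nra.
have {}h := h isT; have a : 0 < m / 2 - n by lra.
have b : 0 < 3 * m / 2 - n by lra.
have := mulr_gt0 a b; nra.
Qed.

(** * First and second moment bounds *)

Section PairSumBounds.
Context (R : realType) (d : measure_display) (Omega : measurableType d).
Context (P : probability Omega R) (X : Omega -> set (R * R)).
Hypothesis HX : bergman_dpp P X.
Local Notation leb := (@leb2 R).
Context (U : set (R * R)).
Hypotheses (mU : measurable U) (cU : rel_compact U).

Let UD := rel_compact_disk cU.

Lemma grid_indic n (J : 'I_(2 * n.+1) * 'I_(2 * n.+1) -> \bar R) c y :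
  (forall c, 0 <= J c)%E -> grid U n c y ->
  (\sum_c' J c' * (\1_(grid U n c') y)%:E = J c)%E.
Proof.
move=> J0 cy; rewrite (bigD1 c)//= indicE mem_set// mule1 big1 ?adde0// => c' cc'.
rewrite indicE memNset ?mule0// => c'y.
by have : (set0 : set (R * R)) y by rewrite -(grid_disj U cc').
Qed.

Lemma sum_grid n (J : 'I_(2 * n.+1) * 'I_(2 * n.+1) -> \bar R) :
  (forall c, 0 <= J c)%E ->
  (\sum_c J c * leb (grid U n c) =
   \int[leb]_(y in U) \sum_c J c * (\1_(grid U n c) y)%:E)%E.
Proof.
move=> J0.
have mI c : measurable_fun U (fun y => (\1_(grid U n c) y : R)%:E).
  by apply/measurable_EFinP; apply: measurable_indic; exact: measurable_grid.
have mJ c : measurable_fun U (fun y => J c * (\1_(grid U n c) y : R)%:E)%E.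
  by apply: emeasurable_funM.
transitivity (\sum_c \int[leb]_(y in U) (J c * (\1_(grid U n c) y)%:E))%E.
  apply: eq_bigr => c _; rewrite ge0_integralZl//; last exact: mI.
  have mG := measurable_grid c mU.
  have GU : grid U n c `&` U = grid U n c by rewrite setIidl//; exact: subIsetl.
  by congr (_ * _)%E; rewrite integral_indic ?GU.
rewrite -ge0_integral_sum//.
by move=> c y _; rewrite mule_ge0 ?lee_fin.
Qed.

Lemma sum_intensity_grid n : (\sum_c intensity (grid U n c) = intensity U)%E.
Proof.
rewrite /intensity.
rewrite -ge0_sume_distrr; last first.
  by move=> c _; apply: integral_ge0 => y _; rewrite lee_fin rho1_ge0.
congr (_ * _)%E.
have e : \big[setU/set0]_(c <- index_enum _) grid U n c = U.
  apply/seteqP; split => y.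
    by rewrite -bigcup_seq => -[c _ []].
  by move=> /(grid_cover n UD)[c cy]; rewrite -bigcup_seq; exists c => //=; rewrite mem_index_enum.
rewrite -[in RHS]e ge0_integral_bigsetU//.
- by move=> c; exact: measurable_grid.
- exact: index_enum_uniq.
- apply/trivIsetP => c c' _ _ cc'.
  by rewrite setIC; apply: grid_disj.
- by rewrite e; exact: measurable_rho1.
- by move=> y _; rewrite lee_fin rho1_ge0.
Qed.

Lemma hinf1_le1 n c c' : hinf U (fun _ _ => 1) n c c' <= 1 :> R.
Proof.
rewrite /hinf; set S := [set _ | _].
have [->|/set0P[_ [x [y [cx cy _]]]]] := eqVneq S set0; first by rewrite inf0.
apply: ge_inf; last by exists x, y.
by exists 1 => _ [? [? [_ _ ->]]].
Qed.

Lemma expected_pairs_le :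
  (\int[P]_w lower_pair_sum X U (fun _ _ => 1%R) w <= intensity U * intensity U)%E.
Proof.
apply: (expected_lower_pair_sum_le HX mU cU) => // n.
rewrite -[in leRHS](sum_intensity_grid n) ge0_sume_distrl; last first.
  by move=> c _; exact: intensity_ge0.
apply: lee_sum => c _; rewrite ge0_sume_distrr; last first.
  by move=> c' _; exact: intensity_ge0.
apply: lee_sum => c' _; rewrite -[leRHS]mul1e lee_wpmul2r ?lee_fin ?hinf1_le1//.
by rewrite mule_ge0 ?intensity_ge0.
Qed.

Let alg (k h a b : \bar R) :
  (h * ((k * a) * (k * b)) = (k * k) * ((h * b) * a))%E.
Proof. by rewrite -(muleA h b a) (muleC b a) [RHS]muleCA muleACA. Qed.

(** The intensity of a cell is at most [kap / pi] times its area, and the infima over pairs of cells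
    form a step function below [H]; what remains is a lower sum of the double integral. *)
Lemma expected_weighted_pairs_le (H : R * R -> R * R -> R) (kap : R) :
  0 <= kap -> (forall x, U x -> rho1 x <= kap) ->
  (forall x y, 0 <= H x y) ->
  (forall x y e, 0 < e -> exists2 del, 0 < del & forall x' y',
    near_pt del x x' -> near_pt del y y' -> H x y - e <= H x' y') ->
  (\int[P]_w lower_pair_sum X U H w <= ((kap / pi) ^+ 2)%:E *
    \int[leb]_(x in U) \int[leb]_(y in U) (H x y)%:E)%E.
Proof.
move=> kap0 hk H0 Hlsc.
have k0 : 0 <= kap / pi :> R by rewrite divr_ge0 ?pi_ge0.
apply: (expected_lower_pair_sum_le HX mU cU) => // n.
have hi c : (intensity (grid U n c) <= (kap / pi)%:E * leb (grid U n c))%E.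
  have mG := measurable_grid c mU.
  rewrite /intensity mulrC EFinM -muleA lee_pmul2l ?lte_fin ?invr_gt0 ?pi_gt0//.
  have -> : (kap%:E * leb (grid U n c) = \int[leb]_(x in grid U n c) kap%:E)%E.
    by symmetry; apply: integral_cst.
  apply: le_integral_nonmeas => x [Ux _]; rewrite lee_fin//; exact: hk.
have h0 c c' := hinf_ge0 U H0 c c'.
have l0 c : (0 <= leb (grid U n c))%E by exact: measure_ge0.
apply: (@le_trans _ _ (\sum_c \sum_c' (hinf U H n c c')%:E *
    (((kap / pi)%:E * leb (grid U n c)) * ((kap / pi)%:E * leb (grid U n c')))))%E.
  apply: lee_sum => c _; apply: lee_sum => c' _.
  by rewrite lee_wpmul2l ?lee_fin// lee_pmul ?intensity_ge0.
pose J c : \bar R := (\sum_c' (hinf U H n c c')%:E * leb (grid U n c'))%E.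
have J0 c : (0 <= J c)%E by apply: sume_ge0 => c' _; rewrite mule_ge0 ?lee_fin.
have -> : (\sum_c \sum_c' (hinf U H n c c')%:E *
    (((kap / pi)%:E * leb (grid U n c)) * ((kap / pi)%:E * leb (grid U n c'))) =
    ((kap / pi) ^+ 2)%:E * \sum_c J c * leb (grid U n c))%E.
  rewrite ge0_sume_distrr; last by move=> c _; rewrite mule_ge0.
  apply: eq_bigr => c _; rewrite /J ge0_sume_distrl; last first.
    by move=> c' _; rewrite mule_ge0 ?lee_fin.
  rewrite ge0_sume_distrr; last by move=> c' _; rewrite !mule_ge0 ?lee_fin.
  apply: eq_bigr => c' _.
  by rewrite expr2 (EFinM (kap / pi)); exact: alg.
rewrite lee_wpmul2l ?lee_fin ?sqr_ge0// sum_grid//.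
apply: le_integral_nonmeas => x Ux.
  by apply: integral_ge0 => y _; rewrite lee_fin.
have [c cx] := grid_cover n UD Ux; rewrite (grid_indic J0 cx).
rewrite /J sum_grid; last by move=> c'; rewrite lee_fin.
apply: le_integral_nonmeas => y Uy; first by rewrite lee_fin.
have [c' cy] := grid_cover n UD Uy; rewrite (grid_indic _ cy); last first.
  by move=> c''; rewrite lee_fin.
by rewrite lee_fin; exact: hinf_le.
Qed.

(** Integrating [deviation_ineq] gives [2 m^2 + (m^2 / 4) P(E) <= m^2 + m + m^2], since the pair sum
    with constant weight 1 dominates [N (N - 1)] and has expectation at most [m^2]. *)
Lemma count_lower_tail (m : R) : 0 < m -> intensity U = m%:E ->
  let E := [set w | (ncount U (X w) < (m / 2)%:E)%E] in
  measurable E /\ (P E <= (4 / m)%:E)%E.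
Proof.
move=> m0 Um E.
have mN := measurable_ncount HX mU cU.
have mE : measurable E.
  rewrite /E -[X in measurable X]setTI.
  exact: emeasurable_fun_infty_o.
split => //.
pose Y := lower_pair_sum X U (fun _ _ => 1).
have lsc1 : forall (x y : R * R) (e : R), 0 < e -> exists2 del : R, 0 < del &
  forall x' y' : R * R, near_pt del x x' -> near_pt del y y' -> (1 : R) - e <= 1.
  by move=> x y e e0; exists 1 => // x' y' _ _; rewrite lerBlDr lerDl ltW.
have h1 (x y : R * R) : (0 : R) <= 1 by [].
have mY : measurable_fun setT Y by exact: (measurable_lower_pair_sum HX).
have Y0 w : (0 <= Y w)%E by exact: lower_pair_sum_ge0.
have N0 w : (0 <= ncount U (X w))%E by exact: ncount_ge0.
have pt w : ((2 * m)%:E * ncount U (X w) + (m ^+ 2 / 4)%:E * (\1_E w)%:E <=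
    Y w + ncount U (X w) + (m ^+ 2)%:E)%E.
  have [cX _ _] := HX; have [s us sE] := finite_conf_seq (cX w) cU.
  have nE := ncountE us sE.
  have : ((\sum_(x <- s) \sum_(y <- s | y != x) 1 : R)%:E <= Y w)%E.
    apply: lower_pair_sum_ge => // x xs.
    by have : (X w `&` U) x by rewrite sE.
  have -> : \sum_(x <- s) \sum_(y <- s | y != x) 1 =
      (size s)%:R * ((size s)%:R - 1) :> R.
    rewrite big_seq (eq_bigr (fun=> (size s)%:R - 1)); last first.
      move=> x xs; rewrite big_const_seq iter_addr addr0.
      rewrite -(count_predC (pred1 x) s) natrD count_uniq_mem// xs.
      by rewrite addrAC subrr add0r.
    by rewrite -big_seq big_const_seq iter_addr addr0 count_predT mulr_natl.
  rewrite nE => h.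
  apply: (@le_trans _ _ (((size s)%:R * ((size s)%:R - 1))%:E + (size s)%:R%:E + (m ^+ 2)%:E))%E.
    rewrite -!EFinM -!EFinD lee_fin indicE; apply: deviation_ineq => //.
    by rewrite inE /E /= nE lte_fin.
  by rewrite leeD2r// leeD2r.
have I : (\int[P]_w ((2 * m)%:E * ncount U (X w) + (m ^+ 2 / 4)%:E * (\1_E w)%:E) <=
    \int[P]_w (Y w + ncount U (X w) + (m ^+ 2)%:E))%E.
  apply: le_integral_nonmeas => w _ //.
  by rewrite !adde_ge0// lee_fin sqr_ge0.
have c0 : 0 <= m ^+ 2 / 4 by rewrite divr_ge0 ?sqr_ge0.
have m20 : 0 <= 2 * m by rewrite mulr_ge0 ?ltW.
have mI : measurable_fun setT (fun w => (\1_E w : R)%:E).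
  by apply/measurable_EFinP; exact: measurable_indic.
move: I; rewrite ge0_integralD//; last 4 first.
- by move=> w _; rewrite mule_ge0 ?lee_fin.
- exact: measurable_funeM.
- by move=> w _; rewrite mule_ge0 ?lee_fin.
- exact: measurable_funeM.
rewrite ge0_integralZl_EFin// ge0_integralZl_EFin//.
rewrite (expected_count HX)// Um integral_indic// setIT.
rewrite ge0_integralD//; last 3 first.
- by move=> w _; rewrite adde_ge0.
- exact: emeasurable_funD.
- by move=> w _; rewrite lee_fin sqr_ge0.
rewrite ge0_integralD// (expected_count HX)// Um.
have Ic : (\int[P]_w (m ^+ 2)%:E = (m ^+ 2)%:E)%E.
  transitivity ((m ^+ 2)%:E * P setT)%E; first exact: integral_cst.
  by rewrite probability_setT mule1.
rewrite Ic.
have pf : P E \is a fin_num by exact: fin_num_measure.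
move=> h.
have {h} : ((2 * m)%:E * m%:E + (m ^+ 2 / 4)%:E * P E <=
    m%:E * m%:E + m%:E + (m ^+ 2)%:E)%E.
  apply: le_trans h _; rewrite leeD2r// leeD2r//.
  by rewrite -Um; exact: expected_pairs_le.
rewrite -(fineK pf) -!EFinM -!EFinD !lee_fin => h.
rewrite ler_pdivlMr//.
have : (fine (P E) * m) * m <= 4 * m by clear h1 lsc1; nra.
by rewrite ler_pM2r.
Qed.

End PairSumBounds.

(** * The geometry of hyperbolic annuli *)

Section HyperbolicGeometry.
Context (R : realType) (z : R * R).
Hypothesis zD : diskD z.
Local Notation zeta := (cabs (toC z)).

Let zeta1 : zeta < 1. Proof. exact: zD. Qed.
Let zeta0 : 0 <= zeta. Proof. exact: cabs_ge0. Qed.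

Let le_sqr (a b : R) : 0 <= a -> a <= b -> a ^+ 2 <= b ^+ 2.
Proof. by move=> a0 ab; rewrite lerXn2r// nnegrE// (le_trans a0). Qed.

Definition den2 (x : R * R) : R := cabs (1 - conjc (toC z) * toC x) ^+ 2.

(** The pseudohyperbolic distance from [z]. *)
Definition pdist (x : R * R) : R := cabs (phiz (toC z) (toC x)).

Lemma den2E x : den2 x = 1 - 2 * (z.1 * x.1 + z.2 * x.2) + nsq z * nsq x.
Proof. by rewrite /den2 cabs_sqr /= /nsq; ring. Qed.

Lemma den2_ge x : diskD x -> (1 - zeta * cabs (toC x)) ^+ 2 <= den2 x.
Proof.
move=> x1; have zx : zeta * cabs (toC x) <= 1.
  by rewrite mulr_ile1 ?cabs_ge0// ltW.
rewrite /den2 lerXn2r ?nnegrE ?subr_ge0 ?cabs_ge0//.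
by have := le_cabsB 1 (conjc (toC z) * toC x); rewrite cabs1 cabsM cabsJ.
Qed.

Lemma zx_lt1 x : diskD x -> zeta * cabs (toC x) < 1.
Proof.
move=> x1; apply: le_lt_trans x1.
by rewrite ler_piMl ?cabs_ge0// ltW.
Qed.

Lemma den2_gt0 x : diskD x -> 0 < den2 x.
Proof.
by move=> x1; apply: lt_le_trans (den2_ge x1); rewrite exprn_gt0// subr_gt0 zx_lt1.
Qed.

Lemma den2_le4 x : diskD x -> den2 x <= 4.
Proof.
move=> x1; have -> : 4 = 2 ^+ 2 :> R by ring.
rewrite /den2 lerXn2r ?nnegrE ?cabs_ge0//.
have := le_cabsD 1 (- (conjc (toC z) * toC x)).
by rewrite cabs1 cabsN cabsM cabsJ; have := zx_lt1 x1; lra.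
Qed.

Lemma pdist_sqr x : diskD x ->
  1 - pdist x ^+ 2 = (1 - zeta ^+ 2) * (1 - nsq x) / den2 x.
Proof.
move=> x1; have d0 := den2_gt0 x1.
rewrite /pdist /phiz cabsM cabsV exprMn exprVn -/(den2 x).
rewrite -[X in X - _](@divff _ (den2 x)) ?gt_eqF// -mulrBl; congr (_ / _).
by rewrite den2E -!nsqE cabs_sqr /= /nsq; ring.
Qed.

Lemma pdist_ge0 x : 0 <= pdist x. Proof. exact: cabs_ge0. Qed.

Lemma pdist_lt1 x : diskD x -> pdist x < 1.
Proof.
move=> x1; rewrite -(@expr_lt1 _ 2) ?pdist_ge0// -subr_gt0 pdist_sqr//.
rewrite divr_gt0 ?den2_gt0// mulr_gt0// subr_gt0 ?expr_lt1//.
by rewrite nsq_lt1.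
Qed.

(** This is [tanh (t / 2)], the pseudohyperbolic radius of a hyperbolic disc of radius [t]. *)
Definition hyp_radius (t : R) : R := (1 - expR (- t)) / (1 + expR (- t)).

Lemma dh_lt x t : diskD x -> (dh z x < t) = (pdist x < hyp_radius t).
Proof.
move=> x1; rewrite /dh -/(pdist x); have q1 := pdist_lt1 x1; have q0 := pdist_ge0 x.
have e0 : 0 < expR (- t) by exact: expR_gt0.
have e1 : 0 < 1 + expR (- t) by rewrite addr_gt0.
rewrite -[in LHS](expRK t) ltr_ln ?posrE ?expR_gt0 ?divr_gt0 ?subr_gt0 ?ltr_wpDr//.
rewrite ltr_pdivrMr ?subr_gt0// /hyp_radius ltr_pdivlMr//.
rewrite -(@ltr_pM2l _ (expR (- t)))// mulrA -expRD addNr expR0 mul1r.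
by apply/idP/idP => h; lra.
Qed.

Lemma hyp_radius_sqr t : 1 - hyp_radius t ^+ 2 =
  4 * expR (- t) / (1 + expR (- t)) ^+ 2.
Proof.
have e1 : 0 < 1 + expR (- t) by rewrite addr_gt0 ?expR_gt0.
by rewrite /hyp_radius; field; rewrite gt_eqF.
Qed.

Lemma hyp_radius_ge0 t : 0 <= t -> 0 <= hyp_radius t < 1.
Proof.
move=> t0; have e0 := expR_gt0 (- t).
have e1 : expR (- t) <= 1 by rewrite -expR0 ler_expR oppr_le0.
rewrite /hyp_radius; apply/andP; split; first by apply: divr_ge0; lra.
by rewrite ltr_pdivrMr ?addr_gt0//; lra.
Qed.

Variable k : nat.
Local Notation e := (expR (- k.+1%:R : R)).
Local Notation Q := (hyp_radius k.+1%:R).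

(* the largest modulus in the hyperbolic disc of centre [z] and radius [k+1] *)
Definition outer_radius : R := (zeta + Q) / (1 + zeta * Q).
Definition rho_k : R := 1 - outer_radius ^+ 2.
Local Notation Rk := outer_radius.
Local Notation rho := rho_k.

Let Q0 : 0 <= Q. Proof. by have /andP[] := hyp_radius_ge0 (ler0n R k.+1). Qed.
Let Q1 : Q < 1. Proof. by have /andP[] := hyp_radius_ge0 (ler0n R k.+1). Qed.
Let den0 : 0 < 1 + zeta * Q. Proof. by rewrite ltr_wpDr// mulr_ge0. Qed.

Lemma outer_radius_ge0 : 0 <= Rk.
Proof. by apply: divr_ge0; [exact: addr_ge0|exact: ltW]. Qed.

Lemma outer_radius_lt1 : Rk < 1.
Proof.
rewrite ltr_pdivrMr// mul1r -subr_gt0.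
have -> : 1 + zeta * Q - (zeta + Q) = (1 - zeta) * (1 - Q) by ring.
by rewrite mulr_gt0// subr_gt0.
Qed.

Lemma zR_lt1 : 0 < 1 - zeta * Rk.
Proof.
rewrite subr_gt0; apply: le_lt_trans outer_radius_lt1.
by rewrite ler_piMl ?outer_radius_ge0// ltW.
Qed.

Lemma outer_radiusE : Rk - zeta = Q * (1 - zeta * Rk).
Proof. by rewrite /outer_radius; field; rewrite gt_eqF. Qed.

Lemma rho_gt0 : 0 < rho.
Proof. by rewrite subr_gt0 expr_lt1// ?outer_radius_lt1// outer_radius_ge0. Qed.

(** This is [pdist_sqr] at the outermost boundary point, where [pdist] equals [Q] and the
    denominator is [(1 - zeta * Rk) ^+ 2]. *)
Lemma outer_radius_id : (1 - Q ^+ 2) * (1 - zeta * Rk) ^+ 2 = (1 - zeta ^+ 2) * rho.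
Proof.
by rewrite mulrBl mul1r -exprMn -outer_radiusE /rho; ring.
Qed.

Lemma e_gt0 : 0 < e. Proof. exact: expR_gt0. Qed.
Lemma e_le1 : e <= 1. Proof. by rewrite -expR0 ler_expR oppr_le0. Qed.

(** By [hyp_radius_sqr], [1 - Q ^+ 2] lies between [e] and [4 * e]; with [rho_le_e] this makes [rho]
    comparable to [exp (- k)] up to constants depending on [z] only. *)
Lemma rho_ge_e : (1 - zeta) ^+ 2 * e <= rho.
Proof.
have z2 : 0 < 1 - zeta ^+ 2 by rewrite subr_gt0 expr_lt1.
have z2' : 1 - zeta ^+ 2 <= 1 by rewrite gerBl sqr_ge0.
rewrite -(@ler_pM2l _ (1 - zeta ^+ 2))// -outer_radius_id hyp_radius_sqr.
have e0 := e_gt0; have e1 := e_le1.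
have h1 : e <= 4 * e / (1 + e) ^+ 2.
  rewrite ler_pdivlMr ?exprn_gt0 ?addr_gt0// mulrC ler_wpM2r ?(ltW e0)//.
  have -> : 4 = 2 ^+ 2 :> R by ring.
  by apply: le_sqr; lra.
have h2 : (1 - zeta) ^+ 2 <= (1 - zeta * Rk) ^+ 2.
  apply: le_sqr; first by rewrite subr_ge0 ltW.
  by rewrite lerD2l lerN2 ler_piMr// ltW// outer_radius_lt1.
apply: (@le_trans _ _ (e * (1 - zeta) ^+ 2)).
  rewrite [leRHS]mulrC ler_piMl// mulr_ge0 ?sqr_ge0// ltW//.
by rewrite ler_pM ?sqr_ge0 ?(ltW e0).
Qed.

Lemma rho_le_e : rho <= 4 / (1 - zeta ^+ 2) * e.
Proof.
have z2 : 0 < 1 - zeta ^+ 2 by rewrite subr_gt0 expr_lt1.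
have e0 := e_gt0.
rewrite mulrAC ler_pdivlMr// mulrC -outer_radius_id hyp_radius_sqr.
rewrite -[leRHS]mulr1 ler_pM ?sqr_ge0 ?divr_ge0 ?sqr_ge0 ?mulr_ge0 ?(ltW e0)//.
  rewrite ler_pdivrMr ?exprn_gt0 ?addr_gt0// ler_peMr ?mulr_ge0 ?(ltW e0)//.
  by rewrite exprn_ege1// lerDl ltW.
rewrite expr_le1//; last exact: ltW zR_lt1.
by rewrite gerBl mulr_ge0// outer_radius_ge0.
Qed.

(** A point of modulus [a >= zeta] has [pdist] at least [(a - zeta) / (1 - zeta * a)], which
    increases with [a] and reaches [Q] at [Rk]. *)
Lemma lt_outer_radius x : diskD x -> dh z x < k.+1%:R -> cabs (toC x) < Rk.
Proof.
move=> x1; rewrite dh_lt// => qQ; rewrite ltNge; apply/negP => Rx.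
set a := cabs (toC x) in Rx *.
have za : 0 < 1 - zeta * a by rewrite subr_gt0; exact: zx_lt1.
have : Q ^+ 2 <= pdist x ^+ 2.
  rewrite -lerN2 -(lerD2l 1) pdist_sqr// ler_pdivrMr ?den2_gt0//.
  apply: le_trans (ler_wpM2l _ (den2_ge x1)); last first.
    by rewrite subr_ge0 expr_le1 ?(ltW Q1).
  have : 0 <= (a - zeta) - Q * (1 - zeta * a).
    have -> : (a - zeta) - Q * (1 - zeta * a) = (a - Rk) * (1 + zeta * Q).
      rewrite mulrBl [Rk * _]mulfVK ?gt_eqF//; ring.
    by rewrite mulr_ge0 ?subr_ge0// ltW.
  rewrite subr_ge0 => h.
  have Qa : 0 <= Q * (1 - zeta * a) by rewrite mulr_ge0// ltW.
  have := le_sqr Qa h; rewrite nsqE -/a.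
  have -> : (1 - Q ^+ 2) * (1 - zeta * a) ^+ 2 =
    (1 - zeta * a) ^+ 2 - (Q * (1 - zeta * a)) ^+ 2 by ring.
  have -> : (1 - zeta ^+ 2) * (1 - a ^+ 2) =
    (1 - zeta * a) ^+ 2 - (a - zeta) ^+ 2 by ring.
  by rewrite lerD2l lerN2.
have := ltr_pM (pdist_ge0 x) (pdist_ge0 x) qQ qQ; rewrite -!expr2; lra.
Qed.

(** One factor 4 comes from [hyp_radius_sqr], the other from [den2_le4], and [expR 1] from passing
    from radius [k] to [k.+1]. The denominators come from [pdist_sqr] and [rho_ge_e]. *)
Definition annulus_const : R := 16 * expR 1 / ((1 - zeta ^+ 2) * (1 - zeta) ^+ 2).

Lemma inner_bound x : diskD x -> k%:R <= dh z x -> 1 - nsq x <= annulus_const * rho.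
Proof.
move=> x1; rewrite leNgt dh_lt// -leNgt => qQ.
have z2 : 0 < 1 - zeta ^+ 2 by rewrite subr_gt0 expr_lt1.
have z3 : 0 < (1 - zeta) ^+ 2 by rewrite exprn_gt0// subr_gt0.
have e0 := e_gt0.
have Ee : expR (- k%:R) = expR 1 * e.
  by rewrite -expRD -natr1 opprD addrCA subrr addr0.
have Qk0 : 0 <= hyp_radius k%:R by have /andP[] := hyp_radius_ge0 (ler0n R k).
have h : 1 - pdist x ^+ 2 <= 4 * (expR 1 * e).
  apply: (@le_trans _ _ (1 - hyp_radius k%:R ^+ 2)).
    by rewrite lerD2l lerN2 lerXn2r// nnegrE ?pdist_ge0.
  rewrite hyp_radius_sqr Ee ler_pdivrMr ?exprn_gt0 ?addr_gt0 ?mulr_gt0 ?expR_gt0//.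
  rewrite ler_peMr ?mulr_ge0 ?expR_ge0 ?(ltW e0)// exprn_ege1// lerDl.
  by rewrite mulr_ge0 ?expR_ge0// ltW.
move: h; rewrite pdist_sqr// ler_pdivrMr ?den2_gt0// => h.
have h2 : (1 - zeta ^+ 2) * (1 - nsq x) <= 16 * expR 1 * e.
  apply: le_trans h _; have -> : 16 * expR 1 * e = 4 * (expR 1 * e) * 4 by ring.
  by rewrite ler_wpM2l ?den2_le4// !mulr_ge0 ?expR_ge0// ltW.
have h3 : (1 - nsq x) * ((1 - zeta ^+ 2) * (1 - zeta) ^+ 2) <= 16 * expR 1 * rho.
  rewrite mulrA [X in X * _]mulrC; apply: le_trans (ler_wpM2r (ltW z3) h2) _.
  rewrite -[leLHS]mulrA [e * _]mulrC; apply: ler_wpM2l; last exact: rho_ge_e.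
  by rewrite mulr_ge0 ?expR_ge0.
by rewrite /annulus_const mulrAC ler_pdivlMr// mulr_gt0.
Qed.

End HyperbolicGeometry.

(** * A thin sector near the outermost point of the annulus *)

Section Sector.
Variable R : realType.
Local Notation leb := (@leb2 R).

(** A window around the ray through [u], cut by the transverse coordinate and not by an angle, so
    that its slices parallel to [u] are intervals. *)
Definition sector (u : R * R) (a b h : R) : set (R * R) :=
  [set p | [&& a <= nsq p, nsq p < b, `|u.1 * p.2 - u.2 * p.1| <= h &
    0 < u.1 * p.1 + u.2 * p.2]].

Lemma measurable_sector u a b h : measurable (sector u a b h).
Proof.
pose f1 (p : R * R) := u.1 * p.2 - u.2 * p.1.
pose f2 (p : R * R) := u.1 * p.1 + u.2 * p.2.
have m1 : measurable_fun setT f1.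
  by apply: measurable_funB; apply: measurable_funM.
have m2 : measurable_fun setT f2.
  by apply: measurable_funD; apply: measurable_funM.
have -> : sector u a b h =
    ann a b `&` (f1 @^-1` `[-h, h] `&` f2 @^-1` `]0, +oo[).
  apply/seteqP; split => p; rewrite /sector /ann /f1 /f2 /= !in_itv /= ?andbT -ler_norml.
    by move=> /and4P[-> -> -> ->].
  by move=> [/andP[-> ->] [-> ->]].
apply: measurableI; first exact: measurable_ann.
by apply: measurableI; rewrite -[X in measurable X]setTI; [exact: m1|exact: m2].
Qed.

(** After a rotation to [u = (1, 0)], the slice at height [y] contains the interval between
    [sqrt (a - y^2)] and [sqrt (b - y^2)]. Its length is [b - a] divided by the sum of two roots
    that are at most 1, and there are heights of total length [2 h]. *)
Lemma leb2_sector_ge u a b h : u.1 ^+ 2 + u.2 ^+ 2 = 1 -> 0 <= h ->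
  h ^+ 2 <= a -> a <= b -> b <= 1 ->
  ((h * (b - a))%:E <= leb (sector u a b h))%E.
Proof.
move=> u1 h0 ha ab b1; pose v : R * R := (u.1, - u.2).
pose A := sector (1, 0) a b h.
have mA : measurable A by exact: measurable_sector.
have v1 : v.1 ^+ 2 + v.2 ^+ 2 = 1 by rewrite /v /= sqrrN.
have -> : sector u a b h = plane_rot v @^-1` A.
  have e1 p : (1, 0).1 * (plane_rot v p).2 - (1, 0).2 * (plane_rot v p).1 =
      u.1 * p.2 - u.2 * p.1 by rewrite /plane_rot /v /=; ring.
  have e2 p : (1, 0).1 * (plane_rot v p).1 + (1, 0).2 * (plane_rot v p).2 =
      u.1 * p.1 + u.2 * p.2 by rewrite /plane_rot /v /=; ring.
  by apply/seteqP; split => p; rewrite /A /sector /preimage /mkset e1 e2 nsq_rot.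
rewrite leb2_rot// leb2E2//.
pose I : set R := `[-h, h]%classic.
have mI : measurable I by exact: measurable_itv.
apply: (@le_trans _ _ (\int[lebesgue_measure]_(y in I) ((b - a) / 2)%:E)%E).
  have -> : (\int[lebesgue_measure]_(y in I) ((b - a) / 2)%:E =
      ((b - a) / 2)%:E * lebesgue_measure I)%E by exact: integral_cst.
  rewrite lebesgue_measure_itv /= lte_fin; case: ifPn => [hh|].
    by rewrite -EFinB -EFinM lee_fin; lra.
  rewrite -leNgt => hh; have -> : h = 0 by lra.
  by rewrite mul0r mule0.
rewrite integral_mkcond; apply: le_integral_nonmeas => y _; first exact: measure_ge0.
rewrite /patch; case: ifPn => [|_]; last exact: measure_ge0.
rewrite inE /I /= in_itv /= -ler_norml => yh.
have y2 : y ^+ 2 <= h ^+ 2.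
  by rewrite -(real_normK (num_real y)) lerXn2r// nnegrE.
pose sa := Num.sqrt (a - y ^+ 2); pose sb := Num.sqrt (b - y ^+ 2).
have sa0 : 0 <= sa by exact: sqrtr_ge0.
have sb0 : 0 <= sb by exact: sqrtr_ge0.
have sa2 : sa ^+ 2 = a - y ^+ 2 by rewrite sqr_sqrtr//; lra.
have sb2 : sb ^+ 2 = b - y ^+ 2 by rewrite sqr_sqrtr//; lra.
have sab : sa <= sb by rewrite ler_sqrt; lra.
have sb1 : sb <= 1.
  by rewrite -sqrtr1 ler_sqrt//; have := sqr_ge0 y; lra.
apply: (@le_trans _ _ (lebesgue_measure (`]sa, sb[%classic : set R))).
  rewrite lebesgue_measure_itv /= lte_fin; case: ifPn => [ss|].
    rewrite -EFinB lee_fin ler_pdivrMr//.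
    have -> : b - a = (sb - sa) * (sb + sa) by rewrite -subr_sqr sa2 sb2; ring.
    by apply: ler_wpM2l; lra.
  rewrite -leNgt => ss; have e : sa = sb by lra.
  by rewrite lee_fin; have := sa2; rewrite e sb2; lra.
apply: le_measure; rewrite ?inE.
- exact: measurable_itv.
- exact: measurable_ysection.
- move=> x; rewrite /= in_itv /= /ysection /= => /andP[x1 x2].
  rewrite inE /A /sector /nsq /= !mul1r !mul0r subr0 addr0 yh /=.
  have x0 : 0 < x by lra.
  have := ltr_pM sa0 sa0 x1 x1; rewrite -!expr2 sa2 => h1.
  have := ltr_pM (ltW x0) (ltW x0) x2 x2; rewrite -!expr2 sb2 => h2.
  by apply/and3P; split; lra.
Qed.

End Sector.

Section SectorInAnnulus.
Context (R : realType) (z : R * R).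
Hypothesis zD : diskD z.
Local Notation zeta := (cabs (toC z)).
Local Notation leb := (@leb2 R).
Variable k : nat.
Local Notation rho := (rho_k z k).
Local Notation Rk := (outer_radius z k).
Local Notation e := (expR (- k.+1%:R : R)).

Lemma polar_direction : exists u : R * R,
  u.1 ^+ 2 + u.2 ^+ 2 = 1 /\ z = (zeta * u.1, zeta * u.2).
Proof.
have [z0|z0] := eqVneq zeta 0.
  exists (1, 0); split; first by rewrite /= expr1n expr0n addr0.
  move/eqP: z0; rewrite cabs_eq0 => /eqP; rewrite /toC => -[]; case: (z) => a b /= -> ->.
  have -> : cabs (toC (0 : R, 0 : R)) = 0 by rewrite -[toC _]/(0 : R[i]) cabs0.
  by rewrite !mul0r.
exists (z.1 / zeta, z.2 / zeta); split => /=.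
  by rewrite !exprMn -mulrDl -[X in X * _]/(nsq z) nsqE exprVn divff// expf_neq0.
by rewrite !(mulrC zeta) !mulfVK//; case: (z).
Qed.

Variables (u : R * R) (del : R).
Hypotheses (u1 : u.1 ^+ 2 + u.2 ^+ 2 = 1) (zu : z = (zeta * u.1, zeta * u.2)).
Hypotheses (del0 : 0 < del) (del4 : del <= 1 / 4).
Hypotheses (k4 : expR (- k%:R : R) <= 1 / 4).
Hypothesis rho24 : rho <= (1 - zeta) ^+ 2 / 24.

(** A transverse coordinate [h] raises [den2] by order [h^2], and the tolerance is [del] times a
    constant of order [(1 - zeta) ^+ 2]. *)
Definition sector_width : R := Num.sqrt del * (1 - zeta) / 4.
(** The band starts at [rho * (1 + del / 2)] and not at [rho]: this margin pays for the growth of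
    [den2] away from the axis and keeps the sector inside the hyperbolic disc. *)
Definition thin_sector : set (R * R) :=
  sector u (1 - rho * (1 + del)) (1 - rho * (1 + del / 2)) sector_width.

Let zeta1 : zeta < 1. Proof. exact: zD. Qed.
Let zeta0 : 0 <= zeta. Proof. exact: cabs_ge0. Qed.
Let rho0 : 0 < rho. Proof. exact: rho_gt0. Qed.
Let z2 : 0 < 1 - zeta ^+ 2. Proof. by rewrite subr_gt0 expr_lt1. Qed.
Let w0 : 0 < (1 - zeta) ^+ 2. Proof. by rewrite exprn_gt0// subr_gt0. Qed.
Let w1 : (1 - zeta) ^+ 2 <= 1.
Proof. by rewrite expr_le1// ?subr_ge0 ?(ltW zeta1)// gerBl. Qed.

Let rho_small : rho <= 1 / 24.
Proof. by apply: le_trans rho24 _; rewrite ler_wpM2r. Qed.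

Lemma sector_width_sqr : sector_width ^+ 2 = del * (1 - zeta) ^+ 2 / 16.
Proof. by rewrite /sector_width !exprMn sqr_sqrtr ?(ltW del0)//; field. Qed.

Lemma sector_width_ge0 : 0 <= sector_width.
Proof. by rewrite !mulr_ge0 ?sqrtr_ge0 ?invr_ge0// subr_ge0 ltW. Qed.

Lemma rho_del : rho * del <= rho / 4.
Proof. by apply: ler_wpM2l; [exact: ltW|rewrite -div1r]. Qed.

Lemma thin_sector_bounds x : thin_sector x ->
  [/\ diskD x, 1 - nsq x <= rho * (1 + del), rho * (1 + del / 2) < 1 - nsq x &
      1 / 2 <= cabs (toC x)].
Proof.
have r0 := rho0; have rs := rho_small; move=> /and4P[a1 a2 _ _]; have rd := rho_del; have rd0 := mulr_gt0 rho0 del0.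
have x1 : nsq x < 1 by lra.
split; [by rewrite /diskD /= -nsq_lt1|lra|lra|].
rewrite leNgt; apply/negP => x2.
have := ltr_pM (cabs_ge0 (toC x)) (cabs_ge0 (toC x)) x2 x2; rewrite -expr2 -nsqE; lra.
Qed.

(** There are two losses: the modulus [r] falls short of [Rk] by at most [rho * del], and leaving
    the axis adds [2 * zeta * (r - c)], with [r - c] at most twice the squared transverse
    coordinate. Both are small multiples of [del * (1 - zeta) ^+ 2]. *)
Lemma thin_sector_den x : thin_sector x ->
  den2 z x <= (1 - zeta * Rk) ^+ 2 * (1 + del / 2).
Proof.
have r0 := rho0; have rs := rho_small; have w0' := w0; have w1' := w1; have ze0 := zeta0.
move=> Bx; have [xD b1 b2 x2] := thin_sector_bounds Bx.
move: Bx => /and4P[_ _]; set im := _ - _; set c := _ + _ => him c0.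
set r := cabs (toC x) in x2 *.
have r2 : nsq x = r ^+ 2 by rewrite nsqE.
have rc : r ^+ 2 = c ^+ 2 + im ^+ 2.
  by rewrite -r2 -[LHS]mul1r -u1 /nsq /c /im; ring.
have im2 : im ^+ 2 <= del * (1 - zeta) ^+ 2 / 16.
  rewrite -sector_width_sqr -(real_normK (num_real im)).
  by rewrite lerXn2r// nnegrE sector_width_ge0.
have rcle : r - c <= del * (1 - zeta) ^+ 2 / 8.
  have : (r - c) * (r + c) = im ^+ 2 by rewrite -subr_sqr rc; ring.
  have : 0 <= r - c.
    rewrite subr_ge0 leNgt; apply/negP => rltc.
    have := ltr_pM (_ : 0 <= r) (_ : 0 <= r) rltc rltc.
    by rewrite -!expr2 rc => /(_ (cabs_ge0 _) (cabs_ge0 _)); have := sqr_ge0 im; lra.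
  move=> h1 h2; have : (r - c) * (1 / 2) <= im ^+ 2.
    by rewrite -h2 ler_wpM2l//; lra.
  lra.
have dE : den2 z x = (1 - zeta * r) ^+ 2 + 2 * zeta * (r - c).
  have hz1 : z.1 = zeta * u.1 by rewrite [in LHS]zu.
  have hz2 : z.2 = zeta * u.2 by rewrite [in LHS]zu.
  by rewrite den2E hz1 hz2 (nsqE z) r2 /c; ring.
have R2 : 1 / 2 <= Rk.
  rewrite leNgt; apply/negP => R2.
  have := ltr_pM (outer_radius_ge0 z k) (outer_radius_ge0 z k) R2 R2.
  by rewrite -expr2; move: rs; rewrite /rho_k; lra.
have Rr : Rk - r <= rho * del.
  have h : (Rk - r) * (Rk + r) <= rho * del.
    have R2' : Rk ^+ 2 = 1 - rho by rewrite /rho_k; ring.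
    by rewrite -subr_sqr -r2 R2'; lra.
  have [h0|h0] := leP (Rk - r) 0; first by apply: le_trans h0 _; rewrite mulr_ge0 ?ltW.
  by apply: le_trans h; rewrite ler_peMr ?(ltW h0)//; lra.
have zr := zR_lt1 zD k.
have zr1 : 1 - zeta * Rk <= 1.
  by rewrite gerBl mulr_ge0 ?outer_radius_ge0.
have zz : (1 - zeta) ^+ 2 <= (1 - zeta * Rk) ^+ 2.
  rewrite lerXn2r ?nnegrE ?subr_ge0 ?(ltW zeta1)//; last 2 first.
    by rewrite -subr_ge0 ltW.
  by rewrite lerD2l lerN2 ler_piMr// ltW// outer_radius_lt1.
rewrite dE; set A := 1 - zeta * Rk in zr zr1 zz *.
have rd := rho_del; have rd0 := mulr_gt0 rho0 del0.
have h1 : 1 - zeta * r <= A + rho * del.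
  have -> : 1 - zeta * r = A + zeta * (Rk - r) by rewrite /A; ring.
  rewrite lerD2l; have [h0|h0] := leP (Rk - r) 0.
    by apply: (@le_trans _ _ 0); rewrite ?mulr_ge0_le0// ltW.
  by apply: le_trans Rr; rewrite ler_piMl ?ltW.
have h2 : 0 <= 1 - zeta * r by rewrite subr_ge0 ltW// zx_lt1.
have h3 : (1 - zeta * r) ^+ 2 <= (A + rho * del) ^+ 2.
  by rewrite lerXn2r// nnegrE (le_trans h2).
have h4 : (A + rho * del) ^+ 2 <= A ^+ 2 + 3 * (rho * del).
  have -> : (A + rho * del) ^+ 2 =
    A ^+ 2 + 2 * (A * (rho * del)) + (rho * del) * (rho * del) by ring.
  have : A * (rho * del) <= rho * del by rewrite ler_piMl// ltW.
  have : (rho * del) * (rho * del) <= rho * del.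
    by rewrite ler_piMl ?(ltW rd0)//; lra.
  lra.
have h5 : rho * del <= del * (1 - zeta) ^+ 2 / 24.
  by rewrite mulrC -mulrA ler_wpM2l// ltW.
have h6 : zeta * (r - c) <= del * (1 - zeta) ^+ 2 / 8.
  have [h0|h0] := leP (r - c) 0.
    apply: (@le_trans _ _ 0); first by rewrite mulr_ge0_le0.
    by rewrite divr_ge0// mulr_ge0// ltW.
  by apply: le_trans rcle; rewrite ler_piMl ?ltW.
have h7 : del * (1 - zeta) ^+ 2 <= del * A ^+ 2 by rewrite ler_wpM2l ?(ltW del0).
(* In units of [del * (1 - zeta) ^+ 2] the losses are [3 / 24] and [2 / 8], together below the
   available [1 / 2]. *)
have -> : A ^+ 2 * (1 + del / 2) = A ^+ 2 + del * A ^+ 2 / 2 by ring.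
rewrite -mulrA; lra.
Qed.

(** By [pdist_sqr] and [outer_radius_id] both bounds reduce to a comparison of [den2] with
    [(1 - zeta * Rk) ^+ 2]: it exceeds this by a factor of at most [1 + del / 2], below the lower
    edge of the band, and is never smaller. *)
Lemma thin_sector_annulus x : thin_sector x -> k%:R <= dh z x < k.+1%:R.
Proof.
have r0 := rho0; have rs := rho_small; have w0' := w0; have w1' := w1; have ze0 := zeta0.
move=> Bx; have [xD b1 b2 x2] := thin_sector_bounds Bx.
have dle := thin_sector_den Bx.
have d0 := den2_gt0 zD xD.
have A0 : 0 < (1 - zeta * Rk) ^+ 2 by rewrite exprn_gt0// zR_lt1.
have id := outer_radius_id z k.
have Q0 := hyp_radius_ge0 (ler0n R k.+1).
have Qk0 := hyp_radius_ge0 (ler0n R k).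
apply/andP; split; last first.
  rewrite dh_lt// ltNge; apply/negP => qQ.
  have : hyp_radius k.+1%:R ^+ 2 <= pdist z x ^+ 2.
    by case/andP: Q0 => Q0 _; rewrite lerXn2r// nnegrE ?pdist_ge0.
  have -> : pdist z x ^+ 2 = 1 - (1 - pdist z x ^+ 2) by ring.
  rewrite pdist_sqr//; move=> h.
  have {}h : (1 - zeta ^+ 2) * (1 - nsq x) / den2 z x <= 1 - hyp_radius k.+1%:R ^+ 2 by lra.
  move: h; rewrite ler_pdivrMr//; apply/negP; rewrite -ltNge.
  apply: (@le_lt_trans _ _ ((1 - hyp_radius k.+1%:R ^+ 2) *
      ((1 - zeta * Rk) ^+ 2 * (1 + del / 2)))).
    rewrite ler_wpM2l// subr_ge0 expr_le1//; case/andP: Q0 => // _; exact: ltW.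
  by rewrite mulrA id -mulrA ltr_pM2l.
rewrite leNgt dh_lt// -leNgt leNgt; apply/negP => qQ.
have q0 := pdist_ge0 z x.
have : pdist z x ^+ 2 < hyp_radius k%:R ^+ 2.
  by have := ltr_pM q0 q0 qQ qQ; rewrite -!expr2.
have -> : pdist z x ^+ 2 = 1 - (1 - pdist z x ^+ 2) by ring.
rewrite pdist_sqr//; move=> h.
have {h} : 1 - hyp_radius k%:R ^+ 2 < (1 - zeta ^+ 2) * (1 - nsq x) / den2 z x by lra.
apply/negP; rewrite -leNgt ler_pdivrMr//.
set r := cabs (toC x) in x2.
have rR : r < Rk.
  rewrite ltNge; apply/negP => h.
  have := ler_pM (outer_radius_ge0 z k) (outer_radius_ge0 z k) h h.
  rewrite -!expr2 -nsqE; have rd0 := mulr_gt0 rho0 del0.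
  by move: b2; rewrite /rho_k; have := rho0; rewrite {1}/rho_k => *; nra.
have A1 : (1 - zeta * Rk) ^+ 2 <= den2 z x.
  apply: le_trans (den2_ge zD xD); rewrite lerXn2r ?nnegrE//.
  - exact: ltW (zR_lt1 zD k).
  - by rewrite subr_ge0 ltW// zx_lt1.
  - by rewrite lerD2l lerN2 ler_wpM2l// ltW.
have e0 : 0 < e by exact: expR_gt0.
have Ee : expR (- k%:R : R) = expR 1 * e.
  by rewrite -expRD -natr1 opprD addrCA subrr addr0.
have E2 : 2 <= expR 1 :> R by have := expR_ge1Dx (1 : R); lra.
(* shrinking the hyperbolic radius by one multiplies [1 - Q^2] by at least
   [5/4], because [exp 1 >= 2] and [exp (-k) <= 1/4] *)
have Qr : (1 + del) * (1 - hyp_radius k.+1%:R ^+ 2) <= 1 - hyp_radius k%:R ^+ 2 :> R.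
  rewrite !hyp_radius_sqr Ee; set e' := expR 1 * e in Ee *.
  have e'2 : 2 * e <= e' by rewrite ler_wpM2r// ltW.
  have e'4 : e' <= 1 / 4 by rewrite -Ee.
  have e'0 : 0 < e' by lra.
  apply: (@le_trans _ _ (5 * e)).
    rewrite mulrA ler_pdivrMr ?exprn_gt0 ?addr_gt0//.
    apply: (@le_trans _ _ (5 * e)).
      have : del * e <= 1 / 4 * e by rewrite ler_wpM2r// ltW.
      lra.
    by rewrite ler_peMr ?mulr_ge0 ?(ltW e0)// exprn_ege1// lerDl ltW.
  rewrite ler_pdivlMr ?exprn_gt0 ?addr_gt0//.
  have : (1 + e') ^+ 2 <= 25 / 16.
    have -> : 25 / 16 = (5 / 4) ^+ 2 :> R by field.
    by rewrite lerXn2r ?nnegrE//; lra.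
  move=> h; apply: (@le_trans _ _ (5 * e * (25 / 16))); last lra.
  by rewrite ler_wpM2l// mulr_ge0// ltW.
apply: (@le_trans _ _ ((1 - zeta ^+ 2) * (rho * (1 + del)))).
  by rewrite ler_wpM2l// ltW.
rewrite mulrA -id mulrAC.
apply: ler_pM.
- apply: mulr_ge0; last by rewrite addr_ge0// ltW.
  by rewrite subr_ge0; case/andP: Q0 => Qa Qb; rewrite expr_le1// ltW.
- exact: ltW.
- by rewrite mulrC.
- exact: A1.
Qed.

Lemma leb2_thin_sector_ge :
  ((sector_width * (rho * del / 2))%:E <= leb thin_sector)%E.
Proof.
have r0 := rho0; have rd := rho_del; have rd0 := mulr_gt0 rho0 del0.
have -> : rho * del / 2 = (1 - rho * (1 + del / 2)) - (1 - rho * (1 + del)) by field.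
apply: leb2_sector_ge => //; [exact: sector_width_ge0| |lra|lra].
rewrite sector_width_sqr; have rs := rho_small; have := w1; have := w0.
have : del * (1 - zeta) ^+ 2 <= 1 / 4 * (1 - zeta) ^+ 2 by rewrite ler_wpM2r// ltW.
lra.
Qed.

End SectorInAnnulus.

(** * The kernel of the quadratic form *)

Section OffDiagonal.
Variable R : realType.
Local Notation leb := (@leb2 R).
Local Notation alpha := (@disc_area R).

(* [|sum_(j < T) (g x conj y)^j|^2], the modulus of the kernel of [quad] below *)
Definition kerH (g : R) (T : nat) (x y : R * R) : R :=
  cabs (cpoly (fun j => (g ^+ j)%:C * conjc (toC x) ^+ j) T (toC y)) ^+ 2.

Lemma kerH_ge0 g T x y : 0 <= kerH g T x y. Proof. exact: sqr_ge0. Qed.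

(** With [r = 2 / s] the minimum is at most [4 / (r + j + 1)], so its square is bounded by a
    telescoping term, and the total is at most [16 / r]. The bound is linear in the thickness [s]
    and uniform in [T], which is what yields the power [rho^-3]. *)
Lemma sum_min_sqr_le (s : R) (T : nat) : 0 < s ->
  \sum_(j < T) Num.min s (2 / j.+1%:R) ^+ 2 <= 8 * s.
Proof.
move=> s0; pose r : R := 2 / s; have r0 : 0 < r by rewrite divr_gt0.
have step (j : nat) : Num.min s (2 / j.+1%:R) ^+ 2 <=
    16 * ((r + j%:R)^-1 - (r + j.+1%:R)^-1).
  have j0 : 0 <= j%:R :> R by [].
  set n : R := j.+1%:R; have n0 : 0 < n by rewrite /n ltr0n.
  have nE : n = j%:R + 1 by rewrite /n natr1.
  have a0 : 0 < r + j%:R by lra.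
  have b0 : 0 < r + n by lra.
  have m0 : 0 <= Num.min s (2 / n) by rewrite le_min ltW//= divr_ge0// ltW.
  have h : Num.min s (2 / n) * (r + n) <= 4.
    rewrite mulrDr; have -> : 4 = 2 + 2 :> R by ring.
    apply: lerD.
      apply: (@le_trans _ _ (s * r)); first by rewrite ler_wpM2r ?(ltW r0)// ge_min lexx.
      by rewrite /r mulrCA divff ?gt_eqF// mulr1.
    apply: (@le_trans _ _ (2 / n * n)); last by rewrite mulfVK// gt_eqF.
    by rewrite ler_wpM2r ?(ltW n0)// ge_min lexx orbT.
  have h2 : (Num.min s (2 / n) * (r + n)) ^+ 2 <= 16.
    have -> : 16 = 4 ^+ 2 :> R by ring.
    by rewrite lerXn2r ?nnegrE ?mulr_ge0// ltW.
  have -> : (r + j%:R)^-1 - (r + n)^-1 = ((r + j%:R) * (r + n))^-1.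
    by rewrite nE; field; rewrite -nE !gt_eqF.
  rewrite ler_pdivlMr ?mulr_gt0//; apply: le_trans h2.
  rewrite exprMn ler_wpM2l ?sqr_ge0// [leRHS]expr2 ler_wpM2r ?(ltW b0)//; lra.
apply: (@le_trans _ _ (\sum_(j < T) 16 * ((r + j%:R)^-1 - (r + j.+1%:R)^-1))).
  by apply: ler_sum => j _.
rewrite -mulr_sumr -(big_mkord xpredT (fun j => (r + j%:R)^-1 - (r + j.+1%:R)^-1)).
have -> : \sum_(0 <= j < T) ((r + j%:R)^-1 - (r + j.+1%:R)^-1) =
    r^-1 - (r + T%:R)^-1.
  elim: T => [|T ih]; first by rewrite big_geq// addr0 subrr.
  by rewrite big_nat_recr//= ih; ring.
have rT : 0 <= (r + T%:R)^-1 by rewrite invr_ge0 addr_ge0// ltW.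
have -> : r^-1 = s / 2 by rewrite /r invf_div.
lra.
Qed.

Section Bound.
Variables (a b g s : R) (T : nat).
Hypotheses (a0 : 0 <= a) (ab : a <= b) (b0 : 0 < b) (b1 : b <= 1).
Hypotheses (gb : g * b = 1) (s0 : 0 < s) (bas : b - a <= s).

Let m (j : nat) : R := Num.min s (2 / j.+1%:R).
Let m0 j : 0 <= m j.
Proof. by rewrite le_min ltW//= divr_ge0. Qed.
Let g0 : 0 <= g.
Proof. by rewrite -(@pmulr_lge0 _ b)// gb. Qed.

(** Low powers are controlled by the thickness of the annulus, high powers by their integral over
    the whole disc. *)
Lemma integral_ann_pow_le (j : nat) :
  (\int[leb]_(p in ann a b) (nsq p ^+ j)%:E <= (b ^+ j * (alpha * m j))%:E)%E.
Proof.
have al0 := disc_area_ge0 R.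
rewrite /m; have [h|h] := leP s (2 / j.+1%:R).
  apply: (@le_trans _ _ (\int[leb]_(p in ann a b) (b ^+ j)%:E)%E).
    apply: le_integral_nonmeas => p; first by rewrite lee_fin exprn_ge0// ltW.
    move=> /andP[_ pb]; rewrite lee_fin lerXn2r ?nnegrE ?nsq_ge0//; exact: ltW.
  have -> : (\int[leb]_(p in ann a b) (b ^+ j)%:E = (b ^+ j)%:E * leb (ann a b))%E.
    by apply: integral_cst; exact: measurable_ann.
  rewrite leb2_ann ?a0// -EFinM lee_fin ler_wpM2l ?exprn_ge0 ?(ltW b0)//.
  by rewrite mulrC ler_wpM2l.
apply: (@le_trans _ _ (\int[leb]_(p in ann 0 b) (nsq p ^+ j)%:E)%E).
  apply: ge0_subset_integral; try exact: measurable_ann.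
  - apply: measurable_funTS; apply/measurable_EFinP.
    by apply: measurable_funX; exact: measurable_nsq.
  - by move=> p _; rewrite lee_fin exprn_ge0 ?nsq_ge0.
  - by move=> p /andP[_ pb]; rewrite /ann /= nsq_ge0.
apply: le_trans (integral_nsq_pow_le j (ltW b0)) _; rewrite lee_fin.
have -> : 2 * alpha * b ^+ j.+1 / j.+1%:R = b ^+ j * (alpha * (2 / j.+1%:R)) * b.
  by rewrite [b ^+ j.+1]exprSr; ring.
by rewrite ler_piMr// !mulr_ge0 ?exprn_ge0 ?invr_ge0 ?(ltW b0).
Qed.

Lemma integral_kerH_inner_le x :
  (\int[leb]_(y in ann a b) (kerH g T x y)%:E <=
   \sum_(j < T) (g ^+ j * (alpha * m j))%:E * (nsq x ^+ j)%:E)%E.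
Proof.
rewrite integral_parseval; apply: lee_sum => j _.
have al0 := disc_area_ge0 R.
rewrite cabsM cabs_real cabsX cabsJ ger0_norm ?exprn_ge0// exprMn.
have -> : (cabs (toC x) ^+ j) ^+ 2 = nsq x ^+ j by rewrite nsqE exprAC.
have -> : ((g ^+ j * (alpha * m j))%:E * (nsq x ^+ j)%:E =
    ((g ^+ j) ^+ 2 * nsq x ^+ j)%:E * (b ^+ j * (alpha * m j))%:E)%E.
  rewrite -!EFinM; congr EFin.
  have e : g ^+ j * b ^+ j = 1 by rewrite -exprMn gb expr1n.
  by rewrite -[g ^+ j in LHS]mulr1 -e; ring.
rewrite lee_wpmul2l ?integral_ann_pow_le// lee_fin mulr_ge0 ?sqr_ge0//.
by rewrite exprn_ge0 ?nsq_ge0.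
Qed.

(** Parseval in [y] leaves the diagonal terms, integration in [x] contributes the same moment again,
    and [g * b = 1] cancels all powers; only the squares of the minima survive. *)
Lemma integral_kerH_le :
  (\int[leb]_(x in ann a b) \int[leb]_(y in ann a b) (kerH g T x y)%:E <=
   (alpha ^+ 2 * (8 * s))%:E)%E.
Proof.
have al0 := disc_area_ge0 R.
have c0 j : 0 <= g ^+ j * (alpha * m j) by rewrite !mulr_ge0// exprn_ge0.
apply: (@le_trans _ _ (\int[leb]_(x in ann a b)
    \sum_(j < T) (g ^+ j * (alpha * m j))%:E * (nsq x ^+ j)%:E)%E).
  apply: le_integral_nonmeas => x _; last exact: integral_kerH_inner_le.
  by apply: sume_ge0 => j _; rewrite mule_ge0 ?lee_fin ?exprn_ge0 ?nsq_ge0.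
have mn j : measurable_fun (ann a b) (fun p : R * R => (nsq p ^+ j)%:E).
  apply: measurable_funTS; apply/measurable_EFinP.
  by apply: measurable_funX; exact: measurable_nsq.
have -> : (\int[leb]_(x in ann a b)
    (\sum_(j < T) (g ^+ j * (alpha * m j))%:E * (nsq x ^+ j)%:E) =
    \sum_(j < T) \int[leb]_(x in ann a b)
      ((g ^+ j * (alpha * m j))%:E * (nsq x ^+ j)%:E))%E.
  apply: (@ge0_integral_sum _ _ R leb _ (measurable_ann a b) _
    (fun (j : 'I_T) x => ((g ^+ j * (alpha * m j))%:E * (nsq x ^+ j)%:E)%E)).
    by move=> j; apply: measurable_funeM; exact: mn.
  by move=> j x _; rewrite mule_ge0 ?lee_fin ?exprn_ge0 ?nsq_ge0.
apply: (@le_trans _ _ (\sum_(j < T) (alpha ^+ 2 * m j ^+ 2)%:E)%E).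
  apply: lee_sum => j _; rewrite ge0_integralZl_EFin//; last 3 first.
  - exact: measurable_ann.
  - by move=> p _; rewrite lee_fin exprn_ge0 ?nsq_ge0.
  - exact: mn.
  apply: (@le_trans _ _ ((g ^+ j * (alpha * m j))%:E * (b ^+ j * (alpha * m j))%:E)%E).
    by rewrite lee_wpmul2l ?lee_fin// integral_ann_pow_le.
  rewrite -EFinM lee_fin.
  have e : g ^+ j * b ^+ j = 1 by rewrite -exprMn gb expr1n.
  have -> : g ^+ j * (alpha * m j) * (b ^+ j * (alpha * m j)) =
    (g ^+ j * b ^+ j) * (alpha ^+ 2 * m j ^+ 2) by ring.
  by rewrite e mul1r.
rewrite sumEFin lee_fin -mulr_sumr ler_wpM2l ?sqr_ge0//.
exact: sum_min_sqr_le.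
Qed.

End Bound.
End OffDiagonal.

(** * Continuity of the kernel *)

Section KernelContinuity.
Variable R : realType.

Definition ccontinuous (f : (R * R) * (R * R) -> R[i]) :=
  continuous (fun p => complex.Re (f p)) /\ continuous (fun p => complex.Im (f p)).

Lemma ccontinuous_cst c : ccontinuous (fun=> c).
Proof. by split=> p; exact: cvg_cst. Qed.

Lemma ccontinuousD f g : ccontinuous f -> ccontinuous g ->
  ccontinuous (fun p => f p + g p).
Proof.
move=> [f1 f2] [g1 g2]; split => p.
  by under eq_fun do rewrite ReD; apply: cvgD; [exact: f1|exact: g1].
by under eq_fun do rewrite ImD; apply: cvgD; [exact: f2|exact: g2].
Qed.

Lemma ccontinuousM f g : ccontinuous f -> ccontinuous g ->
  ccontinuous (fun p => f p * g p).
Proof.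
move=> [f1 f2] [g1 g2]; split => p.
  have -> : (fun x => complex.Re (f x * g x)) = (fun x => complex.Re (f x) *
      complex.Re (g x) - complex.Im (f x) * complex.Im (g x)).
    by apply/funext => x; case: (f x) => ? ?; case: (g x).
  by apply: cvgB; apply: cvgM; [exact: f1|exact: g1|exact: f2|exact: g2].
have -> : (fun x => complex.Im (f x * g x)) = (fun x => complex.Re (f x) *
    complex.Im (g x) + complex.Im (f x) * complex.Re (g x)).
  by apply/funext => x; case: (f x) => ? ?; case: (g x).
by apply: cvgD; apply: cvgM; [exact: f1|exact: g2|exact: f2|exact: g1].
Qed.

Lemma ccontinuousX f n : ccontinuous f -> ccontinuous (fun p => f p ^+ n).
Proof.
move=> cf; elim: n => [|n ih]; first exact: ccontinuous_cst.
by under eq_fun do rewrite exprS; exact: ccontinuousM.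
Qed.

Lemma ccontinuous_sum (I : Type) (r : seq I) (F : I -> (R * R) * (R * R) -> R[i]) :
  (forall i, ccontinuous (F i)) -> ccontinuous (fun p => \sum_(i <- r) F i p).
Proof.
move=> cF; elim: r => [|i r ih].
  by under eq_fun do rewrite big_nil; exact: ccontinuous_cst.
by under eq_fun do rewrite big_cons; exact: ccontinuousD.
Qed.

Lemma continuous_kerH g T :
  continuous (fun p : (R * R) * (R * R) => kerH g T p.1 p.2).
Proof.
have [c1 c2] : ccontinuous (fun p =>
    cpoly (fun j => (g ^+ j)%:C * conjc (toC p.1) ^+ j) T (toC p.2)).
  have q1 : ccontinuous (fun p => conjc (toC p.1)).
    split => p /=.
      by apply: continuous_comp; [exact: cvg_fst|exact: cvg_fst].
    apply: cvgN; by apply: continuous_comp; [exact: cvg_fst|exact: cvg_snd].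
  have q2 : ccontinuous (fun p => toC p.2).
    split => p /=.
      by apply: continuous_comp; [exact: cvg_snd|exact: cvg_fst].
    by apply: continuous_comp; [exact: cvg_snd|exact: cvg_snd].
  apply: ccontinuous_sum => j; apply: ccontinuousM; last exact: ccontinuousX.
  by apply: ccontinuousM; [exact: ccontinuous_cst|exact: ccontinuousX].
move=> p; rewrite /kerH; under eq_fun do rewrite cabs_sqr !expr2.
by apply: cvgD; apply: cvgM; [exact: c1|exact: c1|exact: c2|exact: c2].
Qed.

Lemma kerH_lsc (g : R) T (x y : R * R) (e : R) : 0 < e -> exists2 del, 0 < del &
  forall x' y', near_pt del x x' -> near_pt del y y' ->
    kerH g T x y - e <= kerH g T x' y'.
Proof.
move=> e0; have /cvgrPdist_le /(_ e e0) := @continuous_kerH g T (x, y).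
move=> /nbhs_ballP[del /= del0 h]; exists del => //.
move=> x' y' [a1 a2] [b1 b2].
have bxy : ball (x, y) del (x', y').
  by split; split; rewrite /ball /= distrC.
have hh : `|kerH g T x y - kerH g T x' y'| <= e := h (x', y') bxy.
by have := le_trans (ler_norm _) hh; rewrite lerBlDr addrC -lerBlDr.
Qed.

End KernelContinuity.

(** * The gliding hump *)

Section GlidingHump.
Variable R : realType.
Implicit Types (S : nat -> nat -> R[i]) (s : seq R[i]).

(* The squared Bergman norm of the power series with coefficients [a] is
   [dsum a], and that of the functional with moments [u] is [wsum u]. *)
Definition wsum (u : nat -> R[i]) (m n : nat) : R :=
  \sum_(m <= i < n) i.+1%:R * cabs (u i) ^+ 2.

Definition dsum (u : nat -> R[i]) (m n : nat) : R :=
  \sum_(m <= i < n) cabs (u i) ^+ 2 / i.+1%:R.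

Lemma wsum_ge0 u m n : 0 <= wsum u m n.
Proof. by apply: sumr_ge0 => i _; rewrite mulr_ge0 ?sqr_ge0. Qed.

Lemma dsum_ge0 u m n : 0 <= dsum u m n.
Proof. by apply: sumr_ge0 => i _; rewrite divr_ge0 ?sqr_ge0. Qed.

Lemma le_cabs_pairing (a u : nat -> R[i]) m n :
  cabs (\sum_(m <= i < n) a i * u i) <= (dsum a m n + wsum u m n) / 2.
Proof.
apply: le_trans (le_cabs_sum _ _ _) _.
rewrite /dsum /wsum -big_split /= mulr_suml; apply: ler_sum => i _.
rewrite cabsM; set x := cabs _; set y := cabs _.
have i0 : 0 < i.+1%:R :> R by rewrite ltr0n.
rewrite -(@ler_pM2r _ (2 * i.+1%:R)) ?mulr_gt0//.
have -> : (x ^+ 2 / i.+1%:R + i.+1%:R * y ^+ 2) / 2 * (2 * i.+1%:R) =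
    x ^+ 2 + (i.+1%:R * y) ^+ 2 by field; rewrite gt_eqF.
by have := sqr_ge0 (x - i.+1%:R * y); nra.
Qed.

(** The list is extended by coefficients proportional to [(n+1) conj (S k n)], the equality case of
    Cauchy-Schwarz, for a [k] whose norm is so large that a hump of squared norm [2^-j] outweighs
    the part already fixed. *)
Lemma hump_step S s (j : nat) :
  (forall k, exists N0, forall N, wsum (S k) N0 N <= 1) ->
  (forall n, exists B, forall k, cabs (S k n) <= B) ->
  (forall M : R, exists k N, M < wsum (S k) 0 N) ->
  exists t, [/\ (size s < size t)%N, take (size s) t = s,
    dsum (nth 0 t) (size s) (size t) <= 2^-1 ^+ j &
    exists k, j%:R <= cabs (\sum_(0 <= n < size t) t`_n * S k n) /\
      forall N, wsum (S k) (size t) N <= 1].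
Proof.
move=> tailS bdS unbS.
have [B hB] := choice bdS.
pose C1 := \sum_(0 <= n < size s) cabs s`_n * B n.
pose C2 := \sum_(0 <= n < size s) n.+1%:R * B n ^+ 2.
have B0 n : 0 <= B n by apply: le_trans (hB n 0%N); exact: cabs_ge0.
have C10 : 0 <= C1 by apply: sumr_ge0 => n _; rewrite mulr_ge0 ?cabs_ge0.
have hC1 k : cabs (\sum_(0 <= n < size s) s`_n * S k n) <= C1.
  apply: le_trans (le_cabs_sum _ _ _) _; apply: ler_sum => n _.
  by rewrite cabsM ler_wpM2l ?cabs_ge0.
have hC2 k : wsum (S k) 0 (size s) <= C2.
  apply: ler_sum => n _; rewrite ler_wpM2l// lerXn2r// nnegrE ?cabs_ge0//.
(* [C2] bounds the part of the norm below [size s]. The rest, [V], gives the hump the value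
   [sqrt (V / 2^j)], which must exceed [j] by the contribution [C1] of the old coefficients. *)
have [k [N kN]] := unbS (C2 + 2 ^+ j * (C1 + j%:R + 1) ^+ 2).
have [N1 hN1] := tailS k.
(* The three entries make the list grow, capture the large norm, and leave a tail of norm at most
   1. *)
pose N' := maxn (size s).+1 (maxn N N1).
have sN' : (size s < N')%N by rewrite leq_max leqnn.
have NN' : (N <= N')%N by rewrite /N' !leq_max leqnn orbT.
have N1N' : (N1 <= N')%N by rewrite /N' !leq_max leqnn !orbT.
pose V := wsum (S k) (size s) N'.
have hV : 2 ^+ j * (C1 + j%:R + 1) ^+ 2 < V.
  have : wsum (S k) 0 N <= wsum (S k) 0 N'.
    rewrite /wsum (big_cat_nat (leq0n _) NN')//= lerDl.
    exact: (wsum_ge0 (S k)).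
  rewrite {2}/wsum (big_cat_nat (leq0n _) (ltnW sN'))//= -/(wsum _ _ _) -/(wsum _ _ _) -/V.
  have := hC2 k; lra.
have j0 : 0 < 2 ^+ j :> R by rewrite exprn_gt0.
have V0 : 0 < V by apply: le_lt_trans hV; rewrite mulr_ge0 ?sqr_ge0// ltW.
pose be := (Num.sqrt (2 ^+ j * V))^-1.
have be0 : 0 < be by rewrite invr_gt0 sqrtr_gt0 mulr_gt0.
have be2 : be ^+ 2 * (2 ^+ j * V) = 1.
  by rewrite exprVn sqr_sqrtr ?mulVf// ?gt_eqF ?mulr_gt0// ltW// mulr_gt0.
pose b n : R[i] := (be * n.+1%:R)%:C * conjc (S k n).
pose t := s ++ [seq b n | n <- index_iota (size s) N'].
have st : size t = N' by rewrite size_cat size_map size_iota subnKC// ltnW.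
have tl n : (n < size s)%N -> t`_n = s`_n by move=> ns; rewrite nth_cat ns.
have tr n : (size s <= n < N')%N -> t`_n = b n.
  move=> /andP[sn nN]; rewrite nth_cat ltnNge sn /= (nth_map 0%N).
    by rewrite nth_iota ?subnKC// ltn_sub2r// (leq_ltn_trans sn).
  by rewrite size_iota ltn_sub2r// (leq_ltn_trans sn).
have cb n : cabs (b n) = be * n.+1%:R * cabs (S k n).
  by rewrite cabsM cabs_real cabsJ ger0_norm// mulr_ge0// ltW.
exists t; split.
- by rewrite st.
- by rewrite /t take_size_cat.
- rewrite st /dsum (eq_big_nat _ _ (F2 := fun n => be ^+ 2 * (n.+1%:R * cabs (S k n) ^+ 2))).
    rewrite -mulr_sumr -/(wsum (S k) (size s) N') -/V [leRHS]exprVn.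
    by rewrite -(@ler_pM2l _ (2 ^+ j))// mulrCA be2 divff// gt_eqF.
  move=> n nN; rewrite tr// cb; field; rewrite gt_eqF//.
- exists k; split; last first.
    move=> M; rewrite st; have [N'M|MN'] := leqP N' M; last first.
      by rewrite /wsum big_geq// ltnW.
    apply: le_trans (hN1 M); rewrite {2}/wsum (big_cat_nat N1N' N'M)//= lerDr.
    exact: (wsum_ge0 (S k)).
  rewrite st (big_cat_nat (leq0n _) (ltnW sN'))//=.
  rewrite (eq_big_nat _ _ (F2 := fun n => s`_n * S k n)); last first.
    by move=> n /andP[_ ns]; rewrite tl.
  rewrite [X in _ + X](eq_big_nat _ _ (F2 := fun n =>
    (be * (n.+1%:R * cabs (S k n) ^+ 2))%:C)); last first.
    move=> n nN; rewrite tr// /b -mulrA (mulrC (conjc _)) -cabs_sqrC.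
    by rewrite [in RHS]mulrA [RHS]rmorphM.
  rewrite -rmorph_sum -mulr_sumr -/(wsum (S k) (size s) N') -/V addrC.
  rewrite -[X in _ + X]opprK.
  apply: le_trans (le_cabsB _ _); rewrite cabsN cabs_real ger0_norm; last first.
    by rewrite mulr_ge0// ltW.
  have := hC1 k; suff : C1 + j%:R + 1 <= be * V by lra.
  rewrite -(@ler_pXn2r _ 2)// ?nnegrE ?addr_ge0 ?mulr_ge0 ?(ltW be0) ?(ltW V0)//.
  rewrite -(@ler_pM2l _ (2 ^+ j))//; apply: le_trans (ltW hV) _.
  have -> : 2 ^+ j * (be * V) ^+ 2 = (be ^+ 2 * (2 ^+ j * V)) * V by ring.
  by rewrite be2 mul1r.
Qed.

Lemma gliding_hump S :
  (forall k, exists N0, forall N, wsum (S k) N0 N <= 1) ->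
  (forall n, exists B, forall k, cabs (S k n) <= B) ->
  (forall M : R, exists k N, M < wsum (S k) 0 N) ->
  exists a : nat -> R[i], (forall N, dsum a 0 N <= 2) /\
    forall M : R, exists k N0, forall N, (N0 <= N)%N ->
      M <= cabs (\sum_(0 <= n < N) a n * S k n).
Proof.
move=> tailS bdS unbS.
have ex (sj : seq R[i] * nat) := hump_step sj.1 sj.2 tailS bdS unbS.
have [F hF] := choice ex.
pose fix st (j : nat) : seq R[i] := if j is j'.+1 then F (st j', j') else [::].
have hst j : [/\ (size (st j) < size (st j.+1))%N,
    take (size (st j)) (st j.+1) = st j,
    dsum (nth 0 (st j.+1)) (size (st j)) (size (st j.+1)) <= 2^-1 ^+ j &
    exists k, j%:R <= cabs (\sum_(0 <= n < size (st j.+1)) (st j.+1)`_n * S k n) /\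
      forall N, wsum (S k) (size (st j.+1)) N <= 1].
  exact: (hF (st j, j)).
have szj j : (j <= size (st j))%N.
  by elim: j => [//|j ih]; have [h _ _ _] := hst j; exact: leq_ltn_trans h.
have mono i j : (i <= j)%N -> (size (st i) <= size (st j))%N /\
    forall n, (n < size (st i))%N -> (st j)`_n = (st i)`_n.
  elim: j => [|j ih]; first by rewrite leqn0 => /eqP ->.
  rewrite leq_eqVlt => /predU1P[<-//|]; rewrite ltnS => /ih[h1 h2].
  have [h3 h4 _ _] := hst j; split; first exact: leq_trans h1 (ltnW h3).
  move=> n ni; rewrite -h2// -h4 nth_take//; exact: leq_trans ni h1.
(* The list of stage [n.+1] has more than [n] entries and is only extended afterwards, so this
   coefficient is final. *)
pose a n := (st n.+1)`_n.
have aE j n : (n < size (st j))%N -> a n = (st j)`_n.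
  move=> nj; rewrite /a; have [nj'|jn] := leqP n.+1 j.
    by have [_ ->] := mono _ _ nj'; rewrite // (leq_ltn_trans _ (szj n.+1)).
  by have [_ ->] := mono _ _ (ltnW jn).
have da j : dsum a 0 (size (st j)) <= 2 - 2 * 2^-1 ^+ j.
  elim: j => [|j ih]; first by rewrite /dsum big_geq// expr0 mulr1 subrr.
  have [h1 _ h3 _] := hst j.
  rewrite /dsum (big_cat_nat (leq0n _) (ltnW h1))//= -/(dsum a 0 _).
  have -> : \sum_(size (st j) <= i < size (st j.+1)) cabs (a i) ^+ 2 / i.+1%:R =
      dsum (nth 0 (st j.+1)) (size (st j)) (size (st j.+1)).
    by apply: eq_big_nat => n /andP[_ nj]; rewrite (aE j.+1).
  rewrite exprS; have := lerD ih h3; lra.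
have da2 N : dsum a 0 N <= 2.
  apply: (@le_trans _ _ (dsum a 0 (size (st N)))).
    rewrite {2}/dsum (big_cat_nat (leq0n _) (szj N))//= lerDl.
    exact: (dsum_ge0 a).
  apply: le_trans (da N) _; rewrite gerBl mulr_ge0// exprn_ge0//.
exists a; split => // M.
(* By [le_cabs_pairing] the coefficients after stage [j.+1] change the pairing by at most
   [(2 + 1) / 2], which the shift by 2 absorbs. *)
pose j := (Num.bound M).+2.
have [_ _ _ [k [hk1 hk2]]] := hst j.
exists k, (size (st j.+1)) => N jN.
rewrite (big_cat_nat (leq0n _) jN)//=.
rewrite (eq_big_nat _ _ (F2 := fun n => (st j.+1)`_n * S k n)); last first.
  by move=> n /andP[_ nj]; rewrite (aE j.+1).
rewrite -[X in _ + X]opprK; apply: le_trans (le_cabsB _ _); rewrite cabsN.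
have := le_cabs_pairing a (S k) (size (st j.+1)) N.
have : dsum a (size (st j.+1)) N <= 2.
  apply: le_trans (da2 N); rewrite {2}/dsum (big_cat_nat (leq0n _) jN)//= lerDr.
  exact: (dsum_ge0 a).
have := hk2 N.
have : M <= j%:R - 2.
  rewrite /j -addn2 natrD addrK; apply: le_trans (ler_norm _) _.
  by apply: ltW; have := archi_boundP (normr_ge0 M); rewrite /Num.bound normr_id.
move: hk1; lra.
Qed.

End GlidingHump.

(** * The quadratic form of the moments *)

Section QuadraticForm.
Variable R : realType.

Definition moment (xs : seq (R * R)) (c : R * R -> R) (n : nat) : R[i] :=
  \sum_(x <- xs) (c x)%:C * toC x ^+ n.

Lemma moment_sqr xs c n : (cabs (moment xs c n) ^+ 2)%:C =
  \sum_(x <- xs) \sum_(y <- xs)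
    (c x * c y)%:C * (toC x * conjc (toC y)) ^+ n.
Proof.
have e y : conjc ((c y)%:C * toC y ^+ n) = (c y)%:C * conjc (toC y) ^+ n.
  by rewrite rmorphM rmorphXn; congr (_ * _); exact: conjc_real.
rewrite cabs_sqrC /moment [conjc _]rmorph_sum big_distrlr.
apply: eq_bigr => x _; apply: eq_bigr => y _.
transitivity ((c x)%:C * toC x ^+ n * ((c y)%:C * conjc (toC y) ^+ n)).
  by congr (_ * _); exact: e.
by rewrite mulrACA -exprMn [(c x * c y)%:C]rmorphM.
Qed.

Definition quad (S : nat -> R[i]) (g : R) (T : nat) : R :=
  \sum_(i < T) \sum_(j < T) g ^+ (i + j) * cabs (S (i + j)%N) ^+ 2.

Definition gpoly (g : R) (T : nat) (v : R[i]) : R[i] :=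
  \sum_(i < T) (g%:C * v) ^+ i.

Lemma kerHE g T x y :
  kerH g T x y = cabs (gpoly g T (toC x * conjc (toC y))) ^+ 2.
Proof.
rewrite /kerH -[in RHS]cabsJ /gpoly rmorph_sum /cpoly; congr (cabs _ ^+ 2).
apply: eq_bigr => j _.
have e : conjc (g%:C * (toC x * conjc (toC y))) = g%:C * (conjc (toC x) * toC y).
  by apply/eqP; rewrite eq_complex /=; apply/andP; split; apply/eqP; ring.
transitivity ((g%:C * (conjc (toC x) * toC y)) ^+ j).
  by rewrite !exprMn [(g ^+ j)%:C]rmorphXn mulrA.
by rewrite -e; symmetry; exact: rmorphXn.
Qed.

Lemma quad_momentE xs c g T : quad (moment xs c) g T =
  \sum_(x <- xs) \sum_(y <- xs)
    c x * c y * complex.Re (gpoly g T (toC x * conjc (toC y)) ^+ 2).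
Proof.
have eC : (quad (moment xs c) g T)%:C = \sum_(x <- xs) \sum_(y <- xs)
    (c x * c y)%:C * gpoly g T (toC x * conjc (toC y)) ^+ 2.
  rewrite /quad rmorph_sum /=.
  under eq_bigr => i _ do
    (rewrite rmorph_sum /=; under eq_bigr => j _ do
      (rewrite rmorphM /= moment_sqr mulr_sumr;
       under eq_bigr => x _ do rewrite mulr_sumr)).
  under eq_bigr => i _ do rewrite exchange_big /=.
  rewrite exchange_big /=; apply: eq_bigr => x _.
  under eq_bigr => i _ do rewrite exchange_big /=.
  rewrite exchange_big /=; apply: eq_bigr => y _.
  rewrite expr2 /gpoly big_distrlr /= mulr_sumr; apply: eq_bigr => i _.
  rewrite mulr_sumr; apply: eq_bigr => j _.
  by rewrite -exprD [(g%:C * _) ^+ _]exprMn rmorphXn mulrCA.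
rewrite -[LHS]/(complex.Re (quad (moment xs c) g T)%:C) eC Re_sum.
apply: eq_bigr => x _; rewrite Re_sum; apply: eq_bigr => y _.
by case: (gpoly _ _ _ ^+ 2) => u v /=; rewrite mul0r subr0.
Qed.

(** On the diagonal the polynomial has a nonnegative real argument, so its square is kept exactly;
    elsewhere the real part of [F^2] is bounded below by [- |F|^2]. *)
Lemma quad_ge xs c g T : uniq xs -> 0 <= g -> (forall x, 0 <= c x) ->
  \sum_(x <- xs) c x ^+ 2 * (\sum_(i < T) (g * nsq x) ^+ i) ^+ 2 -
    \sum_(x <- xs) \sum_(y <- xs | y != x) c x * c y * kerH g T x y <=
  quad (moment xs c) g T.
Proof.
move=> uxs g0 c0; rewrite quad_momentE -sumrB big_seq [leRHS]big_seq.
apply: ler_sum => x xs_x; rewrite (bigD1_seq x)//=.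
rewrite -sumrN; apply: lerD; last first.
  apply: ler_sum => y _; rewrite -mulrN ler_wpM2l ?mulr_ge0// kerHE lerNl.
  by apply: le_trans (ler_norm _) _; rewrite normrN -cabsX; exact: Re_le_cabs.
rewrite -expr2 ler_wpM2l ?sqr_ge0//.
have -> : gpoly g T (toC x * conjc (toC x)) = (\sum_(i < T) (g * nsq x) ^+ i)%:C.
  rewrite /gpoly rmorph_sum /=; apply: eq_bigr => i _.
  by rewrite -cabs_sqrC -nsqE rmorphXn rmorphM.
by rewrite -rmorphXn.
Qed.

(** An index [n] equals [i + j] for at most [n + 1] values of [i], and [n + 1] is the Bergman
    weight. *)
Lemma sum_diag_le (phi : nat -> R) (T : nat) : (forall n, 0 <= phi n) ->
  \sum_(i < T) \sum_(j < T) phi (i + j)%N <= \sum_(0 <= n < 2 * T) n.+1%:R * phi n.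
Proof.
move=> phi0.
have h (i : 'I_T) : \sum_(j < T) phi (i + j)%N <=
    \sum_(0 <= n < 2 * T) (i <= n)%N%:R * phi n.
  have iT : (i <= 2 * T)%N by have := ltn_ord i; lia.
  have iT2 : (i <= i + T <= 2 * T)%N by have := ltn_ord i; lia.
  rewrite (big_cat_nat (leq0n _) iT)/=.
  apply: (@le_trans _ _ (\sum_(i <= n < 2 * T) (i <= n)%N%:R * phi n)); last first.
    by rewrite lerDr; apply: sumr_ge0 => n _; rewrite mulr_ge0.
  have /andP[ia ib] := iT2; rewrite (big_cat_nat ia ib)/=.
  apply: (@le_trans _ _ (\sum_(i <= n < i + T) (i <= n)%N%:R * phi n)); last first.
    by rewrite lerDl; apply: sumr_ge0 => n _; rewrite mulr_ge0.
  rewrite -{2}[nat_of_ord i]add0n big_addn addKn big_mkord; apply: ler_sum => j _.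
  by rewrite leq_addl mul1r addnC.
apply: (@le_trans _ _ (\sum_(i < T) \sum_(0 <= n < 2 * T) (i <= n)%N%:R * phi n)).
  by apply: ler_sum => i _; exact: h.
rewrite exchange_big /=; apply: ler_sum => n _.
rewrite -mulr_suml ler_wpM2r// -natr_sum ler_nat.
rewrite -(big_mkord xpredT (fun i => (i <= n)%N : nat)).
have -> : n.+1 = (\sum_(0 <= i < n.+1) 1)%N by rewrite sum_nat_const_nat subn0 muln1.
have [Tn|nT] := leqP T n.+1.
  rewrite [leqRHS](big_cat_nat (leq0n _) Tn)/=.
  by apply: leq_trans (leq_addr _ _); apply: leq_sum => i _; exact: leq_b1.
rewrite (big_cat_nat (leq0n _) (ltnW nT))/=.
have -> : (\sum_(n.+1 <= i < T) (i <= n) = 0)%N.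
  by rewrite big_nat big1// => i /andP[ni _]; rewrite leqNgt ni.
by rewrite addn0; apply: leq_sum => i _; exact: leq_b1.
Qed.

Lemma quad_le_wsum S g T : 1 <= g ->
  quad S g T <= g ^+ (2 * T) * wsum S 0 (2 * T).
Proof.
move=> g1; have g0 : 0 <= g by lra.
apply: le_trans (@sum_diag_le (fun n => g ^+ n * cabs (S n) ^+ 2) T _) _.
  by move=> n; apply: mulr_ge0; [exact: exprn_ge0|exact: sqr_ge0].
rewrite /wsum mulr_sumr big_nat [leRHS]big_nat; apply: ler_sum => n /andP[_ nT].
rewrite mulrCA; apply: ler_wpM2r; first by rewrite mulr_ge0 ?sqr_ge0.
by rewrite ler_weXn2l// ltnW.
Qed.

End QuadraticForm.

(** * Power series in the Bergman space *)

Section PowerSeries.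
Variable R : realType.
Local Notation leb := (@leb2 R).
Local Notation alpha := (@disc_area R).

Lemma real_series_lim (u : nat -> R) (C q : R) : 0 <= q < 1 ->
  (forall n, `|u n| <= C * q ^+ n) ->
  exists l, forall N, `|\sum_(n < N) u n - l| <= C * q ^+ N / (1 - q).
Proof.
move=> /andP[q0 q1] hu.
have tail N M : (N <= M)%N ->
    `|\sum_(n < M) u n - \sum_(n < N) u n| <= C * q ^+ N / (1 - q).
  move=> NM; have C0 : 0 <= C.
    by have := hu 0%N; rewrite expr0 mulr1; apply: le_trans.
  rewrite -(subnKC NM) big_split_ord /= addrAC subrr add0r.
  apply: le_trans (ler_norm_sum _ _ _) _.
  apply: (@le_trans _ _ (\sum_(i < M - N) C * q ^+ N * q ^+ i)).
    by apply: ler_sum => i _; rewrite -mulrA -exprD.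
  rewrite -mulr_sumr ler_wpM2l ?mulr_ge0 ?exprn_ge0//.
  rewrite -div1r ler_pdivlMr ?subr_gt0// mulrC -opprB mulNr -subrX1 opprB.
  by rewrite gerBl exprn_ge0.
have cvu : cvgn (fun N => \sum_(n < N) u n).
  have -> : (fun N => \sum_(n < N) u n) = series u.
    by apply/funext => N; rewrite /series /= big_mkord.
  apply: normed_cvg; apply: (@series_le_cvg _ _ (geometric C q)).
  - by move=> n; exact: normr_ge0.
  - by move=> n; rewrite /geometric /=; apply: le_trans (hu n).
  - exact: hu.
  - by apply: is_cvg_geometric_series; rewrite ger0_norm.
exists (limn (fun N => \sum_(n < N) u n)) => N.
rewrite distrC; have cN : (fun M => `|\sum_(n < M) u n - \sum_(n < N) u n|) @ \oo -->
    `|limn (fun N => \sum_(n < N) u n) - \sum_(n < N) u n|.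
  by apply: cvg_norm; apply: cvgB => //; exact: cvg_cst.
rewrite -(cvg_lim (@Rhausdorff R) cN); apply: limr_le; first by apply/cvg_ex; eexists; exact: cN.
near=> M; apply: tail.
by near: M; exact: nbhs_infty_ge.
Unshelve. all: by end_near. Qed.

Lemma complex_series_lim (u : nat -> R[i]) (C q : R) : 0 <= q < 1 ->
  (forall n, cabs (u n) <= C * q ^+ n) ->
  exists l, forall N, cabs (\sum_(n < N) u n - l) <= 2 * C / (1 - q) * q ^+ N.
Proof.
move=> q01 hu.
have [a ha] := real_series_lim q01 (fun n => le_trans (Re_le_cabs (u n)) (hu n)).
have [b hb] := real_series_lim q01 (fun n => le_trans (Im_le_cabs (u n)) (hu n)).
exists (a +i* b) => N; apply: le_trans (cabs_le_ReIm _) _.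
rewrite !ReD !ImD /= Re_sum Im_sum; have := lerD (ha N) (hb N).
suff -> : C * q ^+ N / (1 - q) + C * q ^+ N / (1 - q) =
  2 * C / (1 - q) * q ^+ N by [].
by ring.
Qed.

Lemma poly_geometric_bound (r : R) : 0 <= r < 1 ->
  exists C q, [/\ 0 <= C, 0 <= q < 1 &
    forall n : nat, n.+1%:R ^+ 4 * r ^+ n <= C * q ^+ n].
Proof.
move=> /andP[r0 r1]; pose q : R := (1 + r) / 2.
have q01 : 0 < q < 1 by rewrite /q; apply/andP; split; lra.
have /andP[q0 q1] := q01.
pose y : R := r / q.
have y01 : 0 <= y < 1.
  by rewrite divr_ge0 ?(ltW q0)//= ltr_pdivrMr// mul1r /q; lra.
pose e : R := (1 - y) / 4.
have e0 : 0 < e by rewrite divr_gt0// subr_gt0; case/andP: y01.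
(* [y = 1 - 4 e <= exp (- 4 e)] and [e (n+1) <= exp (e (n+1))], so
   [(n+1)^4 y^n] is bounded. *)
have be n : e * n.+1%:R <= expR (e * n.+1%:R).
  by apply: le_trans (expR_ge1Dx _); rewrite lerDr.
have y4 n : n.+1%:R ^+ 4 * y ^+ n <= e ^- 4 * expR (4 * e).
  rewrite -(@ler_pM2l _ (e ^+ 4)) ?exprn_gt0// mulrA -exprMn.
  rewrite [leRHS]mulrA divff ?expf_neq0 ?gt_eqF// mul1r.
  apply: (@le_trans _ _ (expR (e * n.+1%:R) ^+ 4 * expR (- (4 * e)) ^+ n)).
    have /andP[y0 _] := y01; apply: ler_pM.
    - by rewrite exprn_ge0// mulr_ge0// ltW.
    - exact: exprn_ge0.
    - by rewrite lerXn2r// nnegrE ?expR_ge0// mulr_ge0// ltW.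
    - rewrite lerXn2r ?nnegrE ?expR_ge0//.
      by apply: le_trans (expR_ge1Dx _); rewrite /e; lra.
  rewrite -!expRM_natl -expRD ler_expR -natr1 le_eqVlt.
  by apply/orP; left; apply/eqP; ring.
exists (e ^- 4 * expR (4 * e)), q; split.
- by rewrite mulr_ge0 ?expR_ge0// invr_ge0 exprn_ge0// ltW.
- by rewrite (ltW q0).
- move=> n; have -> : r = y * q by rewrite /y mulfVK// gt_eqF.
  by rewrite exprMn mulrA ler_wpM2r// exprn_ge0// ltW.
Qed.

Section Series.
Context (a : nat -> R[i]) (M : R).
Hypothesis aM : forall N, dsum a 0 N <= M.

Lemma coef_le n : cabs (a n) <= (M + 1) * n.+1%:R.
Proof.
have M0 : 0 <= M by have := aM 0; rewrite /dsum big_geq.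
have n1 : 1 <= n.+1%:R :> R by rewrite ler1n.
have : cabs (a n) ^+ 2 / n.+1%:R <= M.
  apply: le_trans (aM n.+1); rewrite /dsum big_nat_recr//= lerDr.
  exact: (dsum_ge0 a).
rewrite ler_pdivrMr ?ltr0n// => h.
rewrite -(@ler_pXn2r _ 2)// ?nnegrE ?cabs_ge0 ?mulr_ge0 ?addr_ge0//.
apply: le_trans h _; rewrite exprMn.
set t := n.+1%:R in n1 *; have t0 : 0 <= t by lra.
have : M * t <= M * t ^+ 2 by rewrite ler_wpM2l// expr2 ler_peMl.
have : 0 <= (M ^+ 2 + M + 1) * t ^+ 2 by rewrite mulr_ge0 ?sqr_ge0// !addr_ge0// sqr_ge0.
nra.
Qed.

Lemma power_series_ex (x : R[i]) : cabs x < 1 -> exists l : R[i],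
  exists C q, 0 <= q < 1 /\ forall N, cabs (cpoly a N x - l) <= C * q ^+ N.
Proof.
move=> x1; have x01 : 0 <= cabs x < 1 by rewrite cabs_ge0.
have M0 : 0 <= M by have := aM 0; rewrite /dsum big_geq.
have [C [q [C0 q01 h]]] := poly_geometric_bound x01.
have [n|l hl] := @complex_series_lim (fun n => a n * x ^+ n) ((M + 1) * C) q q01.
  rewrite cabsM cabsX; apply: (@le_trans _ _ ((M + 1) * n.+1%:R * cabs x ^+ n)).
    by rewrite ler_wpM2r ?exprn_ge0 ?cabs_ge0 ?coef_le.
  rewrite -!mulrA ler_wpM2l ?addr_ge0//; apply: le_trans (h n).
  rewrite ler_wpM2r ?exprn_ge0 ?cabs_ge0// -[leLHS]expr1 ler_weXn2l ?ler1n//.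
by exists l, (2 * ((M + 1) * C) / (1 - q)), q.
Qed.

Definition bseries (p : R * R) : R[i] :=
  match pselect (cabs (toC p) < 1) with
  | left h => projT1 (cid (power_series_ex h))
  | right _ => 0
  end.

Lemma bseriesP p : cabs (toC p) < 1 -> exists C q, 0 <= q < 1 /\
  forall N, cabs (cpoly a N (toC p) - bseries p) <= C * q ^+ N.
Proof.
by move=> h; rewrite /bseries; case: pselect => // h'; case: cid.
Qed.

End Series.
End PowerSeries.

(** * Power series belong to the Bergman space *)

Section BergmanSeries.
Variable R : realType.
Local Notation leb := (@leb2 R).
Local Notation alpha := (@disc_area R).

Lemma diskDE : @diskD R = ann 0 1.
Proof.
by apply/seteqP; split => p; rewrite /diskD /ann /= -nsq_lt1 nsq_ge0.
Qed.

(** Series are handled through geometric truncation errors; this removes the error at the end of an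
    estimate. *)
Lemma le_of_geometric (x y C q : R) : 0 <= q < 1 ->
  (forall N, x <= y + C * q ^+ N) -> x <= y.
Proof.
move=> /andP[q0 q1] h.
have cN : (fun N => y + C * q ^+ N) @ \oo --> y + C * 0.
  apply: cvgD; first exact: cvg_cst.
  by apply: cvgMr; apply: cvg_expr; rewrite ger0_norm.
rewrite mulr0 addr0 in cN.
rewrite -(cvg_lim (@Rhausdorff R) cN); apply: limr_ge.
  by apply/cvg_ex; eexists; exact: cN.
exact: nearW.
Qed.

(** The second order Taylor remainder of a power. The factor [r ^+ 2] on the left stands for an
    exponent [n - 2] on the right, which would be truncated for small [n]. *)
Lemma pow_taylor2 (z w : R[i]) (r : R) n : cabs z <= r -> cabs w <= r ->
  cabs (w ^+ n - z ^+ n - n%:R * z ^+ n.-1 * (w - z)) * r ^+ 2 <=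
  n%:R ^+ 2 * r ^+ n * cabs (w - z) ^+ 2.
Proof.
move=> zr wr; have r0 : 0 <= r by apply: le_trans zr; exact: cabs_ge0.
elim: n => [|n ih].
  by rewrite !expr0 subrr !mul0r subrr cabs0 expr0n /= !mul0r.
have -> : w ^+ n.+1 - z ^+ n.+1 - n.+1%:R * z ^+ n * (w - z) =
    w * (w ^+ n - z ^+ n - n%:R * z ^+ n.-1 * (w - z)) +
    n%:R * z ^+ n.-1 * (w - z) ^+ 2.
  case: n {ih} => [|n]; first by rewrite !expr0 !expr1; ring.
  by rewrite -natr1 !exprS /=; ring.
apply: (@le_trans _ _ ((r * cabs (w ^+ n - z ^+ n - n%:R * z ^+ n.-1 * (w - z)) +
    n%:R * r ^+ n.-1 * cabs (w - z) ^+ 2) * r ^+ 2)).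
  rewrite ler_wpM2r ?sqr_ge0//; apply: le_trans (le_cabsD _ _) _.
  rewrite !cabsM !cabsX lerD//; first by rewrite ler_wpM2r ?cabs_ge0.
  rewrite ler_wpM2r ?sqr_ge0//.
  have -> : cabs (n%:R : R[i]) = n%:R by rewrite -(rmorph_nat (real_complex R)) cabs_real ger0_norm.
  by rewrite ler_wpM2l// lerXn2r// nnegrE cabs_ge0.
rewrite mulrDl -mulrA.
apply: (@le_trans _ _ (r * (n%:R ^+ 2 * r ^+ n * cabs (w - z) ^+ 2) +
    n%:R * r ^+ n.+1 * cabs (w - z) ^+ 2)).
  rewrite lerD ?ler_wpM2l//.
  case: n {ih} => [|n]; first by rewrite !mul0r.
  by rewrite le_eqVlt; apply/orP; left; apply/eqP; rewrite /= !exprS; ring.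
have -> : r * (n%:R ^+ 2 * r ^+ n * cabs (w - z) ^+ 2) +
    n%:R * r ^+ n.+1 * cabs (w - z) ^+ 2 =
    (n%:R ^+ 2 + n%:R) * (r ^+ n.+1 * cabs (w - z) ^+ 2) by rewrite [r ^+ n.+1]exprS; ring.
rewrite -[leRHS]mulrA; apply: ler_wpM2r.
  by rewrite mulr_ge0 ?sqr_ge0 ?exprn_ge0.
by rewrite -natr1 sqrrD mulr1 expr1n; have : 0 <= n%:R :> R by []; lra.
Qed.

Section Series.
Context (a : nat -> R[i]) (M : R).
Hypothesis aM : forall N, dsum a 0 N <= M.

Let M0 : 0 <= M.
Proof. by have := aM 0; rewrite /dsum big_geq. Qed.

Lemma bseries_holomorphic : holomorphic_on (@diskD R) (bseries aM).
Proof.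
move=> z z1; have {}z1 : cabs (toC z) < 1 by [].
pose r := (1 + cabs (toC z)) / 2.
have zr : cabs (toC z) < r by rewrite /r; lra.
have r0 : 0 < r by apply: le_lt_trans zr; exact: cabs_ge0.
have r1 : r < 1 by rewrite /r; lra.
have r01 : 0 <= r < 1 by rewrite (ltW r0).
have [C [q [C0 q01 hC]]] := poly_geometric_bound r01.
have [/andP[q0 q1]] := q01.
pose dcoef n : R[i] := a n * (n%:R * toC z ^+ n.-1).
have n4 n : n%:R <= n.+1%:R ^+ 2 :> R.
  by rewrite -natr1; have : 0 <= n%:R :> R by []; nra.
have cn (n : nat) : cabs (n%:R : R[i]) = n%:R.
  by rewrite -(rmorph_nat (real_complex R)) cabs_real ger0_norm.
have [n|g hg] := @complex_series_lim R dcoef ((M + 1) * C / r) q q01.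
  case: n => [|n].
    by rewrite /dcoef mul0r mulr0 cabs0 !mulr_ge0 ?addr_ge0 ?invr_ge0 ?(ltW r0)// exprn_ge0.
  rewrite /dcoef !cabsM cabsX cn -(@ler_pM2r _ r)//.
  rewrite [leRHS]mulrAC mulfVK ?gt_eqF// -!mulrA.
  apply: (@le_trans _ _ ((M + 1) * n.+2%:R * (n.+2%:R ^+ 2 * (r ^+ n * r)))).
    have zn : 0 <= cabs (toC z) ^+ n * r by rewrite mulr_ge0 ?exprn_ge0 ?cabs_ge0 ?ltW.
    have a1 : cabs (a n.+1) <= (M + 1) * n.+2%:R by exact: (coef_le aM).
    apply: ler_pM => //; [exact: cabs_ge0|exact: mulr_ge0|].
    apply: ler_pM => //; apply: ler_wpM2r; first exact: ltW.
    by rewrite lerXn2r ?nnegrE ?cabs_ge0 ?(ltW r0)// ltW.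
  rewrite -!mulrA ler_wpM2l ?addr_ge0//; apply: le_trans (hC n.+1).
  have -> : n.+2%:R * (n.+2%:R * (n.+2%:R * (r ^+ n * r))) = n.+2%:R ^+ 3 * r ^+ n.+1.
    by rewrite [r ^+ n.+1]exprSr; ring.
  by rewrite ler_wpM2r ?exprn_ge0 ?(ltW r0)// ler_weXn2l// ler1n.
exists g => e e0.
pose K := (M + 1) * C / (1 - q) / r ^+ 2.
have K0 : 0 <= K by rewrite !mulr_ge0 ?addr_ge0 ?invr_ge0 ?subr_ge0 ?exprn_ge0 ?(ltW q1) ?(ltW r0).
(* The quadratic remainder is proved for the partial sums with a constant independent of [N], then
   carried over to the limit. *)
have main w : cabs (toC w) <= r ->
    cabs (bseries aM w - bseries aM z - g * (toC w - toC z)) <=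
    K * cabs (toC w - toC z) ^+ 2.
  move=> wr; have w1 : cabs (toC w) < 1 by exact: le_lt_trans r1.
  have [Cw [qw [qw01 hw]]] := bseriesP aM w1.
  have [Cz [qz [qz01 hz]]] := bseriesP aM z1.
  set G := 2 * _ / _ in hg.
  set h := toC w - toC z.
  have taylor N : cabs (cpoly a N (toC w) - cpoly a N (toC z) -
      (\sum_(n < N) dcoef n) * h) <= K * cabs h ^+ 2.
    have -> : cpoly a N (toC w) - cpoly a N (toC z) - (\sum_(n < N) dcoef n) * h =
        \sum_(n < N) a n * (toC w ^+ n - toC z ^+ n - n%:R * toC z ^+ n.-1 * h).
      rewrite /cpoly mulr_suml -!sumrB; apply: eq_bigr => n _.
      by rewrite /dcoef; ring.
    apply: le_trans (le_cabs_sum _ _ _) _.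
    apply: (@le_trans _ _ (\sum_(n < N) (M + 1) * C / r ^+ 2 * cabs h ^+ 2 * q ^+ n)).
      apply: ler_sum => n _; rewrite cabsM.
      rewrite -(@ler_pM2r _ (r ^+ 2)) ?exprn_gt0// -[leLHS]mulrA.
      apply: (@le_trans _ _ ((M + 1) * n.+1%:R * (n%:R ^+ 2 * r ^+ n * cabs h ^+ 2))).
        apply: ler_pM; [exact: cabs_ge0| |exact: (coef_le aM)|].
          by rewrite mulr_ge0 ?cabs_ge0// exprn_ge0// ltW.
        exact: pow_taylor2 (ltW zr) wr.
      have -> : (M + 1) * C / r ^+ 2 * cabs h ^+ 2 * q ^+ n * r ^+ 2 =
          (M + 1) * (C * q ^+ n) * cabs h ^+ 2 by field; rewrite gt_eqF.
      have -> : (M + 1) * n.+1%:R * (n%:R ^+ 2 * r ^+ n * cabs h ^+ 2) =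
          (M + 1) * (n.+1%:R * n%:R ^+ 2 * r ^+ n) * cabs h ^+ 2 by ring.
      apply: ler_wpM2r; first exact: sqr_ge0.
      apply: ler_wpM2l; first by rewrite addr_ge0.
      apply: le_trans (hC n); apply: ler_wpM2r; first by rewrite exprn_ge0// ltW.
      have : n%:R ^+ 2 <= n.+1%:R ^+ 2 :> R.
        by rewrite lerXn2r ?nnegrE// ler_nat.
      have n1 : 1 <= n.+1%:R :> R by rewrite ler1n.
      set t := n.+1%:R in n1 * => ht.
      apply: (@le_trans _ _ (t * t ^+ 2)); first by rewrite ler_wpM2l//; lra.
      by rewrite -exprS ler_weXn2l.
    rewrite -mulr_sumr.
    have -> : K * cabs h ^+ 2 = (M + 1) * C / r ^+ 2 * cabs h ^+ 2 * (1 - q)^-1.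
      by rewrite /K; ring.
    apply: ler_wpM2l.
      apply: mulr_ge0; last exact: sqr_ge0.
      by apply: divr_ge0; [rewrite mulr_ge0 ?addr_ge0|exact: sqr_ge0].
    rewrite -div1r ler_pdivlMr ?subr_gt0// mulrC -opprB mulNr -subrX1 opprB.
    by rewrite gerBl exprn_ge0.
  (* One rate for three truncation errors: the values at [w] and [z], and the derivative. *)
  pose Q := Num.max q (Num.max qw qz).
  have Q01 : 0 <= Q < 1.
    by rewrite /Q le_max q0 /= !gt_max q1; case/andP: qw01 => _ ->; case/andP: qz01.
  have leQ (c x : R) N : 0 <= x -> x <= Q -> c * x ^+ N <= `|c| * Q ^+ N.
    move=> x0 xQ; apply: (@le_trans _ _ (`|c| * x ^+ N)).
      by rewrite ler_wpM2r ?exprn_ge0 ?ler_norm.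
    by rewrite ler_wpM2l// lerXn2r// nnegrE (le_trans x0).
  apply: (@le_of_geometric _ _ (`|Cw| + `|Cz| + `|G| * cabs h) Q Q01) => N.
  have -> : bseries aM w - bseries aM z - g * h =
      (cpoly a N (toC w) - cpoly a N (toC z) - (\sum_(n < N) dcoef n) * h) -
      (cpoly a N (toC w) - bseries aM w) + (cpoly a N (toC z) - bseries aM z) +
      (\sum_(n < N) dcoef n - g) * h by ring.
  apply: le_trans (le_cabsD _ _) _; rewrite cabsM.
  have eg := ler_wpM2r (cabs_ge0 h) (hg N).
  have e1 := le_cabsD ((cpoly a N (toC w) - cpoly a N (toC z) -
    (\sum_(n < N) dcoef n) * h) - (cpoly a N (toC w) - bseries aM w))
    (cpoly a N (toC z) - bseries aM z).
  have e2 := le_cabsD (cpoly a N (toC w) - cpoly a N (toC z) -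
    (\sum_(n < N) dcoef n) * h) (- (cpoly a N (toC w) - bseries aM w)).
  rewrite [X in _ <= _ + X]cabsN in e2.
  have ew := hw N; have ez := hz N; have t := taylor N.
  have qw0 : 0 <= qw by case/andP: qw01.
  have qz0 : 0 <= qz by case/andP: qz01.
  have lw : Cw * qw ^+ N <= `|Cw| * Q ^+ N by apply: leQ; rewrite // !le_max lexx orbT.
  have lz : Cz * qz ^+ N <= `|Cz| * Q ^+ N by apply: leQ; rewrite // !le_max lexx !orbT.
  have lg : G * q ^+ N * cabs h <= `|G| * Q ^+ N * cabs h.
    by rewrite ler_wpM2r ?cabs_ge0//; apply: leQ; rewrite // le_max lexx.
  rewrite !mulrDl [_ * cabs h * _]mulrAC; lra.
(* The first bound keeps [w] in the disc of radius [r], the second makes [K] times the distance less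
   than [e], also when [K] is 0. *)
exists (Num.min (r - cabs (toC z)) (e / (K + 1))).
  by rewrite lt_min subr_gt0 zr divr_gt0// ltr_wpDl.
move=> w w1 /andP[h0]; rewrite lt_min => /andP[hr he].
have wr : cabs (toC w) <= r.
  have := le_cabsD (toC w - toC z) (toC z); rewrite subrK; lra.
rewrite -(@ltr_pM2r _ (cabs (toC w - toC z)))// -cabsM mulrBl mulfVK; last first.
  by rewrite -cabs_gt0.
apply: le_lt_trans (main w wr) _; rewrite expr2 mulrA ltr_pM2r//.
move: he; rewrite ltr_pdivlMr ?ltr_wpDl//; apply: le_lt_trans.
by rewrite mulrDr mulr1 [leLHS]mulrC lerDl ltW.
Qed.

Lemma dsum_ord N : dsum a 0 N = \sum_(j < N) cabs (a j) ^+ 2 / j.+1%:R.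
Proof. by rewrite /dsum big_mkord. Qed.

Lemma integral_cpoly_le N :
  (\int[leb]_(p in ann 0 1) (cabs (cpoly a N (toC p)) ^+ 2)%:E <=
    (2 * alpha * M)%:E)%E.
Proof.
rewrite integral_parseval.
apply: (@le_trans _ _ (\sum_(j < N) (2 * alpha * (cabs (a j) ^+ 2 / j.+1%:R))%:E)%E).
  apply: lee_sum => j _.
  have := @integral_nsq_pow_le R 1 j ler01; rewrite expr1n mulr1 => h.
  apply: (@le_trans _ _ ((cabs (a j) ^+ 2)%:E * (2 * alpha / j.+1%:R)%:E)%E).
    by rewrite lee_wpmul2l ?lee_fin ?sqr_ge0.
  by rewrite -EFinM lee_fin mulrCA mulrA.
rewrite sumEFin lee_fin -mulr_sumr -dsum_ord ler_wpM2l//.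
by rewrite mulr_ge0// disc_area_ge0.
Qed.

(** Fatou's lemma along the partial sums, whose square integrals are uniformly bounded by
    Parseval. *)
Lemma bseries_bergman : bergman (bseries aM).
Proof.
split; first exact: bseries_holomorphic.
apply: (@le_lt_trans _ _ ((pi^-1)%:E * (2 * alpha * M)%:E)%E); last first.
  by rewrite -EFinM ltry.
rewrite lee_wpmul2l ?lee_fin ?invr_ge0 ?pi_ge0//.
pose F (n : nat) (p : R * R) : \bar R := (cabs (cpoly a n (toC p)) ^+ 2)%:E.
have mF n : measurable_fun (@diskD R) (F n).
  apply: measurable_funTS; apply/measurable_EFinP; exact: measurable_cpoly.
have mD : measurable (@diskD R) by rewrite diskDE; exact: measurable_ann.
have F0 n p : diskD p -> (0 <= F n p)%E by rewrite lee_fin sqr_ge0.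
have -> : (\int[leb]_(p in @diskD R) (cabs (bseries aM p) ^+ 2)%:E =
    \int[leb]_(p in @diskD R) limn_einf (F ^~ p))%E.
  apply: eq_integral => p /set_mem p1.
  have [C [q [/andP[q0 q1] h]]] := bseriesP aM p1.
  suff cF : F ^~ p @ \oo --> (cabs (bseries aM p) ^+ 2)%:E.
    by rewrite (cvg_limn_einf_sup cF).
  apply: cvg_EFin; first exact: nearW.
  have c1 : (fun n => cabs (cpoly a n (toC p))) @ \oo --> cabs (bseries aM p).
    apply/cvgrPdist_le => e e0.
    have cC : (fun n => C * q ^+ n) @ \oo --> C * 0.
      by apply: cvgMr; apply: cvg_expr; rewrite ger0_norm.
    rewrite mulr0 in cC; near=> n.
    apply: (@le_trans _ _ (C * q ^+ n)).
      apply: le_trans (h n); rewrite ler_norml.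
      have := le_cabsB (bseries aM p) (cpoly a n (toC p)).
      have := le_cabsB (cpoly a n (toC p)) (bseries aM p).
      by rewrite [cabs (bseries _ _ - _)]cabsBC => *; apply/andP; split; lra.
    by near: n; apply: (cvgr_le _ cC).
  by rewrite /F; under eq_fun do rewrite expr2; rewrite expr2; exact: cvgM.
apply: le_trans (fatou _ _ _ _) _ => //.
rewrite limn_einf_supE; apply: ge_ereal_sup => _ [n _ <-].
apply: (@le_trans _ _ (\int[leb]_(p in @diskD R) F n p)%E).
  by apply: ereal_inf_lbound; exists n => /=.
by rewrite diskDE; exact: integral_cpoly_le.
Unshelve. all: by end_near. Qed.

End Series.
End BergmanSeries.

(** * Blocks of a configuration *)

Section Configurations.
Variable R : realType.

Lemma continuous_nsq : continuous (@nsq R).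
Proof.
move=> p; rewrite /nsq; under eq_fun do rewrite !expr2.
apply: cvgD; apply: cvgM; by [exact: cvg_fst|exact: cvg_snd].
Qed.

Lemma compact_disc (b : R) : b < 1 -> compact [set p : R * R | nsq p <= b].
Proof.
move=> b1; pose I : set R := `[-1, 1]%classic.
apply: (@subclosed_compact _ _ (I `*` I)).
- have -> : [set p : R * R | nsq p <= b] = @nsq R @^-1` [set x | x <= b] by [].
  by apply: closed_comp; [move=> p _; exact: continuous_nsq|exact: closed_le].
- by apply: compact_setX; exact: segment_compact.
- move=> p; rewrite /nsq /= => h; rewrite /I /=; split; rewrite in_itv /=;
    apply/andP; split; nra.
Qed.

Lemma rel_compact_sub_disc (B : set (R * R)) (b : R) : b < 1 ->
  (forall p, B p -> nsq p <= b) -> rel_compact B.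
Proof.
move=> b1 hB; exists [set p : R * R | nsq p <= b]; split => //.
- exact: compact_disc.
- by move=> p /= pb; rewrite /diskD /= -nsq_lt1 (le_lt_trans pb).
Qed.

Lemma rel_compact_ann (a b : R) : b < 1 -> rel_compact (ann a b).
Proof. by move=> b1; apply: (rel_compact_sub_disc b1) => p /andP[_ /ltW]. Qed.

End Configurations.

(** * From convergent series to bounded norms *)

Section BlockFunctionals.
Variable R : realType.

Lemma series_terms_bounded (u : nat -> R) : cvgn (series u) ->
  exists M, forall k, `|u k| <= M.
Proof.
move=> /cvg_series_cvg_0 u0.
have /cvg_seq_bounded/pinfty_ex_gt0[M _ hM] : cvgn u by apply/cvg_ex; exists 0.
by exists M => k; exact: hM.
Qed.

Section Pairing.
Context (a : nat -> R[i]) (M : R).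
Hypothesis aM : forall N, dsum a 0 N <= M.

(** Identifies the block functional with the pairing of coefficients and moments; the sums are
    exchanged at a finite truncation. *)
Lemma pairing_lim (xs : seq (R * R)) (c : R * R -> R) :
  (forall x, x \in xs -> cabs (toC x) < 1) ->
  exists C q, 0 <= q < 1 /\ forall N,
    cabs (\sum_(0 <= n < N) a n * moment xs c n -
          \sum_(x <- xs) (c x)%:C * bseries aM x) <= C * q ^+ N.
Proof.
elim: xs => [|x xs ih] hxs.
  exists 0, 0; split; first by rewrite lexx ltr01.
  move=> N; rewrite big_nil subr0 big1 ?cabs0 ?mul0r// => n _.
  by rewrite /moment big_nil mulr0.
have [C [q [/andP[q0 q1] hq]]] : exists C q, 0 <= q < 1 /\ forall N,
    cabs (\sum_(0 <= n < N) a n * moment xs c n -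
          \sum_(x <- xs) (c x)%:C * bseries aM x) <= C * q ^+ N.
  by apply: ih => y ys; apply: hxs; rewrite inE ys orbT.
have [D [r [/andP[r0 r1] hr]]] := bseriesP aM (hxs x (mem_head _ _)).
pose t := Num.max q r.
have t01 : 0 <= t < 1 by rewrite /t le_max q0 gt_max q1.
have le_t (e y : R) N : 0 <= y -> y <= t -> e * y ^+ N <= `|e| * t ^+ N.
  move=> y0 yt; apply: (@le_trans _ _ (`|e| * y ^+ N)).
    by rewrite ler_wpM2r ?exprn_ge0 ?ler_norm.
  by rewrite ler_wpM2l// lerXn2r// nnegrE (le_trans y0).
exists (`|C| + `|c x| * `|D|), t; split => // N.
have -> : \sum_(0 <= n < N) a n * moment (x :: xs) c n -
    \sum_(y <- x :: xs) (c y)%:C * bseries aM y =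
    (\sum_(0 <= n < N) a n * moment xs c n -
      \sum_(y <- xs) (c y)%:C * bseries aM y) +
    (c x)%:C * (cpoly a N (toC x) - bseries aM x).
  rewrite big_cons mulrBr addrACA -opprD; congr (_ - _); last by rewrite addrC.
  rewrite /cpoly mulr_sumr -(big_mkord xpredT (fun j => (c x)%:C * (a j * toC x ^+ j))).
  rewrite -big_split /=; apply: eq_bigr => n _.
  by rewrite /moment big_cons; ring.
apply: le_trans (le_cabsD _ _) _; rewrite mulrDl; apply: lerD.
  by apply: le_trans (hq N) (le_t _ _ _ _ _); rewrite // /t le_max lexx.
rewrite cabsM cabs_real -mulrA ler_wpM2l//.
by apply: le_trans (hr N) (le_t _ _ _ _ _); rewrite // /t le_max lexx orbT.
Qed.

End Pairing.

Lemma cabs_moment_le xs (c : R * R -> R) (r : R) n : (forall x, 0 <= c x) ->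
  (forall x, x \in xs -> cabs (toC x) <= r) ->
  cabs (moment xs c n) <= (\sum_(x <- xs) c x) * r ^+ n.
Proof.
move=> c0 hr; apply: le_trans (le_cabs_sum _ _ _) _.
rewrite mulr_suml big_seq [leRHS]big_seq; apply: ler_sum => x xs_x.
rewrite cabsM cabs_real cabsX ger0_norm// ler_wpM2l// lerXn2r// ?nnegrE ?cabs_ge0//.
  by apply: le_trans (hr x xs_x); exact: cabs_ge0.
exact: hr.
Qed.

Lemma wsum_tail_le (u : nat -> R[i]) (C r : R) : 0 <= r < 1 ->
  (forall n, cabs (u n) <= C * r ^+ n) ->
  exists N0, forall N, wsum u N0 N <= 1.
Proof.
move=> r01 hu; have [D [q [D0 /andP[q0 q1] hD]]] := poly_geometric_bound r01.
have /andP[r0 r1] := r01.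
have term n : n.+1%:R * cabs (u n) ^+ 2 <= C ^+ 2 * D * q ^+ n.
  apply: (@le_trans _ _ (n.+1%:R * (C * r ^+ n) ^+ 2)).
    rewrite ler_wpM2l// lerXn2r ?nnegrE ?cabs_ge0//.
    exact: le_trans (cabs_ge0 _) (hu n).
  rewrite exprMn mulrCA -[leRHS]mulrA ler_wpM2l ?sqr_ge0//.
  apply: le_trans (hD n); apply: ler_pM => //; first by rewrite sqr_ge0.
    by rewrite -[leLHS]expr1 ler_weXn2l// ler1n.
  by rewrite expr2 ler_piMr ?exprn_ge0// exprn_ile1// ltW.
pose E := C ^+ 2 * D / (1 - q).
have E0 : 0 <= E.
  by apply: divr_ge0; [rewrite mulr_ge0 ?sqr_ge0|rewrite subr_ge0 ltW].
have cE : (fun n => E * q ^+ n) @ \oo --> E * 0.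
  by apply: cvgMr; apply: cvg_expr; rewrite ger0_norm.
rewrite mulr0 in cE.
have /cvgrPdist_le /(_ 1 ltr01) [N0 _ hN0] := cE.
exists N0 => N; apply: (@le_trans _ _ (E * q ^+ N0)); last first.
  have := hN0 N0 (leqnn _); rewrite sub0r normrN; apply: le_trans; exact: ler_norm.
have [N0N|NN0] := leqP N0 N; last first.
  by rewrite /wsum (big_geq (ltnW NN0)) mulr_ge0// exprn_ge0.
apply: (@le_trans _ _ (\sum_(N0 <= n < N) C ^+ 2 * D * q ^+ n)).
  by apply: ler_sum => n _; exact: term.
rewrite -mulr_sumr.
have -> : E * q ^+ N0 = C ^+ 2 * D * (q ^+ N0 / (1 - q)) by rewrite /E; ring.
apply: ler_wpM2l.
  by rewrite mulr_ge0// sqr_ge0.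
rewrite -{1}[N0]add0n big_addn big_mkord ler_pdivlMr ?subr_gt0//.
under eq_bigr do rewrite exprD.
rewrite -mulr_suml mulrAC [X in X * _]mulrC -opprB mulNr -subrX1 opprB.
by rewrite ler_piMl ?exprn_ge0// gerBl exprn_ge0.
Qed.

Section Convergence.
Context (z : R * R) (s : R) (Y : set (R * R)).
Hypotheses (zD : diskD z) (Yconf : is_conf Y).

Definition weight (x : R * R) : R := expR (- (s * dh z x)).

Lemma annulus_points k : exists xs : seq (R * R), uniq xs /\
  [set x | Y x /\ k%:R <= dh z x < k.+1%:R] = [set` xs].
Proof.
have [YD _] := Yconf.
have R1 : outer_radius z k ^+ 2 < 1.
  by rewrite expr_lt1// ?outer_radius_lt1// outer_radius_ge0.
pose B := [set x : R * R | diskD x /\ k%:R <= dh z x < k.+1%:R].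
have cB : rel_compact B.
  apply: (rel_compact_sub_disc R1) => x [xD /andP[_ dk]].
  rewrite nsqE lerXn2r ?nnegrE ?cabs_ge0 ?outer_radius_ge0//.
  exact/ltW/lt_outer_radius.
have [xs uxs e] := finite_conf_seq Yconf cB.
exists xs; split => //; rewrite -e; apply/seteqP; split => x /=.
  by move=> [Yx dx]; split => //; split => //; exact: YD.
by move=> [Yx [_ dx]].
Qed.

Context (xs : nat -> seq (R * R)).
Hypothesis uxs : forall k, uniq (xs k).
Hypothesis xsE : forall k,
  [set x | Y x /\ k%:R <= dh z x < k.+1%:R] = [set` xs k].

Lemma blockE f k : block Y z s f k = \sum_(x <- xs k) (weight x)%:C * f x.
Proof. by rewrite /block xsE -fsbig_seq. Qed.

Lemma annulus_point_disk k x : x \in xs k -> cabs (toC x) < 1.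
Proof.
move=> xk; have : [set` xs k] x by [].
by rewrite -xsE => -[Yx _]; have [YD _] := Yconf; exact: YD.
Qed.

Lemma annulus_point_outer k x : x \in xs k -> cabs (toC x) < outer_radius z k.
Proof.
move=> xk; apply: lt_outer_radius => //; first exact: annulus_point_disk xk.
have : [set` xs k] x by [].
by rewrite -xsE => -[_ /andP[]].
Qed.

Let S k := moment (xs k) weight.

Let w0 x : 0 <= weight x. Proof. exact: expR_ge0. Qed.

Hypothesis Hconv : forall f, bergman f -> cseries_converges (block Y z s f).

Lemma block_bounded f : bergman f -> exists M, forall k, cabs (block Y z s f k) <= M.
Proof.
move=> /Hconv[/series_terms_bounded[M1 h1] /series_terms_bounded[M2 h2]].
exists (M1 + M2) => k; apply: le_trans (cabs_le_ReIm _) _.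
by rewrite lerD.
Qed.

Lemma convergent_wsum_bounded :
  exists M : nat, forall k N, wsum (S k) 0 N <= M%:R.
Proof.
apply: contrapT => nM.
have unb (M : R) : exists k N, M < wsum (S k) 0 N.
  apply: contrapT => h; apply: nM; exists (Num.bound M) => k N.
  apply: (@le_trans _ _ M).
    by rewrite leNgt; apply/negP => hM; apply: h; exists k, N.
  by apply: le_trans (ler_norm _) _; apply: ltW; have := archi_boundP (normr_ge0 M); rewrite /Num.bound normr_id.
have tail k : exists N0, forall N, wsum (S k) N0 N <= 1.
  have r01 : 0 <= outer_radius z k < 1.
    by rewrite outer_radius_ge0 outer_radius_lt1.
  apply: (wsum_tail_le r01) => n; apply: cabs_moment_le => // x xk.
  exact/ltW/annulus_point_outer.
(* Tested on the monomial of degree [n], the blocks are exactly the moments [S k n]. *)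
have bd n : exists B, forall k, cabs (S k n) <= B.
  pose a m : R[i] := (m == n)%:R.
  have aE m : a m = 0 \/ m = n by rewrite /a; case: eqVneq; [right|left].
  have aM N : dsum a 0 N <= 1.
    rewrite /dsum; have [nN|Nn] := ltnP n N.
      rewrite (bigD1_seq n) ?mem_index_iota ?iota_uniq//= /a eqxx cabs1 expr1n.
      rewrite big1 ?addr0; last by move=> m mn; rewrite (negPf mn) cabs0 expr0n mul0r.
      by rewrite div1r invf_le1// ler1n.
    rewrite big_nat big1// => m /andP[_ mN].
    by rewrite /a (ltn_eqF (leq_trans mN Nn)) cabs0 expr0n mul0r.
  have [B hB] := block_bounded (bseries_bergman aM).
  exists B => k; apply: le_trans (hB k).
  have [C [q [q01 h]]] := pairing_lim aM weight (@annulus_point_disk k).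
  have /andP[q0 q1] := q01.
  rewrite blockE; apply: (@le_of_geometric _ _ _ (`|C|) q q01) => N.
  have {}h := h (N + n.+1)%N.
  have e : \sum_(0 <= m < N + n.+1) a m * S k m = S k n.
    rewrite (bigD1_seq n) ?mem_index_iota ?iota_uniq//=; last by rewrite addnS ltnS leq_addl.
    rewrite /a eqxx mul1r big1 ?addr0// => m mn.
    by rewrite (negPf mn) mul0r.
  rewrite [X in cabs (X - _)]e in h.
  rewrite -lerBlDl; apply: le_trans (le_cabsB _ _) _; apply: le_trans h _.
  apply: (@le_trans _ _ (`|C| * q ^+ (N + n.+1))).
    by rewrite ler_wpM2r ?exprn_ge0 ?ler_norm.
  by rewrite ler_wpM2l// exprD ler_piMr ?exprn_ge0// exprn_ile1// ltW.
have [a [aM ha]] := gliding_hump tail bd unb.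
have [B hB] := block_bounded (bseries_bergman aM).
have [k [N0 hk]] := ha (B + 1).
have [C [q [q01 h]]] := pairing_lim aM weight (@annulus_point_disk k).
have /andP[q0 q1] := q01.
(* The truncated pairings have modulus at least [B + 1] from [N0] on, yet they tend to a block of
   modulus at most [B]. *)
have : B + 1 <= B; last by rewrite gerDl ler10.
apply: (@le_of_geometric _ _ _ (`|C|) q q01) => N.
apply: le_trans (hk (N + N0)%N (leq_addl _ _)) _.
apply: (@le_trans _ _ (cabs (block Y z s (bseries aM) k) + C * q ^+ (N + N0))).
  rewrite -lerBlDl; apply: le_trans (le_cabsB _ _) _; rewrite blockE; exact: h.
apply: lerD; first exact: hB.
apply: (@le_trans _ _ (`|C| * q ^+ (N + N0))).
  by rewrite ler_wpM2r ?exprn_ge0 ?ler_norm.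
by rewrite ler_wpM2l// exprD ler_piMr ?exprn_ge0// exprn_ile1// ltW.
Qed.

End Convergence.
End BlockFunctionals.

(** * Lower bound for the norm of a block *)

Section LowerBound.
Context (R : realType) (z : R * R).
Hypothesis zD : diskD z.
Local Notation zeta := (cabs (toC z)).
Local Notation leb := (@leb2 R).
Variables (k : nat) (s : R).
Hypothesis s0 : 0 < s.
Local Notation rho := (rho_k z k).
Local Notation e := (expR (- k.+1%:R : R)).

Lemma bernoulli_le (x : R) n : 0 <= x <= 1 -> 1 - n%:R * x <= (1 - x) ^+ n.
Proof.
move=> /andP[x0 x1]; elim: n => [|n ih]; first by rewrite mul0r subr0 expr0.
have := ler_wpM2r (_ : 0 <= 1 - x) ih; rewrite subr_ge0 => /(_ x1).
rewrite -exprSr; apply: le_trans; rewrite -natr1.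
have : 0 <= n%:R * (x * x) by rewrite !mulr_ge0.
nra.
Qed.

(** Compensates the decay of powers: [gain * nsq x] stays below 1 on the annulus and is nearly 1 on
    the thin sector. *)
Definition gain : R := (1 - rho)^-1.

Lemma annulus_const_ge1 : 1 <= annulus_const z.
Proof.
have zeta1 : zeta < 1 by exact: zD.
have z0 := cabs_ge0 (toC z).
have a : 0 < 1 - zeta ^+ 2 by rewrite subr_gt0 expr_lt1.
have a1 : 1 - zeta ^+ 2 <= 1 by rewrite gerBl sqr_ge0.
have b : 0 < (1 - zeta) ^+ 2 by rewrite exprn_gt0// subr_gt0.
have b1 : (1 - zeta) ^+ 2 <= 1 by rewrite expr_le1// ?subr_ge0 ?(ltW zeta1)// gerBl.
have ab : 0 < (1 - zeta ^+ 2) * (1 - zeta) ^+ 2 by exact: mulr_gt0.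
rewrite /annulus_const ler_pdivlMr; last exact: ab.
rewrite mul1r; apply: (@le_trans _ _ 1).
  by apply: mulr_ile1 => //; exact: ltW.
by have := expR_ge1Dx (1 : R); lra.
Qed.

(** Parseval needs an annulus centred at 0; this one contains the hyperbolic annulus and still has
    thickness of order [rho]. *)
Definition fat_annulus : set (R * R) := ann (1 - annulus_const z * rho) (1 - rho).

Hypothesis rho_half : rho <= 1 / 2.

Let rho0 : 0 < rho. Proof. exact: rho_gt0. Qed.

Lemma gain_ge1 : 1 <= gain.
Proof.
have r0 := rho0; rewrite /gain invf_ge1; last by have := rho_half; lra.
by rewrite gerBl ltW.
Qed.

Lemma gain_le : gain <= expR (2 * rho).
Proof.
have r0 := rho0; have rh := rho_half.
rewrite /gain -div1r ler_pdivrMr; last by lra.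
apply: (@le_trans _ _ ((1 + 2 * rho) * (1 - rho))); last first.
  by rewrite ler_wpM2r ?expR_ge1Dx//; lra.
have : 0 <= rho * (1 - 2 * rho) by rewrite mulr_ge0 ?(ltW r0)//; lra.
lra.
Qed.

Lemma annulus_sub_fat x : diskD x -> k%:R <= dh z x < k.+1%:R -> fat_annulus x.
Proof.
move=> xD /andP[d1 d2]; rewrite /fat_annulus /ann /=.
have := inner_bound zD xD d1; have := lt_outer_radius zD xD d2 => h1 h2.
apply/andP; split; first lra.
rewrite /rho_k opprB addrCA subrr addr0 nsqE.
by have := ltr_pM (cabs_ge0 _) (cabs_ge0 _) h1 h1; rewrite -!expr2.
Qed.

Lemma fat_rho1_le x : fat_annulus x -> rho1 x <= rho ^- 2.
Proof.
move=> /andP[_ h]; have r0 := rho0; have h' : rho < 1 - nsq x by lra.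
have h0 := lt_trans r0 h'.
rewrite /rho1 lef_pV2 ?posrE ?exprn_gt0//.
by rewrite lerXn2r ?nnegrE ?ltW.
Qed.

Variables (u : R * R) (del : R) (T : nat).
Hypotheses (del0 : 0 < del) (del4 : del <= 1 / 4).
Local Notation B := (thin_sector z k u del).
Hypothesis Tle : T%:R * (4 * (rho * del)) <= 1.

(** On the thin sector [gain * nsq x] is at least [1 - 2 * (rho * del)], and by Bernoulli's
    inequality and the bound on [T] its powers below [T] stay above [1 / 2]. *)
Lemma diag_ge x : B x -> T%:R / 2 <= \sum_(i < T) (gain * nsq x) ^+ i.
Proof.
move=> /and4P[b1 _ _ _]; have r0 := rho0; have rh := rho_half.
have rd0 : 0 < rho * del by rewrite mulr_gt0.
have rd1 : rho * del <= 1 / 8.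
  have : rho * del <= (1 / 2) * (1 / 4) by rewrite ler_pM// ltW.
  lra.
have h0 : 0 <= 2 * (rho * del) <= 1 by apply/andP; split; lra.
have h : 1 - 2 * (rho * del) <= gain * nsq x.
  rewrite [gain * _]mulrC /gain ler_pdivlMr; last by lra.
  apply: le_trans b1; have : 0 <= (rho * del) * (1 - 2 * rho).
    by rewrite mulr_ge0 ?(ltW rd0)//; lra.
  lra.
have -> : T%:R / 2 = \sum_(i < T) (2^-1 : R).
  by rewrite sumr_const card_ord mulrC mulr_natr.
 apply: ler_sum => i _.
have : (1 - 2 * (rho * del)) ^+ i <= (gain * nsq x) ^+ i.
  by case/andP: h0 => _ h1; rewrite lerXn2r// nnegrE; lra.
apply: le_trans; apply: le_trans (bernoulli_le i h0).
have h1 : i%:R * (4 * (rho * del)) <= 1.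
  apply: le_trans Tle; apply: ler_wpM2r; first by rewrite mulr_ge0 ?(ltW rd0).
  by rewrite ler_nat ltnW.
have h2 : i%:R * (2 * (rho * del)) = i%:R * (4 * (rho * del)) / 2 by field.
suff : 2^-1 <= 1 - i%:R * (2 * (rho * del)) :> R by [].
by rewrite h2; lra.
Qed.

Variable xs : seq (R * R).
Hypothesis uxs : uniq xs.
Hypothesis xsA : forall x, x \in xs -> diskD x /\ k%:R <= dh z x < k.+1%:R.

(** The diagonal keeps only the points of the thin sector, with the smallest weight of the annulus;
    the off-diagonal part keeps all pairs, with the largest. The random quantities enter through
    [nB] and [off] alone. *)
Lemma wsum_lower (nB off : R) :
  nB <= (size [seq x <- xs | `[< B x >]])%:R ->
  \sum_(x <- xs) \sum_(y <- xs | y != x) kerH gain T x y <= off ->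
  expR (- (s * k.+1%:R)) ^+ 2 * (T%:R / 2) ^+ 2 * nB -
    expR (- (s * k%:R)) ^+ 2 * off <=
  gain ^+ (2 * T) * wsum (moment xs (weight z s)) 0 (2 * T).
Proof.
move=> hB hoff; have g1 := gain_ge1; have g0 : 0 <= gain by lra.
apply: le_trans (quad_le_wsum _ T g1).
apply: le_trans (quad_ge T uxs g0 (fun x => expR_ge0 (- (s * dh z x)))).
have wl x : x \in xs -> expR (- (s * k.+1%:R)) <= weight z s x.
  move=> /xsA[_ /andP[_ d2]]; rewrite /weight ler_expR lerN2.
  by rewrite ler_wpM2l ?(ltW s0)// ltW.
have wu x : x \in xs -> weight z s x <= expR (- (s * k%:R)).
  move=> /xsA[_ /andP[d1 _]]; rewrite /weight ler_expR lerN2.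
  by rewrite ler_wpM2l ?(ltW s0).
apply: lerB.
  set E := expR _.
  apply: (@le_trans _ _ (E ^+ 2 * (T%:R / 2) ^+ 2 *
      (size [seq x <- xs | `[< B x >]])%:R)).
    by rewrite ler_wpM2l// mulr_ge0 ?sqr_ge0.
  rewrite size_filter -sum1_count natr_sum mulr_sumr big_mkcond /=.
  rewrite big_seq [leRHS]big_seq; apply: ler_sum => x xs_x.
  case: ifPn => [/asboolP Bx|_]; last by rewrite mulr_ge0 ?sqr_ge0.
  rewrite mulr1; apply: ler_pM; rewrite ?sqr_ge0//.
    rewrite lerXn2r ?nnegrE ?expR_ge0//; exact: wl.
  have := diag_ge Bx => h; rewrite lerXn2r ?nnegrE ?divr_ge0//.
  by apply: le_trans h; rewrite divr_ge0.
apply: (@le_trans _ _ (expR (- (s * k%:R)) ^+ 2 *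
  \sum_(x <- xs) \sum_(y <- xs | y != x) kerH gain T x y)); last first.
  by rewrite ler_wpM2l ?sqr_ge0.
rewrite mulr_sumr big_seq [leRHS]big_seq; apply: ler_sum => x xs_x.
rewrite mulr_sumr big_seq_cond [leRHS]big_seq_cond; apply: ler_sum => y /andP[ys _].
apply: ler_wpM2r; first exact: kerH_ge0.
by rewrite expr2 ler_pM ?expR_ge0//; [exact: wu|exact: wu].
Qed.

End LowerBound.

(** * The exceptional events *)

Section Numerics.
Variable R : realType.

Lemma expRN_le_inv n : expR (- n%:R : R) <= n.+1%:R^-1.
Proof.
rewrite expRN lef_pV2 ?posrE ?expR_gt0 ?ltr0n//.
by rewrite -natr1 addrC; exact: expR_ge1Dx.
Qed.

Lemma half_inverse (a : R) : 0 < a -> a <= 1 / 8 ->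
  exists T : nat, T%:R * (4 * a) <= 1 /\ 1 <= T%:R * (8 * a).
Proof.
move=> a0 a8; pose x : R := (4 * a)^-1.
have a4 : 0 < 4 * a by rewrite mulr_gt0.
have x0 : 0 <= x by rewrite invr_ge0 ltW.
have x2 : 2 <= x by rewrite /x -[2]invrK lef_pV2 ?posrE ?invr_gt0//; lra.
have /andP[t1 t2] := Num.Theory.truncn_itv x0.
exists (Num.truncn x); set T := Num.truncn x in t1 t2 *.
have xa : x * (4 * a) = 1 by rewrite /x mulVf ?gt_eqF.
split; first by have := ler_wpM2r (ltW a4) t1; rewrite xa.
have t3 : 1 <= T%:R :> R.
  by rewrite ler1n lt0n; apply/negP => /eqP T0; move: t2; rewrite T0; lra.
have -> : T%:R * (8 * a) = (T%:R + T%:R) * (4 * a) by ring.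
rewrite -natr1 in t2; have h : x <= T%:R + T%:R by lra.
by have := ler_wpM2r (ltW a4) h; rewrite xa.
Qed.

(** Here [del = eta ^+ 2]. The hypotheses give [(T / 2) ^+ 2 * (m / 2) >= c1 / (512 * eta * rho^3)],
    and the bound on [eta] makes [g] times this at least [2 * K * rho^-3]: one half cancels the
    off-diagonal part, the other remains. *)
Lemma diag_dominates (q g rho eta c1 K T m : R) :
  0 <= q -> 0 < g -> 0 < rho -> 0 < eta -> 0 < c1 -> 0 < K -> 0 <= T ->
  eta <= g * c1 / (32 * (32 * K)) -> 1 <= T * (8 * (rho * eta ^+ 2)) ->
  c1 * eta ^+ 3 / rho <= m ->
  K * rho ^- 3 * q <= q * g * (T / 2) ^+ 2 * (m / 2) - q * (K * rho ^- 3).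
Proof.
move=> q0 g0 r0 e0 c0 K0 T0 he hT hm.
have T2 : (16 * (rho * eta ^+ 2))^-1 <= T / 2.
  rewrite -div1r ler_pdivrMr ?mulr_gt0 ?exprn_gt0//.
  by have -> : T / 2 * (16 * (rho * eta ^+ 2)) = T * (8 * (rho * eta ^+ 2)) by field.
have T2s : (16 * (16 * (rho ^+ 2 * eta ^+ 4)))^-1 <= (T / 2) ^+ 2.
  have -> : 16 * (16 * (rho ^+ 2 * eta ^+ 4)) = (16 * (rho * eta ^+ 2)) ^+ 2 by ring.
  rewrite -exprVn lerXn2r ?nnegrE ?divr_ge0 ?invr_ge0//.
  by rewrite mulr_ge0// mulr_ge0 ?exprn_ge0 ?ltW.
have hK : 2 * K <= g * c1 / (16 * (32 * eta)).
  have he' : eta * (32 * (32 * K)) <= g * c1.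
    by rewrite -ler_pdivlMr// mulr_gt0// mulr_gt0.
  rewrite ler_pdivlMr; last by rewrite mulr_gt0// mulr_gt0.
  by have -> : 2 * K * (16 * (32 * eta)) = eta * (32 * (32 * K)) by ring.
have step : 2 * K * rho ^- 3 <= g * ((T / 2) ^+ 2 * (m / 2)).
  apply: (@le_trans _ _ (g * c1 / (16 * (32 * eta)) * rho ^- 3)).
    by apply: ler_wpM2r => //; rewrite invr_ge0 exprn_ge0// ltW.
  have -> : g * c1 / (16 * (32 * eta)) * rho ^- 3 =
      g * ((16 * (16 * (rho ^+ 2 * eta ^+ 4)))^-1 * (c1 * eta ^+ 3 / rho / 2)).
    by field; rewrite !gt_eqF.
  apply: ler_wpM2l; first exact: ltW.
  apply: ler_pM => //.
  - by rewrite invr_ge0 !mulr_ge0 ?exprn_ge0 ?ltW.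
  - by rewrite !mulr_ge0 ?invr_ge0 ?exprn_ge0 ?ltW.
  - by apply: ler_wpM2r => //; rewrite invr_ge0.
have := ler_wpM2l q0 step; set A := rho ^- 3; set D := (T / 2) ^+ 2.
have -> : q * (2 * K * A) = K * A * q + q * (K * A) by ring.
have -> : q * g * D * (m / 2) = q * (g * (D * (m / 2))) by ring.
by rewrite lerBrDr.
Qed.

End Numerics.

Section TailBound.
Context (R : realType) (d : measure_display) (T : measurableType d).
Variable P : probability T R.

(** Markov's inequality, together with the measurability of the event. *)
Lemma tail_le (Y : T -> \bar R) (c t : R) :
  measurable_fun setT Y -> (forall w, 0 <= Y w)%E -> 0 < t ->
  (\int[P]_w Y w <= c%:E)%E ->
  let A := [set w | (t%:E <= Y w)%E] in measurable A /\ (P A <= (c / t)%:E)%E.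
Proof.
move=> mY Y0 t0 h A.
have mA : measurable A.
  rewrite /A -[X in measurable X]setTI.
  exact: emeasurable_fun_c_infty.
split=> //.
have pf : P A \is a fin_num by exact: fin_num_measure.
have : (t%:E * P A <= c%:E)%E.
  apply: le_trans h; rewrite -[X in (_ * P X)%E](setIT A) -integral_indic//.
  rewrite -ge0_integralZl_EFin ?(ltW t0)//; last first.
    by apply/measurable_EFinP; exact: measurable_indic.
  apply: le_integral_nonmeas => w _ //; rewrite indicE.
  have [/set_mem wA|_] := boolP (w \in A); last by rewrite mule0.
  by rewrite mule1.
by rewrite -(fineK pf) -EFinM !lee_fin ler_pdivlMr// mulrC.
Qed.

End TailBound.

Section Assembly.
Context (R : realType) (d : measure_display) (Omega : measurableType d).
Context (P : probability Omega R) (X : Omega -> set (R * R)).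
Hypothesis HX : bergman_dpp P X.
Context (z : R * R).
Hypothesis zD : diskD z.
Local Notation zeta := (cabs (toC z)).
Local Notation leb := (@leb2 R).
Local Notation alpha := (@disc_area R).
Local Notation C := (annulus_const z).

Let zeta1 : zeta < 1. Proof. exact: zD. Qed.
Let zeta0 : 0 <= zeta. Proof. exact: cabs_ge0. Qed.

Section FixedAnnulus.
Variable k : nat.
Local Notation rho := (rho_k z k).
Let rho0 : 0 < rho. Proof. exact: rho_gt0. Qed.

Lemma measurable_fat_annulus : measurable (fat_annulus z k).
Proof. exact: measurable_ann. Qed.

Lemma rel_compact_fat_annulus : rel_compact (fat_annulus z k).
Proof. by apply: rel_compact_ann; rewrite gtrBl. Qed.

(** [integral_kerH_le] with thickness [C * rho] gives [8 * C * alpha ^+ 2 * rho], and the density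
    bound [rho^-2], normalized by [pi] and squared, gives the rest. *)
Definition off_const : R := 8 * C * alpha ^+ 2 / pi ^+ 2.

Lemma expected_off_diagonal_le T : C * rho <= 1 -> rho <= 1 / 2 ->
  (\int[P]_w lower_pair_sum X (fat_annulus z k) (kerH (gain z k) T) w <=
   (off_const * rho ^- 3)%:E)%E.
Proof.
move=> C1 rh; have r0 := rho0.
have r20 : 0 <= rho ^- 2 by rewrite invr_ge0 exprn_ge0 ?ltW.
have Cr : rho <= C * rho by rewrite ler_peMl ?(ltW rho0)// annulus_const_ge1.
apply: le_trans (expected_weighted_pairs_le HX measurable_fat_annulus
  rel_compact_fat_annulus r20 (fun x => fat_rho1_le zD (x := x))
  (kerH_ge0 (gain z k) T) (@kerH_lsc R (gain z k) T)) _.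
have I : (\int[leb]_(x in fat_annulus z k) \int[leb]_(y in fat_annulus z k)
    (kerH (gain z k) T x y)%:E <= (alpha ^+ 2 * (8 * (C * rho)))%:E)%E.
  apply: integral_kerH_le; [lra|lra|lra|lra| |lra|lra].
  by rewrite /gain mulVf// gt_eqF//; lra.
apply: le_trans (lee_wpmul2l _ I) _; first by rewrite lee_fin sqr_ge0.
rewrite -EFinM lee_fin /off_const le_eqVlt; apply/orP; left; apply/eqP.
move: (pi : R) (pi_gt0 R) => p p0; by field; rewrite !gt_eqF ?rho_gt0.
Qed.

Variables (u : R * R) (eta : R).
Hypotheses (u1 : u.1 ^+ 2 + u.2 ^+ 2 = 1) (zu : z = (zeta * u.1, zeta * u.2)).
Hypotheses (eta0 : 0 < eta) (eta2 : eta <= 1 / 2).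
Hypotheses (k4 : expR (- k%:R : R) <= 1 / 4).
Hypothesis rho24 : rho <= (1 - zeta) ^+ 2 / 24.
Local Notation B := (thin_sector z k u (eta ^+ 2)).

Lemma eta_sqr_bounds : 0 < eta ^+ 2 /\ eta ^+ 2 <= 1 / 4.
Proof.
split; first exact: exprn_gt0.
have -> : 1 / 4 = (1 / 2) ^+ 2 :> R by field.
by rewrite lerXn2r ?nnegrE ?(ltW eta0)//; lra.
Qed.

Lemma thin_sector_fat : B `<=` fat_annulus z k.
Proof.
have [d0 d4] := eta_sqr_bounds; move=> x Bx.
have [xD _ _ _] := thin_sector_bounds zD d0 d4 rho24 Bx.
by apply: (annulus_sub_fat zD xD); apply: (thin_sector_annulus zD u1 zu d0 d4 k4 rho24 Bx).
Qed.

Lemma measurable_thin_sector : measurable B.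
Proof. exact: measurable_sector. Qed.

Lemma rel_compact_thin_sector : rel_compact B.
Proof. exact: rel_compactS thin_sector_fat rel_compact_fat_annulus. Qed.

(** The factor 32 collects 4 from [sector_width], 2 from the thickness of the band and 4 from
    [rho1 >= 1 / (4 * rho ^+ 2)] on the sector. With [del = eta ^+ 2] the area carries
    [eta ^+ 3]. *)
Definition count_const : R := (1 - zeta) / (32 * pi).

Lemma intensity_thin_sector :
  exists m, intensity B = m%:E /\ count_const * eta ^+ 3 / rho <= m.
Proof.
have [d0 d4] := eta_sqr_bounds; have r0 := rho0.
have fin : intensity B \is a fin_num.
  rewrite ge0_fin_numE ?intensity_ge0// /intensity.
  apply: lte_mul_pinfty; rewrite ?lee_fin ?invr_ge0 ?pi_ge0//.
  apply: (@le_lt_trans _ _ (\int[leb]_(x in B) (rho ^- 2)%:E)%E).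
    apply: le_integral_nonmeas => x Bx; rewrite lee_fin.
      by rewrite invr_ge0 exprn_ge0// ltW.
    have h := fat_rho1_le zD (thin_sector_fat Bx).
    exact h.
  have -> : (\int[leb]_(x in B) (rho ^- 2)%:E = (rho ^- 2)%:E * leb B)%E.
    by apply: integral_cst; exact: measurable_sector.
  apply: lte_mul_pinfty; rewrite ?lee_fin ?invr_ge0 ?exprn_ge0 ?ltW//.
  apply: (@le_lt_trans _ _ (leb (ann 0 1))).
    apply: le_measure; rewrite ?inE.
    - exact: measurable_sector.
    - exact: measurable_ann.
    - move=> x /(thin_sector_bounds zD d0 d4 rho24)[xD _ _ _].
      by rewrite /ann /= nsq_ge0 nsq_lt1.
  by rewrite leb2_ann01 ltry.
exists (fine (intensity B)); rewrite fineK//; split => //.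
rewrite -lee_fin fineK// /intensity.
have rr : 0 <= (4 * rho ^+ 2)^-1 by rewrite invr_ge0 mulr_ge0 ?exprn_ge0 ?ltW.
apply: (@le_trans _ _ ((pi^-1)%:E * ((4 * rho ^+ 2)^-1%:E *
    (sector_width z (eta ^+ 2) * (rho * eta ^+ 2 / 2))%:E))%E).
  rewrite -!EFinM lee_fin /count_const /sector_width sqrtr_sqr (gtr0_norm eta0).
  rewrite le_eqVlt; apply/orP; left; apply/eqP.
  move: (pi : R) (pi_gt0 R) => p p0; by field; rewrite !gt_eqF ?rho_gt0.
apply: lee_wpmul2l; first by rewrite lee_fin invr_ge0 pi_ge0.
apply: (@le_trans _ _ ((4 * rho ^+ 2)^-1%:E * leb B)%E).
  apply: lee_wpmul2l; first by rewrite lee_fin.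
  exact: leb2_thin_sector_ge.
have <- : (\int[leb]_(x in B) ((4 * rho ^+ 2)^-1)%:E = (4 * rho ^+ 2)^-1%:E * leb B)%E.
  by apply: integral_cst; exact: measurable_sector.
apply: le_integral_nonmeas => x Bx; first by rewrite lee_fin rho1_ge0.
have [xD h1 h2 _] := thin_sector_bounds zD d0 d4 rho24 Bx.
have rd : 0 < rho * eta ^+ 2 by rewrite mulr_gt0.
have rd2 : rho * eta ^+ 2 <= rho * (1 / 4) by rewrite ler_wpM2l// ltW.
have h3 : 0 < 1 - nsq x by lra.
rewrite lee_fin /rho1 lef_pV2 ?posrE ?exprn_gt0//; last first.
  by rewrite mulr_gt0 ?exprn_gt0.
have -> : 4 * rho ^+ 2 = (2 * rho) ^+ 2 by ring.
by rewrite lerXn2r ?nnegrE ?(ltW h3) ?mulr_ge0 ?(ltW r0)//; lra.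
Qed.

End FixedAnnulus.


Variable s : R.
Local Notation C6 := (4 / (1 - zeta ^+ 2)).

Let z2 : 0 < 1 - zeta ^+ 2. Proof. by rewrite subr_gt0 expr_lt1. Qed.
Let C60 : 0 < C6. Proof. by rewrite divr_gt0. Qed.

Lemma rho_k_le k : rho_k z k <= C6 * expR (- k%:R).
Proof.
apply: le_trans (rho_le_e zD k) _; apply: ler_wpM2l; first exact: ltW.
by rewrite ler_expR lerN2 ler_nat.
Qed.

Lemma large_index (tau L : R) : 0 < tau -> s < 3 / 2 -> exists k,
  [/\ rho_k z k <= tau, expR (- k%:R : R) <= 1 / 4 &
      L <= expR ((3 - 2 * s) * k%:R)].
Proof.
move=> t0 s32; have b0 : 0 < 3 - 2 * s by lra.
(* The three summands serve the three requirements; the last gives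
   [exp (- N) <= 1 / (N + 1) <= 1 / 4]. *)
pose N := (Num.bound (C6 / tau) + (Num.bound (`|L| / (3 - 2 * s)) + 3))%N.
have h1 : C6 / tau <= N%:R.
  apply: ltW; apply: lt_le_trans (archi_boundP _) _; first by rewrite divr_ge0 ?ltW.
  by rewrite ler_nat leq_addr.
have h2 : `|L| / (3 - 2 * s) <= N%:R.
  apply: ltW; apply: lt_le_trans (archi_boundP _) _; first by rewrite divr_ge0 ?(ltW b0).
  by rewrite ler_nat /N addnCA leq_addr.
have h3 : 3 <= N%:R :> R by rewrite (ler_nat _ 3) /N !addnA leq_addl.
exists N; have e1 := expRN_le_inv R N.
have n0 : 0 < N.+1%:R :> R by rewrite ltr0n.
have nE : N.+1%:R = N%:R + 1 :> R by rewrite natr1.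
split.
- apply: le_trans (rho_k_le N) _.
  apply: le_trans (ler_wpM2l (ltW C60) e1) _.
  rewrite ler_pdivrMr//; move: h1; rewrite ler_pdivrMr// => h1.
  by rewrite nE mulrDr mulr1 mulrC; lra.
- apply: le_trans e1 _; rewrite div1r lef_pV2 ?posrE//; lra.
- apply: le_trans (expR_ge1Dx _); move: h2; rewrite ler_pdivrMr// => h2.
  have := ler_norm L; lra.
Qed.

(** The price of the gain is bounded in [k]: [gain ^+ (2 * T) <= exp (4 * rho * T) <= exp (1 /
    del)]. The remaining factor grows because [rho] is at most a constant times [exp (- k)]. *)
Lemma wsum_growth k T (K del W : R) : rho_k z k <= 1 / 2 -> 0 < K -> 0 < del ->
  T%:R * (4 * (rho_k z k * del)) <= 1 ->
  K * rho_k z k ^- 3 * expR (- (s * k%:R)) ^+ 2 <= gain z k ^+ (2 * T) * W ->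
  expR (- del^-1) * (K * C6 ^- 3) * expR ((3 - 2 * s) * k%:R) <= W.
Proof.
set rho := rho_k z k => rh K0 del0 Td h.
have r0 : 0 < rho := rho_gt0 zD k; have c0 := C60.
have g1 := gain_ge1 zD rh; have g0 : 0 < gain z k by lra.
have G : gain z k ^+ (2 * T) <= expR del^-1.
  apply: (@le_trans _ _ (expR (2 * rho) ^+ (2 * T))).
    by rewrite lerXn2r ?nnegrE ?expR_ge0 ?(ltW g0)//; exact: gain_le.
  rewrite -expRM_natl ler_expR -div1r ler_pdivlMr// natrM.
  by have -> : 2%:R * T%:R * (2 * rho) * del = T%:R * (4 * (rho * del)) by ring.
have W0 : 0 <= W.
  rewrite -(@pmulr_rge0 _ (gain z k ^+ (2 * T))) ?exprn_gt0//.
  apply: le_trans h; rewrite mulr_ge0 ?sqr_ge0// mulr_ge0 ?(ltW K0)//.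
  by rewrite invr_ge0 exprn_ge0// ltW.
have low : K * C6 ^- 3 * expR ((3 - 2 * s) * k%:R) <=
    K * rho ^- 3 * expR (- (s * k%:R)) ^+ 2.
  have -> : expR ((3 - 2 * s) * k%:R) =
      expR (- k%:R) ^- 3 * expR (- (s * k%:R)) ^+ 2.
    rewrite -exprVn -expRN opprK -!expRM_natl -expRD; congr expR; ring.
  rewrite mulrA; apply: ler_wpM2r; first exact: sqr_ge0.
  rewrite -mulrA; apply: ler_wpM2l; first exact: ltW.
  have hp : 0 < C6 * expR (- k%:R) := mulr_gt0 c0 (expR_gt0 _).
  rewrite -invfM -exprMn lef_pV2 ?posrE ?exprn_gt0//.
  have := rho_k_le k; rewrite -/rho => hr.
  by rewrite lerXn2r ?nnegrE ?(ltW r0) ?(le_trans (ltW r0) hr).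
have -> : expR (- del^-1) * (K * C6 ^- 3) * expR ((3 - 2 * s) * k%:R) =
    K * C6 ^- 3 * expR ((3 - 2 * s) * k%:R) / expR del^-1.
  by rewrite -[(expR del^-1)^-1]expRN; ring.
rewrite ler_pdivrMr ?expR_gt0//.
apply: le_trans low _; apply: le_trans h _; rewrite mulrC.
by apply: ler_wpM2l.
Qed.

Hypotheses (s0 : 0 < s) (s32 : s < 3 / 2).

Lemma exceptional_event (M eps : R) : 0 < eps -> exists k (A : set Omega),
  [/\ measurable A, (P A <= eps%:E)%E & forall w, ~ A w ->
    forall xs, uniq xs ->
    [set x | X w x /\ k%:R <= dh z x < k.+1%:R] = [set` xs] ->
    exists N, M < wsum (moment xs (weight z s)) 0 N].
Proof.
move=> eps0; have [u [u1 zu]] := polar_direction z.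
have Cge := annulus_const_ge1 zD.
have Cp : 0 < C by apply: lt_le_trans Cge.
have p0 : 0 < pi :> R := pi_gt0 R.
pose co := off_const; have co0 : 0 <= co.
  rewrite /co /off_const divr_ge0 ?sqr_ge0// mulr_ge0 ?sqr_ge0//.
  by rewrite mulr_ge0// ltW.
pose c1 := count_const; have c10 : 0 < c1 by rewrite divr_gt0 ?subr_gt0 ?mulr_gt0.
(* Markov's inequality at level [K * rho^-3] then leaves probability at most [eps / 2]; the summand
   1 keeps [K] positive. *)
pose K := 2 * (co + 1) / eps.
have K0 : 0 < K by rewrite divr_gt0// mulr_gt0// ltr_wpDl.
pose g := expR (- s) ^+ 2; have g0 : 0 < g by rewrite exprn_gt0 ?expR_gt0.
(* The second bound is the hypothesis of [diag_dominates]; [g] is the squared ratio of the extreme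
   weights in one annulus. *)
pose eta := Num.min (1 / 2) (g * c1 / (32 * (32 * K))).
have eta0 : 0 < eta.
  rewrite lt_min; apply/andP; split; first by rewrite divr_gt0.
  apply: divr_gt0; first exact: mulr_gt0.
  by apply: mulr_gt0 => //; exact: mulr_gt0.
have eta2 : eta <= 1 / 2 by rewrite ge_min lexx.
have etaK : eta <= g * c1 / (32 * (32 * K)) by rewrite ge_min lexx orbT.
have [d0 d4] := eta_sqr_bounds eta0 eta2.
have w0 : 0 < (1 - zeta) ^+ 2 by rewrite exprn_gt0 ?subr_gt0.
have c3 : 0 < c1 * eta ^+ 3 by rewrite mulr_gt0 ?exprn_gt0.
(* The bounds on [rho] serve, in order: the estimates for the gain, a nonnegative inner radius of
   the fat annulus, the thin sector, and a mean count [m >= 8 / eps], for which [count_lower_tail]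
   gives at most [eps / 2]. *)
pose tau := Num.min (Num.min (1 / 2) C^-1)
  (Num.min ((1 - zeta) ^+ 2 / 24) (c1 * eta ^+ 3 * (eps / 8))).
have tau0 : 0 < tau.
  have e8 : 0 < eps / 8 by rewrite divr_gt0.
  rewrite !lt_min invr_gt0 Cp andbT; apply/and3P; split; [exact: divr_gt0| |].
    exact: divr_gt0.
  exact: mulr_gt0.
pose k1 := expR (- (eta ^+ 2)^-1) * (K * (4 / (1 - zeta ^+ 2)) ^- 3).
have k10 : 0 < k1 by rewrite mulr_gt0 ?expR_gt0// mulr_gt0// invr_gt0 exprn_gt0.
(* All constants so far are independent of [k]; only the truncation [T] depends on it. The level
   [M + 1] makes the final inequality strict. *)
have [k [rtau k4 Lk]] := large_index ((M + 1) / k1) tau0 s32.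
set rho := rho_k z k in rtau; have r0 : 0 < rho := rho_gt0 zD k.
move: rtau; rewrite !le_min => /andP[/andP[rh rC] /andP[r24 rc]].
have Cr : C * rho <= 1 by rewrite mulrC -ler_pdivlMr ?div1r.
have rd8 : rho * eta ^+ 2 <= 1 / 8.
  have : rho * eta ^+ 2 <= (1 / 2) * (1 / 4) by rewrite ler_pM// ltW.
  lra.
have [T [T1 T2]] := half_inverse (mulr_gt0 r0 d0) rd8.
have [m [mE mge]] := intensity_thin_sector u1 zu eta0 eta2 k4 r24.
have m8 : 8 / eps <= m.
  apply: le_trans mge; rewrite ler_pdivlMr//.
  have e8 : 0 <= 8 / eps by rewrite divr_ge0// ltW.
  apply: le_trans (ler_wpM2l e8 rc) _.
  have e (c : R) : 8 / eps * (c * (eps / 8)) = c by field; rewrite gt_eqF.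
  by rewrite e.
have m0 : 0 < m by apply: lt_le_trans m8; rewrite divr_gt0.
pose Y := lower_pair_sum X (fat_annulus z k) (kerH (gain z k) T).
have mY : measurable_fun setT Y.
  by apply: (measurable_lower_pair_sum HX); [exact: measurable_fat_annulus|
    exact: rel_compact_fat_annulus].
have Y0 w : (0 <= Y w)%E by apply: lower_pair_sum_ge0; exact: kerH_ge0.
have K30 : 0 < K * rho ^- 3 by rewrite mulr_gt0// invr_gt0 exprn_gt0.
have [mA1 PA1] := tail_le mY Y0 K30 (expected_off_diagonal_le T Cr rh).
have [mA2 PA2] := count_lower_tail HX (measurable_thin_sector k u eta)
  (rel_compact_thin_sector u1 zu eta0 eta2 k4 r24) m0 mE.
set A1 := [set w | _] in mA1 PA1; set A2 := [set w | _] in mA2 PA2.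
exists k, (A1 `|` A2); split.
- exact: measurableU.
- apply: (@le_trans _ _ (P A1 + P A2)%E).
    by apply: measureU2.
  apply: (@le_trans _ _ ((eps / 2)%:E + (eps / 2)%:E)%E); last first.
    by rewrite -EFinD lee_fin; lra.
  apply: leeD; [apply: le_trans PA1 _|apply: le_trans PA2 _]; rewrite lee_fin.
    rewrite ler_pdivrMr// mulrA; apply: ler_wpM2r.
      by rewrite invr_ge0 exprn_ge0// ltW.
    have -> : eps / 2 * K = co + 1 by rewrite /K; field; rewrite gt_eqF.
    by rewrite lerDl.
  rewrite ler_pdivrMr//; move: m8; rewrite ler_pdivrMr// => m8.
  have -> : eps / 2 * m = m * eps / 2 by ring.
  lra.
move=> w /not_orP[/negP nA1 /negP nA2] xs uxs xsE.
have cX : is_conf (X w) by have [] := HX.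
have xsA x : x \in xs -> diskD x /\ k%:R <= dh z x < k.+1%:R.
  move=> xx; have : [set` xs] x by [].
  by rewrite -xsE => -[Xx dx]; split => //; have [XD _] := cX; exact: XD.
pose B := thin_sector z k u (eta ^+ 2).
have nB : m / 2 <= (size [seq x <- xs | `[< B x >]])%:R.
  have e : X w `&` B = [set` [seq x <- xs | `[< B x >]]].
    apply/seteqP; split => x /=.
      move=> [Xx Bx]; rewrite mem_filter; apply/andP; split; first exact/asboolP.
      have : [set` xs] x; last by [].
      rewrite -xsE; split => //.
      exact: (thin_sector_annulus zD u1 zu d0 d4 k4 r24 Bx).
    rewrite mem_filter => /andP[/asboolP Bx xx]; split => //.
    by have : [set` xs] x by []; rewrite -xsE => -[].
  by move: nA2; rewrite /A2 /= (ncountE _ e) ?filter_uniq// -leNgt lee_fin.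
have off : \sum_(x <- xs) \sum_(y <- xs | y != x) kerH (gain z k) T x y <=
    K * rho ^- 3.
  rewrite -lee_fin; apply: (@le_trans _ _ (Y w)); last first.
    by move: nA1; rewrite /A1 /= -ltNge => /ltW.
  apply: lower_pair_sum_ge => //.
  - exact: rel_compact_fat_annulus.
  - exact: kerH_ge0.
  - exact: kerH_lsc.
  - move=> x xx; have [xD dx] := xsA x xx.
    split; last exact: annulus_sub_fat.
    by have : [set` xs] x by []; rewrite -xsE => -[].
exists (2 * T)%N; apply: (@lt_le_trans _ _ (M + 1)); first by rewrite ltrDl.
apply: (@le_trans _ _ (k1 * expR ((3 - 2 * s) * k%:R))).
  by rewrite mulrC -ler_pdivrMr.
apply: (wsum_growth rh K0 d0 T1).
apply: le_trans (wsum_lower zD s0 rh d0 d4 T1 uxs xsA nB off).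
have -> : expR (- (s * k.+1%:R)) ^+ 2 = expR (- (s * k%:R)) ^+ 2 * g.
  rewrite /g -exprMn -expRD; congr (expR _ ^+ 2).
  by rewrite -natr1; ring.
by apply: (@diag_dominates _ _ g rho eta c1 K T%:R m) => //; exact: sqr_ge0.
Qed.

End Assembly.

(** * Probability zero *)

Section Conclusion.
Context (R : realType) (d : measure_display) (Omega : measurableType d).
Context (P : probability Omega R) (X : Omega -> set (R * R)).
Hypothesis HX : bergman_dpp P X.
Context (z : R * R).
Hypothesis zD : diskD z.
Variable s : R.
Hypotheses (s0 : 0 < s) (s32 : s < 3 / 2).

(** Natural bounds [M] make the union over them countable. Quantifying over all enumerations [xs] of
    the annulus points avoids a choice of enumeration for each outcome. *)
Definition bounded_blocks (M : nat) : set Omega :=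
  [set w | forall k xs, uniq xs ->
     [set x | X w x /\ k%:R <= dh z x < k.+1%:R] = [set` xs] ->
     forall N, wsum (moment xs (weight z s)) 0 N <= M%:R].

(** [E] need not be measurable: the covers for [eps = 1 / (n+1)] are intersected into one measurable
    null set that contains it. *)
Lemma negligible_small (E : set Omega) :
  (forall eps : R, 0 < eps -> exists A, [/\ measurable A, (P A <= eps%:E)%E & E `<=` A]) ->
  P.-negligible E.
Proof.
move=> h.
have hn (n : nat) : exists A, [/\ measurable A, (P A <= (n.+1%:R^-1)%:E)%E & E `<=` A].
  by apply: h; rewrite invr_gt0 ltr0n.
have [A hA] := choice hn.
have mA : measurable (\bigcap_n A n) by apply: bigcap_measurable => // n _; have [] := hA n.
exists (\bigcap_n A n); split => //; last by move=> w Ew n _; have [_ _] := hA n; exact.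
apply/eqP; rewrite eq_le measure_ge0 andbT.
apply/lee_addgt0Pr => e e0; rewrite add0e.
have [n ne] : exists n : nat, n.+1%:R^-1 <= e.
  exists (Num.bound e^-1); rewrite -[leRHS]invrK lef_pV2 ?posrE ?invr_gt0//.
  apply: ltW; apply: lt_le_trans (archi_boundP _) _; first by rewrite invr_ge0 ltW.
  by rewrite ler_nat leqnSn.
have [mAn PAn _] := hA n.
apply: (@le_trans _ _ (P (A n))); last by apply: le_trans PAn _; rewrite lee_fin.
by apply: le_measure; rewrite ?inE//; exact: bigcap_inf.
Qed.

Lemma negligible_bounded_blocks M : P.-negligible (bounded_blocks M).
Proof.
apply: negligible_small => eps eps0.
have [k [A [mA PA hA]]] := exceptional_event HX zD s0 s32 M%:R eps0.
exists A; split => // w bw; apply: contrapT => nA.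
have cX : is_conf (X w) by have [] := HX.
have [xs [uxs xsE]] := annulus_points zD cX k.
have [N hN] := hA w nA xs uxs xsE.
by have := bw k xs uxs xsE N; rewrite leNgt hN.
Qed.

Lemma convergent_bounded_blocks w :
  (forall f, bergman f -> cseries_converges (block (X w) z s f)) ->
  exists M, bounded_blocks M w.
Proof.
move=> hw; have cX : is_conf (X w) by have [] := HX.
have [xs hxs] := choice (annulus_points zD cX).
have [M hM] := convergent_wsum_bounded zD cX (fun k => (hxs k).1)
  (fun k => (hxs k).2) hw.
exists M => k ys uys ysE N.
have -> : moment ys (weight z s) = moment (xs k) (weight z s).
  apply/funext => n; rewrite /moment; apply: perm_big.
  apply: uniq_perm => //; first exact: (hxs k).1.
  move=> x; have e : [set` ys] x = [set` xs k] x by rewrite -ysE -(hxs k).2.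
  by apply/idP/idP => h; [have : [set` xs k] x by rewrite -e|
    have : [set` ys] x by rewrite e].
exact: hM.
Qed.

End Conclusion.

Theorem theorem1p1 (R : realType) (d : measure_display) (Omega : measurableType d)
  (P : probability Omega R) (X : Omega -> set (R * R))
  (HX : bergman_dpp P X)
  (s : R) (hs : 1 < s < 3 / 2) (z : R * R) (hz : diskD z) :
  P.-negligible
    [set w | forall f : R * R -> R[i], bergman f ->
                cseries_converges (block (X w) z s f)].
Proof.
move: hs => /andP[s1 s32]; have s0 : 0 < s by apply: lt_trans s1.
have N := negligible_bigcup (negligible_bounded_blocks HX hz s0 s32).
apply: negligibleS N => w /= /(convergent_bounded_blocks HX hz)[M hM].
by exists M.
Qed.
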